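(* There is a polynomial-time algorithm which, given a finite graph $G$ that contains none of $P_9$, $C_3$, $C_5$ as an induced subgraph, decides whether $G$ is $3$-colourable, and outputs a $3$-colouring of $G$ if one exists.
   Context: Graphs are finite and simple. $P_9$ denotes the path on $9$ vertices and $C_\ell$ the cycle of length $\ell$. A $3$-colouring is an assignment of colours from $\{1,2,3\}$ to all the vertices such that adjacent vertices receive distinct colours. Polynomial time means polynomial in the size of $G$. *)

(* Defs.v *)
From HB Require Import structures.
From mathcomp Require Import all_boot.

Set Implicit Arguments.
Unset Strict Implicit.
Unset Printing Implicit Defensive.

Record sgraph (V : finType) := SGraph {
  adj :> rel V;
  adj_sym : symmetric adj;
  adj_irr : irreflexive adj }.

Definition has_induced (U V : finType) (H : sgraph U) (G : sgraph V) : Prop :=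
  exists f : U -> V, injective f /\ forall x y, G (f x) (f y) = H x y.

Definition path_adj (m : nat) : rel 'I_m :=
  fun i j => (i.+1 == j :> nat) || (j.+1 == i :> nat).

Lemma path_adj_sym m : symmetric (@path_adj m).
Proof. by move=> i j; rewrite /path_adj orbC. Qed.

Lemma path_adj_irr m : irreflexive (@path_adj m).
Proof. by move=> i; rewrite /path_adj orbb; apply/negbTE; rewrite neq_ltn ltnSn orbT. Qed.

Definition path_graph (m : nat) : sgraph 'I_m :=
  SGraph (@path_adj_sym m) (@path_adj_irr m).

(* [i != j] only matters for the degenerate case m = 1. *)
Definition cycle_adj (m : nat) : rel 'I_m :=
  fun i j => (i != j) && ((ordS i == j) || (ordS j == i)).

Lemma cycle_adj_sym m : symmetric (@cycle_adj m).
Proof. by move=> i j; rewrite /cycle_adj eq_sym orbC. Qed.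

Lemma cycle_adj_irr m : irreflexive (@cycle_adj m).
Proof. by move=> i; rewrite /cycle_adj eqxx. Qed.

(* The cycle of length m, for m >= 3. *)
Definition cycle_graph (m : nat) : sgraph 'I_m :=
  SGraph (@cycle_adj_sym m) (@cycle_adj_irr m).

Definition is_3colouring (V : finType) (G : sgraph V) (c : V -> 'I_3) : Prop :=
  forall x y, G x y -> c x != c y.

Definition three_colourable (V : finType) (G : sgraph V) : Prop :=
  exists c : V -> 'I_3, is_3colouring G c.

(* Model of computation: the random access machine of Cook and Reckhow (Time
   bounded random access machines, 1973), with unit cost per instruction.
   Multiplication is not primitive, so that polynomial time on this machine
   coincides with polynomial time on Turing machines.  Registers hold natural
   numbers and subtraction is truncated at 0. *)
Inductive instr :=
  | Const of nat & nat       (* Const i c    : X_i <- c                       *)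
  | Add of nat & nat & nat   (* Add i j k    : X_i <- X_j + X_k               *)
  | Sub of nat & nat & nat   (* Sub i j k    : X_i <- X_j - X_k               *)
  | LoadAt of nat & nat      (* LoadAt i j   : X_i <- X_(X_j)                 *)
  | StoreAt of nat & nat     (* StoreAt i j  : X_(X_i) <- X_j                 *)
  | JumpPos of nat & nat     (* JumpPos l j  : goto l if X_j > 0              *)
  | Read of nat              (* Read i       : X_i <- next input (0 if none)  *)
  | Write of nat.            (* Write i      : append X_i to the output       *)

Definition program := seq instr.

Record config := Config {
  pc : nat;
  reg : nat -> nat;
  input : seq nat;
  output : seq nat }.

Definition upd (r : nat -> nat) (i v : nat) : nat -> nat :=
  fun j => if j == i then v else r j.

Definition exec_instr (a : instr) (s : config) : config :=
  let: Config l r x y := s in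
  match a with
  | Const i c => Config l.+1 (upd r i c) x y
  | Add i j k => Config l.+1 (upd r i (r j + r k)) x y
  | Sub i j k => Config l.+1 (upd r i (r j - r k)) x y
  | LoadAt i j => Config l.+1 (upd r i (r (r j))) x y
  | StoreAt i j => Config l.+1 (upd r (r i) (r j)) x y
  | JumpPos m j => Config (if 0 < r j then m else l.+1) r x y
  | Read i => Config l.+1 (upd r i (head 0 x)) (behead x) y
  | Write i => Config l.+1 r x (rcons y (r i))
  end.

Definition halted (p : program) (s : config) : bool := size p <= pc s.

(* Halted configurations are fixed points, so the t of [outputs_within] is an
   upper bound on the number of executed instructions. *)
Definition step (p : program) (s : config) : config :=
  if onth p (pc s) is Some a then exec_instr a s else s.

Definition init (x : seq nat) : config := Config 0 (fun=> 0) x [::].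

Definition outputs_within (p : program) (x y : seq nat) (t : nat) : Prop :=
  let s := iter t (step p) (init x) in halted p s /\ output s = y.

(* The number of vertices, followed by the adjacency matrix row by row. *)
Definition encode_graph (n : nat) (G : sgraph 'I_n) : seq nat :=
  n :: [seq nat_of_bool (G i j) | i <- enum 'I_n, j <- enum 'I_n].

(* Colours are written as 1, 2, 3. *)
Definition encode_colouring (n : nat) (c : 'I_n -> 'I_3) : seq nat :=
  [seq (c i).+1 | i <- enum 'I_n].

(* The first number written is the yes/no answer. *)
Definition correct_answer (n : nat) (G : sgraph 'I_n) (y : seq nat) : Prop :=
  (exists2 c, is_3colouring G c & y = 1 :: encode_colouring c) \/
  (~ three_colourable G /\ y = [:: 0]).

(* Main.v *)
(* Work in one component at a time. A bipartite component is 2-coloured. Otherwise a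
   shortest odd cycle C of it has length 7 or 9. If it has length 9, then every vertex
   has a neighbour on C, so that a colouring of C leaves at most two colours
   everywhere. If it has length 7, then a vertex with a neighbour on C either has
   exactly one (a pendant) or has the two neighbours of some c_i (a clone of c_i).
   The vertices at distance at least 2 from C are of three sorts:
   - edges among them span bipartite components attached to clones only, and each
     such component can be folded onto an edge of C;
   - some others have all their neighbours adjacent to a single c_i, and can be
     folded onto c_i;
   - any other such y has a pair of neighbours of one of 28 kinds, and the absence of
     an induced P9 yields 6 vertices that meet the neighbourhoods of all y of a kind.
   So after guessing the colours of C and of boundedly many further vertices, at most
   two colours are left everywhere, and the 2-list colouring instance is solved by
   propagation with one level of backtracking. The machine tries all guesses (t, a)
   of 175 coloured vertices without knowing C, and keeps the colouring obtained on
   those components on which the propagation succeeds. *)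

Require Import Defs.
From mathcomp Require Import all_boot.
From mathcomp Require Import zify.

Set Implicit Arguments.
Unset Strict Implicit.
Unset Printing Implicit Defensive.

(** * A structured language compiled to the random access machine *)

(** The obstacle is that the candidate colours must be computed from the guess alone, by one rule
    that fits bipartite components and those with a 7-cycle or a 9-cycle. Hence folding is tested
    only against the first seven guessed vertices, and only the first and the last possible target
    are retained; the finite checks show that these two never force equal colours on the ends of an
    edge. No guess has to be recognised as good. An attempt alters the stored colouring only on
    components that it colours completely and properly, and never uncolours a vertex. So every guess
    preserves soundness, and completeness asks for one good guess for each component separately. A
    cycle of length 11 or more is shortened by a chord among nine consecutive vertices, since
    otherwise these induce [P9]; this is why only lengths 7 and 9 occur. The case analyses around a
    cycle become finite computations because most non-edges near it are forced: an additional edge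
    would close an odd walk of length at most 5, or at most 7 around a 9-cycle. *)

Definition mem := nat -> nat -> nat.

Definition mset (m : mem) (a i v : nat) : mem :=
  fun b => if b == a then upd (m a) i v else m b.

Inductive exp :=
  | Cst of nat
  | Dim
  | Cell of nat & exp
  | Plus of exp & exp
  | Minus of exp & exp.

(* In [For a b c] the loop index is held in cell 0 of array a, and b = None
   stands for the bound n, the first number of the input. *)
Inductive cmd :=
  | Skip
  | Sto of nat & exp & exp
  | Then of cmd & cmd
  | Ifp of exp & cmd & cmd
  | For of nat & option nat & cmd
  | Rd of nat & exp
  | Wr of exp.

Definition state : Type := mem * seq nat * seq nat.

Section Language.
Variable n : nat.

Fixpoint value (e : exp) (m : mem) : nat :=
  match e with
  | Cst c => c
  | Dim => n
  | Cell a e => m a (value e m)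
  | Plus e1 e2 => value e1 m + value e2 m
  | Minus e1 e2 => value e1 m - value e2 m
  end.

Definition bound (b : option nat) : nat := odflt n b.

Fixpoint run (c : cmd) (s : state) : state :=
  let: (m, x, y) := s in
  match c with
  | Skip => s
  | Sto a e1 e2 => (mset m a (value e1 m) (value e2 m), x, y)
  | Then c1 c2 => run c2 (run c1 s)
  | Ifp e c1 c2 => if 0 < value e m then run c1 s else run c2 s
  | For a b c =>
      foldl (fun s i => run c (mset s.1.1 a 0 i, s.1.2, s.2)) s
            (iota 0 (bound b))
  | Rd a e => (mset m a (value e m) (head 0 x), behead x, y)
  | Wr e => (m, x, rcons y (value e m))
  end.

Fixpoint ecost (e : exp) : nat :=
  match e with
  | Cst _ => 1
  | Dim => 2
  | Cell _ e => ecost e + 9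
  | Plus e1 e2 | Minus e1 e2 => ecost e1 + ecost e2 + 1
  end.

(** Both branches of a test are charged, so that the bound depends on [n] only and not on the
    state. *)
Fixpoint cost (c : cmd) : nat :=
  match c with
  | Skip => 0
  | Sto _ e1 e2 => ecost e1 + ecost e2 + 9
  | Then c1 c2 => cost c1 + cost c2
  | Ifp e c1 c2 => ecost e + cost c1 + cost c2 + 3
  | For _ b c => bound b * (cost c + 7) + 5
  | Rd _ e => ecost e + 10
  | Wr e => ecost e + 1
  end.

End Language.

(** Only the nesting of loops matters for the degree. Sums of exponents stand in for maxima, as any
    polynomial will do. *)
Lemma cost_poly c : exists A D, forall n, cost n c <= A * n.+1 ^ D.
Proof.
have mono A D D' n : D <= D' -> A * n.+1 ^ D <= A * n.+1 ^ D'.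
  by move=> le; rewrite leq_mul2l leq_pexp2l ?orbT.
elim: c => [|a e1 e2|c1 [A1 [D1 H1]] c2 [A2 [D2 H2]]
  |e c1 [A1 [D1 H1]] c2 [A2 [D2 H2]]|a b c [A [D H]]|a e|e].
- by exists 0, 0.
- by exists (ecost e1 + ecost e2 + 9), 0 => n; rewrite expn0 muln1.
- exists (A1 + A2), (D1 + D2) => n /=; rewrite mulnDl leq_add //.
    by apply: leq_trans (H1 n) _; rewrite mono ?leq_addr.
  by apply: leq_trans (H2 n) _; rewrite mono ?leq_addl.
- exists (ecost e + 3 + A1 + A2), (D1 + D2) => n /=.
  have -> : ecost e + cost n c1 + cost n c2 + 3 =
    ecost e + 3 + cost n c1 + cost n c2 by lia.
  rewrite !mulnDl; apply: leq_add; first apply: leq_add; first apply: leq_add.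
  + by rewrite leq_pmulr ?expn_gt0.
  + by rewrite leq_pmulr ?expn_gt0.
  + by apply: leq_trans (H1 n) _; rewrite mono ?leq_addr.
  by apply: leq_trans (H2 n) _; rewrite mono ?leq_addl.
- exists (odflt 1 b * (A + 7) + 5), D.+1 => n /=.
  rewrite mulnDl leq_add ?leq_pmulr ?expn_gt0 //.
  have le1 : bound n b <= odflt 1 b * n.+1.
    by case: b => [k|] /=; rewrite ?mul1n // leq_pmulr.
  have le2 : cost n c + 7 <= (A + 7) * n.+1 ^ D.
    by rewrite mulnDl leq_add // leq_pmulr ?expn_gt0.
  by rewrite expnS -mulnA (mulnCA (A + 7)) mulnA leq_mul.
- by exists (ecost e + 10), 0 => n; rewrite expn0 muln1.
- by exists (ecost e + 1), 0 => n; rewrite expn0 muln1.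
Qed.

(* Even registers are temporaries, register 0 holding n; cell i of array a < 32
   lives in the odd register 64 i + 2 a + 1. *)
Definition tmp (d : nat) : nat := d.*2.
Definition cell (a i : nat) : nat := i * 64 + a.*2.+1.

(** Six doublings multiply by 64, as the machine has no multiplication; adding 2 a + 1 then gives
    the register of the cell. *)
Definition addr_code (d a : nat) : program :=
  nseq 6 (Add (tmp d) (tmp d) (tmp d)) ++
  [:: Const (tmp d.+1) a.*2.+1; Add (tmp d) (tmp d) (tmp d.+1)].

Lemma size_addr_code d a : size (addr_code d a) = 8.
Proof. by []. Qed.

Arguments tmp : simpl never.
Arguments cell : simpl never.

(** The value is left in temporary [d], and smaller temporaries are not written. A register is
    copied by adding 0 to it. *)
Fixpoint ecode (d : nat) (e : exp) : program :=
  match e with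
  | Cst c => [:: Const (tmp d) c]
  | Dim => [:: Const (tmp d) 0; Add (tmp d) (tmp 0) (tmp d)]
  | Cell a e => ecode d e ++ addr_code d a ++ [:: LoadAt (tmp d) (tmp d)]
  | Plus e1 e2 =>
      ecode d e1 ++ ecode d.+1 e2 ++ [:: Add (tmp d) (tmp d) (tmp d.+1)]
  | Minus e1 e2 =>
      ecode d e1 ++ ecode d.+1 e2 ++ [:: Defs.Sub (tmp d) (tmp d) (tmp d.+1)]
  end.

Definition for_init (d : nat) (b : option nat) : program :=
  if b is Some k then [:: Const (tmp d) k; Const (tmp d.+1) 0]
  else [:: Const (tmp d.+1) 0; Add (tmp d) (tmp 0) (tmp d.+1)].

Lemma size_for_init d b : size (for_init d b) = 2.
Proof. by case: b. Qed.

(* The code of c placed at address o, using only temporaries from d on. *)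
Fixpoint code (o d : nat) (c : cmd) : program :=
  match c with
  | Skip => [::]
  | Sto a e1 e2 =>
      ecode d e1 ++ addr_code d a ++ ecode d.+1 e2 ++
      [:: StoreAt (tmp d) (tmp d.+1)]
  | Then c1 c2 =>
      let p1 := code o d c1 in p1 ++ code (o + size p1) d c2
  | Ifp e c1 c2 =>
      let p0 := ecode d e in
      let p2 := code (o + size p0 + 1) d c2 in
      let l := o + size p0 + 1 + size p2 + 2 in
      let p1 := code l d c1 in
      p0 ++ [:: JumpPos l (tmp d)] ++ p2 ++
      [:: Const (tmp d) 1; JumpPos (l + size p1) (tmp d)] ++ p1
  | For a b c =>
      let p := code (o + 7) d.+2 c in
      for_init d b ++
      [:: JumpPos (o + 5) (tmp d); Const (tmp d) 1;
          JumpPos (o + 11 + size p) (tmp d);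
          Const (cell a 0) 0; Add (cell a 0) (cell a 0) (tmp d.+1)] ++ p ++
      [:: Const (tmp d.+2) 1; Add (tmp d.+1) (tmp d.+1) (tmp d.+2);
          Defs.Sub (tmp d) (tmp d) (tmp d.+2); JumpPos (o + 2) (tmp d.+2)]
  | Rd a e =>
      ecode d e ++ addr_code d a ++
      [:: Read (tmp d.+1); StoreAt (tmp d) (tmp d.+1)]
  | Wr e => ecode d e ++ [:: Write (tmp d)]
  end.

Fixpoint ewf (e : exp) : bool :=
  match e with
  | Cst _ | Dim => true
  | Cell a e => (a < 32) && ewf e
  | Plus e1 e2 | Minus e1 e2 => ewf e1 && ewf e2
  end.

Fixpoint wf (c : cmd) : bool :=
  match c with
  | Skip => true
  | Sto a e1 e2 => [&& a < 32, ewf e1 & ewf e2]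
  | Then c1 c2 => wf c1 && wf c2
  | Ifp e c1 c2 => [&& ewf e, wf c1 & wf c2]
  | For a _ c => (a < 32) && wf c
  | Rd a e => (a < 32) && ewf e
  | Wr e => ewf e
  end.

(** * Simulation of commands by the machine *)

Section Simulation.
Variables (p : program) (n : nat).

Definition placed (o : nat) (q : program) : Prop :=
  forall i, i < size q -> onth p (o + i) = onth q i.

Lemma placed_cat o q1 q2 :
  placed o (q1 ++ q2) <-> placed o q1 /\ placed (o + size q1) q2.
Proof.
split=> [H|[H1 H2] i]; first split=> i ltiq.
- by rewrite H ?onth_cat ?size_cat ?ltiq ?ltn_addr.
- by rewrite -addnA H ?onth_cat ?size_cat ?ltn_add2l // ltnNge leq_addr /= addKn.
rewrite size_cat onth_cat; case: (ltnP i (size q1)) => [lt _|le lt]; first exact: H1.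
by rewrite -H2 -?addnA ?subnKC // ltn_subLR.
Qed.

Lemma placed_cons o a q :
  placed o (a :: q) <-> onth p o = Some a /\ placed o.+1 q.
Proof.
rewrite -cat1s placed_cat addn1; split=> -[H1 H2]; split=> //.
  by have := H1 0 isT; rewrite addn0.
by case=> //; rewrite addn0.
Qed.

Definition runs (s s' : config) (t : nat) : Prop :=
  exists2 k, k <= t & iter k (step p) s = s'.

Lemma runs_refl s : runs s s 0.
Proof. by exists 0. Qed.

Lemma runs_trans s2 s1 s3 t1 t2 :
  runs s1 s2 t1 -> runs s2 s3 t2 -> runs s1 s3 (t1 + t2).
Proof.
move=> [k1 le1 <-] [k2 le2 <-]; exists (k2 + k1); last by rewrite iterD.
by rewrite addnC leq_add.
Qed.

Lemma runs_le s s' t t' : t <= t' -> runs s s' t -> runs s s' t'.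
Proof. by move=> le [k lek <-]; exists k => //; apply: leq_trans lek le. Qed.

Lemma runs_instr l a r x y :
  onth p l = Some a ->
  runs (Config l r x y) (exec_instr a (Config l r x y)) 1.
Proof. by move=> H; exists 1 => //=; rewrite /step /= H. Qed.

(** Temporaries below [d] belong to the surrounding code, for instance to the counters of outer
    loops; [r0] records the values that they must keep. *)
Definition agree (d : nat) (r0 r : nat -> nat) (m : mem) : Prop :=
  [/\ r (tmp 0) = n, forall j, j < d -> r (tmp j) = r0 (tmp j) &
      forall a i, a < 32 -> r (cell a i) = m a i].

Lemma cell_inj a i a' i' : a < 32 -> a' < 32 ->
  (cell a i == cell a' i') = (a == a') && (i == i').
Proof. by rewrite /cell; lia. Qed.

Lemma agree_tmp d d' r0 r m v :
  0 < d -> d <= d' -> agree d r0 r m -> agree d r0 (upd r (tmp d') v) m.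
Proof.
move=> d0 led [H0 H1 H2]; split=> [|j ltj|a i lta]; rewrite /upd.
- by rewrite ifN ?H0 // /tmp; lia.
- by rewrite ifN ?H1 // /tmp; lia.
- by rewrite ifN ?H2 // /tmp /cell; lia.
Qed.

Lemma agree_cell d r0 r m a i v :
  a < 32 -> agree d r0 r m -> agree d r0 (upd r (cell a i) v) (mset m a i v).
Proof.
move=> lta [H0 H1 H2]; split=> [|j ltj|a' i' lta']; rewrite /upd.
- by rewrite ifN ?H0 // /tmp /cell; lia.
- by rewrite ifN ?H1 // /tmp /cell; lia.
rewrite cell_inj // /mset; case: (a' =P a) => [->|_] /=; last exact: H2.
by rewrite /upd; case: eqP => // _; apply: H2.
Qed.

Lemma agree_trans d d' r0 r1 r2 m m' : d <= d' ->
  agree d r0 r1 m -> agree d' r1 r2 m' -> agree d r0 r2 m'.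
Proof.
move=> le [_ H1 _] [K0 K1 K2]; split=> // j lt.
by rewrite K1 ?H1 //; lia.
Qed.

Lemma upd_eq r i v : upd r i v i = v.
Proof. by rewrite /upd eqxx. Qed.

Lemma tmp_neq i j : i != j -> tmp i == tmp j = false.
Proof. by rewrite /tmp; lia. Qed.

Lemma upd_tmp r i j v : i != j -> upd r (tmp j) v (tmp i) = r (tmp i).
Proof. by move=> ne; rewrite /upd tmp_neq. Qed.

Lemma addr_codeP o d d0 a m r0 r x y :
  0 < d0 -> d0 <= d -> placed o (addr_code d a) -> agree d0 r0 r m ->
  exists r', [/\ runs (Config o r x y) (Config (o + 8) r' x y) 8,
                 agree d0 r0 r' m & r' (tmp d) = cell a (r (tmp d))].
Proof.
move=> d0_gt0 led0 /placed_cat[]; rewrite size_nseq => Pa /placed_cons[P7].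
case/placed_cons=> P8 _ agr.
have dbl k : k <= 6 -> exists r', [/\
    runs (Config o r x y) (Config (o + k) r' x y) k,
    agree d0 r0 r' m & r' (tmp d) = 2 ^ k * r (tmp d)].
  elim: k => [_|k IH ltk].
    by exists r; split=> //; rewrite ?mul1n ?addn0 //; apply: runs_refl.
  have [r' [R' agr' E']] := IH (ltnW ltk).
  exists (upd r' (tmp d) (r' (tmp d) + r' (tmp d))); split.
  - rewrite -addn1 addnA addn1; apply: runs_trans R' _.
    have Pk : onth p (o + k) = Some (Add (tmp d) (tmp d) (tmp d)).
      rewrite Pa; last by rewrite size_nseq.
      by clear -ltk; case: k ltk => [|[|[|[|[|[|]]]]]].
    exact: (runs_instr _ _ _ Pk).
  - exact: agree_tmp.
  - by rewrite upd_eq E' addnn -mul2n mulnA -expnS.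
have [r' [R' agr' E']] := dbl 6 isT.
exists (upd (upd r' (tmp d.+1) a.*2.+1) (tmp d)
   (upd r' (tmp d.+1) a.*2.+1 (tmp d) + upd r' (tmp d.+1) a.*2.+1 (tmp d.+1))).
split.
- have -> : o + 8 = (o + 6).+2 by lia.
  apply: (@runs_trans _ _ _ 6 2 R').
  apply: (@runs_trans _ _ _ 1 1); first exact: (runs_instr _ _ _ P7).
  exact: (runs_instr _ _ _ P8).
- by apply: agree_tmp => //; apply: agree_tmp => //; lia.
rewrite upd_eq upd_eq {1}/upd tmp_neq ?E' /cell; last by lia.
by rewrite mulnC.
Qed.

Lemma size_ecode d e : size (ecode d e) = ecost e.
Proof.
elim: e d => [c||a e IH|e1 IH1 e2 IH2|e1 IH1 e2 IH2] d //=.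
- by rewrite !size_cat IH /=; lia.
- by rewrite !size_cat IH1 IH2 addnA.
- by rewrite !size_cat IH1 IH2 addnA.
Qed.

Local Opaque addr_code for_init.

Lemma ecodeP e o d d0 m r0 r x y :
  ewf e -> 0 < d0 -> d0 <= d -> placed o (ecode d e) -> agree d0 r0 r m ->
  exists r', [/\ runs (Config o r x y) (Config (o + ecost e) r' x y) (ecost e),
                 agree d0 r0 r' m,
                 forall j, j < d -> r' (tmp j) = r (tmp j)
               & r' (tmp d) = value n e m].
Proof.
(* Sums and differences have code of the same shape, so both cases follow from one statement about
   an arbitrary three-address instruction. *)
have binop e1 e2 (ins : nat -> nat -> nat -> instr) f o' d' d0' r0' r' :
  (forall i j k l r x y, exec_instr (ins i j k) (Config l r x y) =
     Config l.+1 (upd r i (f (r j) (r k))) x y) ->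
  (forall o d d0 r0 r, ewf e1 -> 0 < d0 -> d0 <= d ->
     placed o (ecode d e1) -> agree d0 r0 r m ->
     exists r', [/\ runs (Config o r x y) (Config (o + ecost e1) r' x y) (ecost e1),
                 agree d0 r0 r' m,
                 forall j, j < d -> r' (tmp j) = r (tmp j)
               & r' (tmp d) = value n e1 m]) ->
  (forall o d d0 r0 r, ewf e2 -> 0 < d0 -> d0 <= d ->
     placed o (ecode d e2) -> agree d0 r0 r m ->
     exists r', [/\ runs (Config o r x y) (Config (o + ecost e2) r' x y) (ecost e2),
                 agree d0 r0 r' m,
                 forall j, j < d -> r' (tmp j) = r (tmp j)
               & r' (tmp d) = value n e2 m]) ->
  ewf e1 && ewf e2 -> 0 < d0' -> d0' <= d' ->
  placed o' (ecode d' e1 ++ ecode d'.+1 e2 ++ [:: ins (tmp d') (tmp d') (tmp d'.+1)]) ->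
  agree d0' r0' r' m ->
  exists r'', [/\ runs (Config o' r' x y)
      (Config (o' + (ecost e1 + ecost e2 + 1)) r'' x y) (ecost e1 + ecost e2 + 1),
                 agree d0' r0' r'' m,
                 forall j, j < d' -> r'' (tmp j) = r' (tmp j)
               & r'' (tmp d') = f (value n e1 m) (value n e2 m)].
  move=> insE IH1 IH2 /andP[w1 w2] d0'_gt0 led /placed_cat[P1 /placed_cat[]].
  rewrite !size_ecode => P2 /placed_cons[P3 _] agr.
  have [r1 [R1 A1 K1 E1]] := IH1 _ _ _ _ _ w1 d0'_gt0 led P1 agr.
  have [|r2 [R2 A2 K2 E2]] := IH2 _ _ _ _ _ w2 d0'_gt0 _ P2 A1; first by lia.
  exists (upd r2 (tmp d') (f (r2 (tmp d')) (r2 (tmp d'.+1)))); split.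
  - apply: runs_trans (runs_trans R1 R2) _.
    by rewrite !addnA addn1 -insE; apply: runs_instr.
  - exact: agree_tmp.
  - by move=> j ltj; rewrite /upd tmp_neq ?K2 ?K1 //; lia.
  - by rewrite upd_eq E2 K2 // E1.
elim: e o d d0 r0 r => [c||a e IH|e1 IH1 e2 IH2|e1 IH1 e2 IH2] o d d0 r0 r /=.
- move=> _ d_gt0 led /placed_cons[P1 _] agr; exists (upd r (tmp d) c).
  split; last by rewrite upd_eq.
  + by rewrite addn1; apply: (runs_instr _ _ _ P1).
  + exact: agree_tmp.
  + by move=> j ltj; rewrite /upd tmp_neq //; lia.
- move=> _ d_gt0 led /placed_cons[P1 /placed_cons[P2 _]] agr.
  exists (upd (upd r (tmp d) 0) (tmp d)
           (upd r (tmp d) 0 (tmp 0) + upd r (tmp d) 0 (tmp d))); split.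
  + rewrite addn2; apply: (@runs_trans _ _ _ 1 1).
      exact: (runs_instr _ _ _ P1).
    exact: (runs_instr _ _ _ P2).
  + by do 2! [apply: agree_tmp => //].
  + by move=> j ltj; rewrite /upd tmp_neq //; lia.
  + rewrite upd_eq upd_eq addn0 /upd tmp_neq; last by lia.
    by case: agr.
- move=> /andP[lta wfe] d_gt0 led.
  case/placed_cat; rewrite size_ecode => P1 /placed_cat[P2 /placed_cons[P3 _]] agr.
  have [r1 [R1 A1 K1 E1]] := IH _ _ _ _ _ wfe d_gt0 led P1 agr.
  have agr1 : agree d r r1 m.
    by case: A1 => A10 A11 A12; split.
  have [||r2 [R2 A2 E2]] := addr_codeP x y _ _ P2 agr1 => //; first by lia.
  have A2' : agree d0 r0 r2 m.
    by apply: agree_trans led agr A2.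
  exists (upd r2 (tmp d) (r2 (r2 (tmp d)))); split.
  + apply: (@runs_le _ _ ((ecost e + 8) + 1)); first by lia.
    apply: runs_trans (runs_trans R1 R2) _.
    have -> : o + (ecost e + 9) = (o + ecost e + 8).+1 by lia.
    by apply: (runs_instr _ _ _ P3).
  + exact: agree_tmp.
  + move=> j ltj; rewrite /upd tmp_neq; last by lia.
    by case: A2 => _ ->.
  + by rewrite upd_eq E2 E1; case: A2' => _ _ ->.
- exact: binop.
- exact: binop.
Qed.

Lemma codeP c o d m r0 r x y :
  wf c -> 0 < d -> placed o (code o d c) -> agree d r0 r m ->
  exists r', let: (m', x', y') := run n c (m, x, y) in
    runs (Config o r x y) (Config (o + size (code o d c)) r' x' y') (cost n c)
    /\ agree d r0 r' m'.
Proof.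
elim: c o d m r0 r x y => [|a e1 e2|c1 IH1 c2 IH2|e c1 IH1 c2 IH2|a b c IH|a e|e]
  o d m r0 r x y /=.
- by move=> _ _ _ agr; exists r; split=> //; rewrite addn0; apply: runs_refl.
- case/and3P=> lta w1 w2 d_gt0.
  case/placed_cat; rewrite size_ecode => P1.
  case/placed_cat=> P2; rewrite size_addr_code => /placed_cat[P3].
  rewrite size_ecode => /placed_cons[P4 _] agr.
  have [r1 [R1 A1 K1 E1]] := ecodeP x y w1 d_gt0 (leqnn d) P1 agr.
  have [r2 [R2 A2 E2]] := addr_codeP x y d_gt0 (leqnn d) P2 A1.
  have [r3 [R3 A3 K3 E3]] := ecodeP x y w2 d_gt0 (leqnSn d) P3 A2.
  exists (upd r3 (r3 (tmp d)) (r3 (tmp d.+1))); split.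
    apply: (@runs_le _ _ (ecost e1 + 8 + ecost e2 + 1)); first by lia.
    apply: runs_trans (runs_trans (runs_trans R1 R2) R3) _.
    rewrite !size_cat !size_ecode /=.
    have -> : o + (ecost e1 + (8 + (ecost e2 + 1))) = (o + ecost e1 + 8 + ecost e2).+1.
      by lia.
    exact: (runs_instr _ _ _ P4).
  by rewrite K3 // E2 E1 E3; apply: agree_cell.
- case/andP=> w1 w2 d_gt0 /placed_cat[P1 P2] agr.
  have [r1] := IH1 _ _ _ _ _ x y w1 d_gt0 P1 agr.
  case: (run n c1 _) => -[m1 x1] y1 [R1 A1].
  have [r2] := IH2 _ _ _ _ _ x1 y1 w2 d_gt0 P2 A1.
  case: (run n c2 _) => -[m2 x2] y2 [R2 A2].
  exists r2; split=> //; rewrite size_cat addnA.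
  exact: runs_trans R1 R2.
- case/and3P=> we w1 w2 d_gt0 /placed_cat[P1]; rewrite size_ecode => P2.
  have := P2; rewrite -cat1s => /placed_cat[/placed_cons[P2' _]] /placed_cat[P3].
  case/placed_cons=> P4 /placed_cons[P5 P6] agr.
  set l := o + ecost e + 1 + _ + 2 in P2 P2' P5 P6 *.
  have [r1 [R1 A1 K1 E1]] := ecodeP x y we d_gt0 (leqnn d) P1 agr.
  have J := runs_instr r1 x y P2'.
  case: (ltnP 0 (value n e m)) => [v_gt0|].
    have [|r2] := IH1 l _ _ _ _ x y w1 d_gt0 _ A1.
      move=> i lti; rewrite -P6 //; congr (onth p (_ + i)).
      by rewrite /l /=; lia.
    case: (run n c1 _) => -[m2 x2] y2 [R2 A2]; exists r2; split=> //.
    move: J; rewrite /= E1 v_gt0 => J.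
    apply: (@runs_le _ _ (ecost e + 1 + cost n c1)); first by lia.
    apply: runs_trans (runs_trans R1 J) _.
    suff -> : o + size (ecode d e ++ JumpPos l (tmp d) :: code (o + ecost e + 1) d c2
       ++ [:: Const (tmp d) 1, JumpPos (l + size (code l d c1)) (tmp d)
            & code l d c1]) = l + size (code l d c1) by [].
    by rewrite !(size_cat, size_ecode) /= size_cat /= /l; lia.
  rewrite leqn0 => /eqP v0.
  move: J; rewrite /= E1 v0 /= => J.
  rewrite -addn1 in J.
  have [r2] := IH2 _ _ _ _ _ x y w2 d_gt0 P3 A1.
  case: (run n c2 _) => -[m2 x2] y2 [R2 A2].
  exists (upd r2 (tmp d) 1); split; last exact: agree_tmp.
  apply: (@runs_le _ _ (ecost e + 1 + cost n c2 + 1 + 1)); first by lia.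
  apply: runs_trans (runs_trans (runs_trans (runs_trans R1 J) R2) _) _.
    exact: (runs_instr _ _ _ P4).
  have := runs_instr (upd r2 (tmp d) 1) x2 y2 P5; rewrite /= upd_eq /=.
  congr runs; congr Config.
  by rewrite !(size_cat, size_ecode) /= size_cat /= /l; lia.
- case/andP=> lta wfc d_gt0.
  set q := code (o + 7) d.+2 c.
  case/placed_cat=> Pi; rewrite size_for_init.
  case/placed_cons=> J1 /placed_cons[I2 /placed_cons[J2 /placed_cons[I3]]].
  case/placed_cons=> I4 /placed_cat[Pc].
  case/placed_cons=> I5 /placed_cons[I6 /placed_cons[I7 /placed_cons[J3 _]]] agr.
  have endE : o + size (for_init d b ++
    [:: JumpPos (o + 5) (tmp d), Const (tmp d) 1,
          JumpPos (o + 11 + size q) (tmp d),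
          Const (cell a 0) 0, Add (cell a 0) (cell a 0) (tmp d.+1) & q ++
      [:: Const (tmp d.+2) 1; Add (tmp d.+1) (tmp d.+1) (tmp d.+2);
          Defs.Sub (tmp d) (tmp d) (tmp d.+2); JumpPos (o + 2) (tmp d.+2)]])
    = o + 11 + size q.
    by rewrite size_cat size_for_init /= size_cat /=; lia.
  rewrite endE.
  have [r1 [R1 A1 Ed Ed1]] : exists r1, [/\
      runs (Config o r x y) (Config (o + 2) r1 x y) 2, agree d r0 r1 m,
      r1 (tmp d) = bound n b & r1 (tmp d.+1) = 0].
    Local Transparent for_init.
    case: b Pi {endE} => [k|] /placed_cons[I0 /placed_cons[I1 _]].
      exists (upd (upd r (tmp d) k) (tmp d.+1) 0).
      split; [|by do 2! [apply: agree_tmp => //]; lia| |by rewrite upd_eq].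
        rewrite addn2; apply: (@runs_trans _ _ _ 1 1).
          exact: (runs_instr _ _ _ I0).
        exact: (runs_instr _ _ _ I1).
      by rewrite /upd tmp_neq ?eqxx //; lia.
    pose r1 := upd r (tmp d.+1) 0.
    exists (upd r1 (tmp d) (r1 (tmp 0) + r1 (tmp d.+1))).
    have A1 : agree d r0 r1 m by apply: agree_tmp => //; lia.
    split; [|by apply: agree_tmp| |].
    - rewrite addn2; apply: (@runs_trans _ _ _ 1 1).
        exact: (runs_instr _ _ _ I0).
      exact: (runs_instr _ _ _ I1).
    - by rewrite upd_eq {2}/r1 upd_eq addn0; case: A1.
    - by rewrite /upd tmp_neq /r1 ?upd_eq //; lia.
  (* The counter of remaining rounds runs down while the index runs up, so the induction on [k]
     needs [i] arbitrary. *)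
  have loop k i r2 m2 x2 y2 : agree d r0 r2 m2 -> r2 (tmp d) = k ->
    r2 (tmp d.+1) = i ->
    exists r', let: (m', x', y') := foldl
        (fun s i => run n c (mset s.1.1 a 0 i, s.1.2, s.2)) (m2, x2, y2) (iota i k) in
      runs (Config (o + 2) r2 x2 y2) (Config (o + 11 + size q) r' x' y')
         (k * (cost n c + 7) + 3) /\ agree d r0 r' m'.
    elim: k i r2 m2 x2 y2 => [|k IHk] i r2 m2 x2 y2 A2 Ek Ei /=.
      exists (upd r2 (tmp d) 1); split; last exact: agree_tmp.
      apply: (@runs_trans _ _ _ 1 2).
        by have := runs_instr r2 x2 y2 J1; rewrite /= Ek /=; apply.
      apply: (@runs_trans _ _ _ 1 1); first exact: (runs_instr _ _ _ I2).
      by have := runs_instr (upd r2 (tmp d) 1) x2 y2 J2; rewrite /= upd_eq.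
    pose r3 := upd r2 (cell a 0) 0.
    pose r4 := upd r3 (cell a 0) (r3 (cell a 0) + r3 (tmp d.+1)).
    have cellN j : tmp j == cell a 0 = false by rewrite /tmp /cell; lia.
    have E4 : r3 (cell a 0) + r3 (tmp d.+1) = i.
      by rewrite {1}/r3 upd_eq /r3 /upd cellN.
    have K4 j : r4 (tmp j) = r2 (tmp j) by rewrite /r4 /r3 /upd !cellN.
    have R4 : runs (Config (o + 2) r2 x2 y2) (Config (o + 7) r4 x2 y2) 3.
      apply: (@runs_trans _ _ _ 1 2).
        by have := runs_instr r2 x2 y2 J1; rewrite /= Ek /=; apply.
      have -> : o + 5 = (o + 2).+3 by lia.
      apply: (@runs_trans _ _ _ 1 1); first exact: (runs_instr _ _ _ I3).
      have -> : o + 7 = (o + 2).+3.+2 by lia.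
      exact: (runs_instr _ _ _ I4).
    (* The reference registers are renewed here, which obliges the body to preserve the counter and
       the index of this loop. *)
    have A4 : agree d.+2 r4 r4 (mset m2 a 0 i).
      case: A2 => A20 A21 A22; split=> [|//|a' i' lta']; first by rewrite K4.
      rewrite /r4 E4 /upd cell_inj // /mset; case: (a' =P a) => [->|ne] /=.
        rewrite /upd; case: (i' =P 0) => // ne'.
        by rewrite /r3 /upd cell_inj // eqxx /=; case: eqP => // _; rewrite A22.
      by rewrite /r3 /upd cell_inj //; case: (a' =P a) ne => //= _ _; rewrite A22.
    have [||r5] := IH (o + 7) _ _ _ _ x2 y2 wfc _ _ A4 => //.
      move=> j ltj; rewrite -/q -Pc //; congr (onth p (_ + j)); lia.
    rewrite -/q; case: (run n c _) => -[m5 x5] y5 [R5 A5].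
    have K5 j : j < d.+2 -> r5 (tmp j) = r2 (tmp j).
      by move=> ltj; case: A5 => _ -> //; rewrite K4.
    pose r6 := upd r5 (tmp d.+2) 1.
    pose r7 := upd r6 (tmp d.+1) (r6 (tmp d.+1) + r6 (tmp d.+2)).
    pose r8 := upd r7 (tmp d) (r7 (tmp d) - r7 (tmp d.+2)).
    have E82 : r8 (tmp d.+2) = 1.
      by rewrite /r8 upd_tmp ?/r7 1?upd_tmp ?/r6 ?upd_eq //; lia.
    have A8 : agree d r0 r8 m5.
      do 3! [apply: agree_tmp => //]; try lia.
      case: A5 => A50 A51 A52; split=> // j ltj; rewrite K5 ?(ltn_trans ltj) //.
      by case: A2 => _ ->.
    have E8 : r8 (tmp d) = k.
      rewrite /r8 upd_eq /r7 upd_tmp; last by lia.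
      rewrite [X in _ - X]upd_tmp; last by lia.
      rewrite /r6 upd_eq upd_tmp; last by lia.
      by rewrite K5 ?Ek ?subn1 //; lia.
    have E81 : r8 (tmp d.+1) = i.+1.
      rewrite /r8 upd_tmp; last by lia.
      rewrite /r7 upd_eq /r6 upd_eq upd_tmp; last by lia.
      by rewrite K5 ?Ei ?addn1 //; lia.
    have [r'] := IHk i.+1 r8 m5 x5 y5 A8 E8 E81.
    case: (foldl _ _ _) => -[m' x'] y' [R' A']; exists r'; split=> //.
    apply: (@runs_le _ _ (3 + cost n c + 4 + (k * (cost n c + 7) + 3))).
      by rewrite mulSn; lia.
    apply: runs_trans R'; apply: runs_trans (runs_trans R4 R5) _.
    have -> : o + 7 + size q = (o + 2).+4.+1 + size q by lia.
    apply: (@runs_trans _ _ _ 1 3); first exact: (runs_instr _ _ _ I5).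
    apply: (@runs_trans _ _ _ 1 2); first exact: (runs_instr _ _ _ I6).
    apply: (@runs_trans _ _ _ 1 1); first exact: (runs_instr _ _ _ I7).
    by have := runs_instr r8 x5 y5 J3; rewrite /= E82; apply.
  have [r'] := loop _ _ _ _ x y A1 Ed Ed1.
  case: (foldl _ _ _) => -[m' x'] y' [R' A']; exists r'; split=> //.
  apply: (@runs_le _ _ (2 + (bound n b * (cost n c + 7) + 3))); first by lia.
  exact: runs_trans R1 R'.
- case/andP=> lta we d_gt0.
  case/placed_cat; rewrite size_ecode => P1.
  case/placed_cat=> P2; rewrite size_addr_code => /placed_cons[P3 /placed_cons[P4 _]] agr.
  have [r1 [R1 A1 K1 E1]] := ecodeP x y we d_gt0 (leqnn d) P1 agr.
  have [r2 [R2 A2 E2]] := addr_codeP x y d_gt0 (leqnn d) P2 A1.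
  pose r3 := upd r2 (tmp d.+1) (head 0 x).
  exists (upd r3 (r3 (tmp d)) (r3 (tmp d.+1))); split.
    apply: (@runs_le _ _ (ecost e + 8 + 1 + 1)); first by lia.
    rewrite !size_cat !size_ecode /=.
    have -> : o + (ecost e + 10) = (o + ecost e + 8).+2 by lia.
    apply: runs_trans (runs_trans (runs_trans R1 R2) _) _.
      exact: (runs_instr _ _ _ P3).
    exact: (runs_instr _ _ _ P4).
  have E3 : r3 (tmp d) = cell a (value n e m).
    by rewrite /r3 /upd tmp_neq ?E2 ?E1 //; lia.
  by rewrite E3 /r3 upd_eq; apply: agree_cell => //; apply: agree_tmp => //; lia.
- move=> we d_gt0 /placed_cat[P1]; rewrite size_ecode => /placed_cons[P2 _] agr.
  have [r1 [R1 A1 K1 E1]] := ecodeP x y we d_gt0 (leqnn d) P1 agr.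
  exists r1; split=> //.
  rewrite size_cat size_ecode /=; apply: runs_trans R1 _.
  rewrite addn1 addnS -addnS -E1 addnS.
  exact: (runs_instr _ _ _ P2).
Qed.

End Simulation.

(** The leading [Read 0] moves the first input number into [tmp 0], where the code expects [n];
    hence code addresses and free temporaries both start at 1. *)
Definition compile (c : cmd) : program := Read 0 :: code 1 1 c.

Lemma compileP c : wf c -> exists a b, forall n x t, a * n.+1 ^ b + a <= t ->
  outputs_within (compile c) (n :: x) (run n c (fun _ _ => 0, x, [::])).2 t.
Proof.
move=> wfc; have [A [D costle]] := cost_poly c; exists A.+1, D => n x t let_t.
pose p := compile c.
have P0 : onth p 0 = Some (Read 0) by [].
have P1 : placed p 1 (code 1 1 c) by [].
pose r0 := upd (fun=> 0) 0 n.
have agr : agree n 1 r0 r0 (fun _ _ => 0).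
  by split=> // a i _; rewrite /r0 /upd ifN // /cell addnS.
have [r'] := codeP x [::] wfc (ltnSn 0) P1 agr.
case: (run n c _) => -[m' x'] y' [R' A'] /=.
have [k lek E] := runs_trans (runs_instr (fun=> 0) (n :: x) [::] P0) R'.
have stop t' : iter t' (step p) (Config (size p) r' x' y') = Config (size p) r' x' y'.
  have oN : onth p (size p) = None by apply: onth_default.
  by elim: t' => // t' /= ->; rewrite /step -[pc _]/(size p) oN.
have -> : t = (t - k) + k.
  rewrite subnK //; apply: leq_trans lek _; apply: leq_trans let_t.
  have := costle n; have := expn_gt0 n.+1 D => /=; rewrite mulSn; lia.
rewrite /outputs_within iterD; move: E; rewrite /init => ->.
have -> : Config (1 + size (code 1 1 c)) r' x' y' = Config (size p) r' x' y' by [].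
by rewrite stop /halted /=.
Qed.

(** * Certificates for induced paths, and hitting sets *)

Section Walks.
Variables (V : finType) (G : sgraph V).

Fixpoint walk (m : nat) (x y : V) : bool :=
  if m is m'.+1 then [exists z, G x z && walk m' z y] else x == y.

Lemma walkS m x z y : G x z -> walk m z y -> walk m.+1 x y.
Proof. by move=> xz zy; apply/existsP; exists z; rewrite xz. Qed.

Lemma walk_rcons m x y z : walk m x y -> G y z -> walk m.+1 x z.
Proof.
elim: m x => [|m IH] x; first by move=> /eqP-> yz; apply: (@walkS 0 _ z); rewrite /= ?eqxx.
case/existsP=> w /andP[xw wy] yz; exact: walkS xw (IH _ wy yz).
Qed.

Hypothesis noP9 : ~ has_induced (path_graph 9) G.
Hypothesis noC3 : ~ has_induced (cycle_graph 3) G.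
Hypothesis noC5 : ~ has_induced (cycle_graph 5) G.

Lemma adjN x y : G x y -> x != y.
Proof. by apply: contraTneq => ->; rewrite adj_irr. Qed.

(** Distinct vertices of [P9] have distinct neighbourhoods, so the pattern of edges alone makes [f]
    injective. *)
Lemma no_P9 (f : nat -> V) :
  (forall i j, i < j -> j < 9 -> G (f i) (f j) = (j == i.+1)) -> False.
Proof.
move=> fE; apply: noP9; exists (fun i : 'I_9 => f i).
have fN i j : i < j -> j < 9 -> f i != f j.
  move=> ltij ltj9; apply/eqP => Efij.
  have := fE _ _ ltij ltj9; rewrite Efij adj_irr => /esym/eqP neij.
  have [ltj8|gej8] := ltnP j 8.
    have := fE i j.+1; rewrite Efij fE ?eqxx //; lia.
  case: i ltij Efij neij => [|i] ltij Efij neij.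
    by have := fE 0 1 isT isT; rewrite Efij adj_sym fE //; lia.
  by have := fE i i.+1 (ltnSn i); rewrite Efij fE; lia.
split=> [i j|i j /=].
  case: (ltngtP i j) => [lt|lt|/val_inj //] Eij.
    by have := fN _ _ lt (ltn_ord j); rewrite Eij eqxx.
  by have := fN _ _ lt (ltn_ord i); rewrite Eij eqxx.
rewrite /path_adj; case: (ltngtP i j) => [lt|lt|->].
- by rewrite fE //; lia.
- by rewrite adj_sym fE //; lia.
- by rewrite adj_irr; lia.
Qed.

Lemma no_triangle x y z : G x y -> G y z -> G z x -> False.
Proof.
move=> xy yz zx; apply: noC3.
have Us : uniq [:: x; y; z].
  by rewrite /= !inE negb_or !adjN // adj_sym.
exists (fun i : 'I_3 => nth x [:: x; y; z] i); split=> [i j /eqP|].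
  by rewrite nth_uniq // => /eqP/val_inj.
case=> [[|[|[|//]]] ?]; case=> [[|[|[|//]]] ?];
  by rewrite /= /cycle_adj -!val_eqE /= ?adj_irr ?xy ?yz ?zx // adj_sym ?xy ?yz ?zx.
Qed.

(** A closed walk of length 5 is enough: a chord or a coincidence of vertices would create a
    triangle. *)
Lemma no_pentagon a b c d e :
  G a b -> G b c -> G c d -> G d e -> G e a -> False.
Proof.
move=> ab bc cd de ea; apply: noC5.
have N x y z : G x y -> G y z -> G x z = false.
  by move=> xy yz; apply/negP => xz; apply: (no_triangle xy yz); rewrite adj_sym.
have S := adj_sym G.
have ac := N _ _ _ ab bc; have bd := N _ _ _ bc cd; have ce := N _ _ _ cd de.
have da := N _ _ _ de ea; have eb := N _ _ _ ea ab.
have D x y z : G x z -> G y z = false -> x != y.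
  by move=> xz; apply: contraFneq => <-.
have Us : uniq [:: a; b; c; d; e].
  have nac : a != c by apply: (D _ _ e); rewrite // S.
  have nad : a != d by apply: (D _ _ b); rewrite // S.
  have nbd : b != d by apply: (D _ _ a); rewrite // S.
  have nbe : b != e by apply: (D _ _ c); rewrite // S.
  have nce : c != e by apply: (D _ _ b); rewrite // S.
  have nae : a != e by rewrite eq_sym adjN.
  by rewrite /= !inE !negb_or nac nad nae nbd nbe nce (adjN ab) (adjN bc) (adjN cd) (adjN de).
exists (fun i : 'I_5 => nth a [:: a; b; c; d; e] i); split=> [i j /eqP|].
  by rewrite nth_uniq // => /eqP/val_inj.
case=> [[|[|[|[|[|//]]]]] ?]; case=> [[|[|[|[|[|//]]]]] ?];
  rewrite /= /cycle_adj -!val_eqE /= ?adj_irr ?ab ?bc ?cd ?de ?ea ?ac ?bd ?ce ?da ?eb //.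
all: by rewrite S ?ab ?bc ?cd ?de ?ea ?ac ?bd ?ce ?da ?eb.
Qed.

(** Consequently two vertices joined by a walk of length 4 are never adjacent, which is how the
    excluded cycles enter the certificates around a 7-cycle. *)
Lemma no_walk5 x : ~~ walk 5 x x.
Proof.
apply/negP => /existsP[a /andP[xa]] /existsP[b /andP[ab]].
case/existsP=> [d /andP[bd]] /existsP[e /andP[de]] /existsP[y /andP[ey]] /eqP Ey.
by subst y; apply: (no_pentagon xa ab bd de ey).
Qed.

End Walks.

(* Refutation certificates: a finite set of known edges E and non-edges N
   between named vertices is contradictory in a P9-free graph without closed
   walks of length g + 1 (g even) if some pair of E is a forced non-edge or if
   w is an induced P9. A pair joined by a walk of length g in E is a forced
   non-edge; walks of smaller even length extend to length g by going back and
   forth. *)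
Section Certificates.

Definition nbrs (E : seq (nat * nat)) (a : nat) : seq nat :=
  [seq e.2 | e <- E & e.1 == a] ++ [seq e.1 | e <- E & e.2 == a].

Fixpoint reach (E : seq (nat * nat)) (m a : nat) : seq nat :=
  if m is m'.+1 then undup (flatten [seq nbrs E b | b <- reach E m' a])
  else [:: a].

Definition nonadj (E N : seq (nat * nat)) (g a b : nat) : bool :=
  [|| b \in reach E g a, (a, b) \in N | (b, a) \in N].

Definition refuted (E N : seq (nat * nat)) (g : nat) (w : seq nat) : bool :=
  has (fun e => nonadj E N g e.1 e.2) E ||
  (size w == 9) &&
  all (fun j => all (fun i =>
    if j == i.+1 then nth 0 w j \in nbrs E (nth 0 w i)
    else nonadj E N g (nth 0 w i) (nth 0 w j)) (iota 0 j)) (iota 0 9).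

Variables (V : finType) (G : sgraph V) (env : nat -> V).
Variables (E N : seq (nat * nat)) (g : nat).
Hypothesis noP9 : ~ has_induced (path_graph 9) G.
Hypothesis odd_free : forall a, ~~ walk G g.+1 (env a) (env a).
Hypothesis edgesE : all (fun e => G (env e.1) (env e.2)) E.
Hypothesis nonedgesN : all (fun e => ~~ G (env e.1) (env e.2)) N.

Lemma nbrsP a b : b \in nbrs E a -> G (env a) (env b).
Proof.
rewrite mem_cat; case/orP=> /mapP[[u v]]; rewrite mem_filter /= => /andP[/eqP-> Ee] ->.
  exact: (allP edgesE _ Ee).
by rewrite adj_sym; apply: (allP edgesE _ Ee).
Qed.

Lemma reachP m a b : b \in reach E m a -> walk G m (env a) (env b).
Proof.
elim: m b => [|m IH] b /=; first by rewrite inE => /eqP->.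
rewrite mem_undup => /flatten_mapP[d /IH wd /nbrsP db].
exact: walk_rcons wd db.
Qed.

Lemma nonadjP a b : nonadj E N g a b -> ~~ G (env a) (env b).
Proof.
case/or3P=> [/reachP w|/(allP nonedgesN) //|/(allP nonedgesN) /=].
  apply/negP; rewrite adj_sym => ba.
  by have := odd_free a; rewrite (walk_rcons w).
by rewrite adj_sym.
Qed.

Lemma refutedP w : refuted E N g w -> False.
Proof.
case/orP=> [/hasP[e Ee /nonadjP]|/andP[/eqP sw]].
  by rewrite (allP edgesE _ Ee).
move/allP=> H; apply: (no_P9 noP9 (f := fun i => env (nth 0 w i))) => i j ltij ltj9.
have := H j; rewrite mem_iota ltj9 => /(_ isT) /allP /(_ i).
rewrite mem_iota ltij => /(_ isT).
by case: eqP => [_ /nbrsP //|_ /nonadjP /negbTE].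
Qed.

End Certificates.

(** * Certificates relative to a cycle *)

Section CyclicCertificates.
Variables (V : finType) (G : sgraph V) (L g : nat) (c : nat -> V) (cc : pred V).
Hypothesis noP9 : ~ has_induced (path_graph 9) G.
Hypothesis odd_free : forall a, cc a -> ~~ walk G g.+1 a a.
Hypothesis cyc : forall i, i < L -> G (c i) (c (i.+1 %% L)).
Hypothesis ccc : forall i, cc (c i).

(* Extra vertices come first, so that a numeral index computes. *)
Fixpoint env (l : seq V) (k : nat) : V :=
  match l, k with
  | [::], _ => c k
  | x :: _, 0 => x
  | _ :: l', k'.+1 => env l' k'
  end.

Lemma env_cycle l k : env l (size l + k) = c k.
Proof. by elim: l => //= x l IH; rewrite addSn. Qed.

Definition far (y : V) : bool := [forall j : 'I_L, ~~ G y (c j)].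

Lemma farP y j : far y -> j < L -> G y (c j) = false.
Proof. by move/forallP=> H lt; apply/negbTE/(H (Ordinal lt)). Qed.

Definition cyc_edges (e : nat) : seq (nat * nat) :=
  [seq (e + i, e + i.+1 %% L) | i <- iota 0 L].

Definition far_pairs (e v : nat) : seq (nat * nat) :=
  [seq (v, e + j) | j <- iota 0 L].

Lemma refute l E N U w :
  refuted (cyc_edges (size l) ++ E)
          (N ++ flatten [seq far_pairs (size l) v | v <- U]) g w ->
  all cc l ->
  all (fun e => G (env l e.1) (env l e.2)) E ->
  all (fun e => ~~ G (env l e.1) (env l e.2)) N ->
  all (fun v => far (env l v)) U -> False.
Proof.
move=> R ccl HE HN HU; apply: (refutedP (env := env l) noP9 _ _ _ R).
- move=> a; apply: odd_free; elim: l a ccl {R HE HN HU} => //= x l IH a.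
  by case/andP=> ccx ccl; case: a => // a; apply: IH.
- rewrite all_cat HE andbT; apply/allP => e /mapP[i]; rewrite mem_iota => lti ->.
  by rewrite !env_cycle; apply: cyc.
- rewrite all_cat HN; apply/allP => e /flatten_mapP[v Uv] /mapP[j].
  rewrite mem_iota => ltj -> /=; rewrite env_cycle; apply/negbT.
  exact: farP (allP HU _ Uv) ltj.
Qed.

End CyclicCertificates.

(** * Hitting sets for families of pairs of sets *)

Section Hitting.
Variables (V : finType) (A B : V -> {set V}).

Definition hit (s : seq V) (y : V) : bool :=
  has (fun v => (v \in A y) || (v \in B y)) s.

Lemma hit_cat s1 s2 y : hit (s1 ++ s2) y = hit s1 y || hit s2 y.
Proof. exact: has_cat. Qed.

Definition hitting (k : nat) (Y : {set V}) : Prop :=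
  exists s, [/\ size s <= k,
                forall v, v \in s -> exists2 y, y \in Y & v \in A y :|: B y
              & forall y, y \in Y -> hit s y].

Lemma minimal_set (F : V -> {set V}) (Y : {set V}) y : y \in Y ->
  exists2 y0, y0 \in Y & forall y, y \in Y -> F y \subset F y0 -> F y = F y0.
Proof.
move=> Yy; case: (arg_minnP (fun y => #|F y|) Yy) => y0 Yy0 miny0.
exists y0 => // z Yz sub; apply/eqP; rewrite eqEcard sub miny0 //.
Qed.

Definition cross (y1 y2 : V) : bool :=
  ~~ (A y1 \subset A y2) && ~~ (B y2 \subset B y1).

Definition both (Y : {set V}) : Prop :=
  forall y, y \in Y -> A y != set0 /\ B y != set0.

(** Take [y0] with [A y0] minimal. A missed [y] with [A y] inside [A y0] would have [A y = A y0],
    and then [a] would hit it; and [b] lies in [B y0] but not in [B y]. *)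
Lemma cross_step (Y : {set V}) : both Y -> Y != set0 ->
  exists y0 a b, [/\ y0 \in Y, a \in A y0, b \in B y0 &
    forall y, y \in Y -> ~~ hit [:: a; b] y -> cross y y0].
Proof.
move=> bY /set0Pn[z Yz]; have [y0 Yy0 min0] := minimal_set A Yz.
have [/set0Pn[a Aa] /set0Pn[b Bb]] := bY _ Yy0.
exists y0, a, b; split=> // y Yy; rewrite /hit /= orbF !negb_or.
case/andP=> /andP[nAa _] /andP[_ nBb].
apply/andP; split; last by apply/subsetPn; exists b.
by apply: contra nAa => sub; rewrite (min0 _ Yy sub).
Qed.

(** Two rounds of [cross_step] pick [y0] and [y1]. An element missed by all four vertices would
    cross both, while [y1] crosses [y0]. *)
Lemma hit_cross (Y : {set V}) : both Y ->
  (forall y1 y2 y3, y1 \in Y -> y2 \in Y -> y3 \in Y ->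
     cross y1 y2 -> cross y1 y3 -> cross y2 y3 -> False) ->
  hitting 4 Y.
Proof.
move=> bY noT; have [->|Yn0] := eqVneq Y set0.
  by exists [::]; split=> // y; rewrite inE.
have [y0 [a0 [b0 [Y0 Aa0 Bb0 cr0]]]] := cross_step bY Yn0.
pose F := [set y in Y | ~~ hit [:: a0; b0] y].
have FY y : y \in F -> y \in Y by rewrite inE => /andP[].
have [F0|Fn0] := eqVneq F set0.
  exists [:: a0; b0]; split=> // [v|y Yy].
    by rewrite !inE => /orP[]/eqP->; exists y0; rewrite // inE ?Aa0 ?Bb0 ?orbT.
  by apply/negPn/negP => h; have := in_set0 y; rewrite -F0 inE Yy h.
have [|y1 [a1 [b1 [Y1 Aa1 Bb1 cr1]]]] := cross_step _ Fn0.
  by move=> y /FY/bY.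
exists [:: a0; b0; a1; b1]; split=> // [v|y Yy].
  rewrite !inE => /or4P[]/eqP->.
  - by exists y0; rewrite // inE Aa0.
  - by exists y0; rewrite // inE Bb0 orbT.
  - by exists y1; rewrite ?FY // inE Aa1.
  - by exists y1; rewrite ?FY // inE Bb1 orbT.
rewrite -[_ :: _]/([:: a0; b0] ++ [:: a1; b1]) hit_cat.
apply/negPn/negP; rewrite negb_or => /andP[h0 h1].
have Fy : y \in F by rewrite inE Yy.
apply: (noT y y1 y0) => //; rewrite ?FY ?cr0 ?cr1 ?FY //.
by move: Y1; rewrite inE => /andP[].
Qed.

(* Hit Y by one vertex each of A p and B p for a B-minimal p; those y that are missed
   have B y not in B p, and are treated according to whether A y is in A p. *)
Lemma hit_chain (Y : {set V}) : both Y ->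
  (forall y1 y2 y3, y1 \in Y -> y2 \in Y -> y3 \in Y ->
     ~~ (A y1 \subset A y2 :|: A y3) -> ~~ (A y2 \subset A y1 :|: A y3) ->
     ~~ (B y2 \subset B y1 :|: B y3) -> ~~ (B y3 \subset B y1 :|: B y2) ->
     False) ->
  (forall y1 y2 y3, y1 \in Y -> y2 \in Y -> y3 \in Y ->
     ~~ (A y1 :&: A y2 \subset A y3) -> ~~ (A y2 :&: A y3 \subset A y1) ->
     ~~ (B y1 \subset B y2 :|: B y3) -> False) ->
  hitting 6 Y.
Proof.
move=> bY star dagger; have [->|/set0Pn[z Yz]] := eqVneq Y set0.
  by exists [::]; split=> // y; rewrite inE.
have [p Yp minp] := minimal_set B Yz.
have [/set0Pn[ap Aap] /set0Pn[bp Bbp]] := bY _ Yp.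
pose unhit y := [&& y \in Y, ap \notin A y & bp \notin B y].
have Bp y : unhit y -> exists2 b, b \in B y & b \notin B p.
  case/and3P=> Yy _ nb; apply/subsetPn.
  by apply: contra nb => sub; rewrite (minp _ Yy sub).
pose F := [set y | unhit y && ~~ (A y \subset A p)].
pose F' := [set y | unhit y && (A y \subset A p)].
have [s1 [sz1 s1Y hit1]] : exists s1, [/\ size s1 <= 2,
    forall v, v \in s1 -> exists2 y, y \in Y & v \in A y :|: B y
    & forall y, y \in F -> hit s1 y].
  have [->|/set0Pn[z1 Fz1]] := eqVneq F set0.
    by exists [::]; split=> // y; rewrite inE.
  (* Minimality outside [B p] shows that a missed [y] has an element of [B y] outside both [B p] and
     [B y2]: otherwise [B y] and [B y2] would agree outside [B p], and [b2] would hit [y]. *)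
  have [y2 Fy2 min2] := minimal_set (fun y => B y :\: B p) Fz1.
  have := Fy2; rewrite inE => /andP[u2 /subsetPn[a2 Aa2 nAa2]].
  have [b2 Bb2 nBb2] := Bp _ u2; have /and3P[Y2 nap2 nbp2] := u2.
  exists [:: a2; b2]; split=> // [v|y Fy].
    by rewrite !inE => /orP[]/eqP->; exists y2; rewrite // inE ?Aa2 ?Bb2 ?orbT.
  apply/negPn/negP; rewrite /hit /= orbF !negb_or.
  case/andP=> /andP[na2 _] /andP[_ nb2].
  have := Fy; rewrite inE => /andP[u /subsetPn[a Aa nAa]].
  have /and3P[Yy nap nbp] := u.
  apply: (star p y2 y) => //.
  - by apply/subsetPn; exists ap; rewrite // inE negb_or nap2.
  - by apply/subsetPn; exists a2; rewrite // inE negb_or nAa2.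
  - by apply/subsetPn; exists b2; rewrite // inE negb_or nBb2.
  apply/negP => sub; have /(min2 _ Fy)/setP/(_ b2) : B y :\: B p \subset B y2 :\: B p.
    apply/subsetP => b; rewrite !inE => /andP[nb /(subsetP sub)].
    by rewrite inE (negbTE nb).
  by rewrite !inE nBb2 Bb2 (negbTE nb2).
have [s2 [sz2 s2Y hit2]] : exists s2, [/\ size s2 <= 2,
    forall v, v \in s2 -> exists2 y, y \in Y & v \in A y :|: B y
    & forall y, y \in F' -> hit s2 y].
  have [->|/set0Pn[z1 Fz1]] := eqVneq F' set0.
    by exists [::]; split=> // y; rewrite inE.
  (* Here [A y1] and [A y] both lie in [A p], and minimality of [A y1] provides an element of [A y]
     outside [A y1] as well as one in the other direction, namely [a0]. *)
  have [y1 Fy1 min1] := minimal_set A Fz1.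
  have := Fy1; rewrite inE => /andP[u1 sub1].
  have [b0 Bb0 nBb0] := Bp _ u1; have /and3P[Y1 nap1 nbp1] := u1.
  have [/set0Pn[a0 Aa0] _] := bY _ Y1.
  exists [:: a0; b0]; split=> // [v|y Fy].
    by rewrite !inE => /orP[]/eqP->; exists y1; rewrite // inE ?Aa0 ?Bb0 ?orbT.
  apply/negPn/negP; rewrite /hit /= orbF !negb_or.
  case/andP=> /andP[na0 _] /andP[_ nb0].
  have := Fy; rewrite inE => /andP[u sub].
  have /and3P[Yy nap nbp] := u.
  apply: (dagger y1 p y) => //.
  - by apply/subsetPn; exists a0; rewrite // inE Aa0 (subsetP sub1).
  - have /subsetPn[a Aa nAa] : ~~ (A y \subset A y1).
      by apply: contra na0 => sub'; rewrite (min1 _ Fy sub').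
    by apply/subsetPn; exists a; rewrite // inE Aa (subsetP sub).
  - by apply/subsetPn; exists b0; rewrite // inE negb_or nBb0.
exists ([:: ap; bp] ++ s1 ++ s2); split=> [|v|y Yy].
- by rewrite -[6]/(2 + (2 + 2)) !size_cat !leq_add.
- rewrite !mem_cat => /or3P[|/s1Y//|/s2Y//].
  by rewrite !inE => /orP[]/eqP->; exists p; rewrite // inE ?Aap ?Bbp ?orbT.
rewrite !hit_cat; case u: (unhit y).
  case sub: (A y \subset A p).
    by rewrite hit2 ?orbT // inE u sub.
  by rewrite hit1 ?orbT // inE u sub.
move/negbT: u; rewrite /unhit Yy /= negb_and !negbK /hit /= orbF.
by case/orP=> ->; rewrite ?orbT.
Qed.

End Hitting.

(** * Neighbourhoods of a 7-cycle *)

(* A vertex with a neighbour on a 7-cycle c has type (true, i) if c_i is its only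
   neighbour there and (false, i) if its neighbours are c_(i-1) and c_(i+1). *)
Definition vtype : Type := (bool * nat)%type.

Definition types : seq vtype :=
  [seq (b, i) | b <- [:: true; false], i <- iota 0 7].

Definition touch (t : vtype) (i : nat) : bool :=
  if t.1 then i == t.2 else (i == (t.2 + 6) %% 7) || (i == (t.2 + 1) %% 7).

Definition type_edges (e k : nat) (t : vtype) : seq (nat * nat) :=
  [seq (k, e + j) | j <- iota 0 7 & touch t j].

(** For a pendant at c_i only c_(i+2) and c_(i-2) need recording: even walks of length 2 or 4
    through c_i reach c_(i+1), c_(i-1), c_(i+3) and c_(i-3), so these non-edges are derived. *)
Definition type_nonedges (e k : nat) (t : vtype) : seq (nat * nat) :=
  if t.1 then [:: (k, e + (t.2 + 2) %% 7); (k, e + (t.2 + 5) %% 7)] else [::].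

Definition cert (e : nat) (T : seq (nat * vtype)) (E N : seq (nat * nat))
    (U w : seq nat) : bool :=
  refuted (cyc_edges 7 e ++ flatten [seq type_edges e t.1 t.2 | t <- T] ++ E)
          ((flatten [seq type_nonedges e t.1 t.2 | t <- T] ++ N)
             ++ flatten [seq far_pairs 7 e v | v <- U]) 4 w.

(* m consecutive cycle vertices from c_i, in steps of s *)
Definition arc (e i s m : nat) : seq nat :=
  [seq e + (i + s * k) %% 7 | k <- iota 0 m].

(** With an empty path, [cert] can succeed only because some recorded edge is a forced non-edge; the
    excluded pairs of types are thus those contradicting adjacency alone. *)
Definition compat (t1 t2 : vtype) : bool :=
  ~~ cert 3 [:: (1, t1); (2, t2)] [:: (0, 1); (0, 2)] [::] [:: 0] [::].

Definition compat_edge (t1 t2 : vtype) : bool :=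
  ~~ cert 4 [:: (2, t1); (3, t2)] [:: (0, 1); (0, 2); (1, 3)] [::] [:: 0; 1] [::].

(* Pairs of types of neighbours of y that no single vertex of the cycle dominates. *)
Definition kinds : seq (vtype * vtype) :=
  flatten [seq [:: ((true, i), (true, (i + 2) %% 7)); ((true, i), (true, (i + 3) %% 7));
    ((true, i), (false, (i + 3) %% 7)); ((true, i), (false, (i + 4) %% 7))] | i <- iota 0 7].

Section SevenCycle.
Variables (V : finType) (G : sgraph V).
Hypothesis noP9 : ~ has_induced (path_graph 9) G.
Hypothesis noC3 : ~ has_induced (cycle_graph 3) G.
Hypothesis noC5 : ~ has_induced (cycle_graph 5) G.
Variable c : nat -> V.
Hypothesis cyc : forall i, i < 7 -> G (c i) (c (i.+1 %% 7)).

Notation far := (far G 7 c).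
Notation symG := (adj_sym G).

Definition typed (x : V) (t : vtype) : bool :=
  all (fun j => G x (c j)) [seq j <- iota 0 7 | touch t j] &&
  (t.1 ==> ~~ G x (c ((t.2 + 2) %% 7)) && ~~ G x (c ((t.2 + 5) %% 7))).

Lemma certP l T E N U w :
  cert (size l) T E N U w ->
  all (fun t => typed (env c l t.1) t.2) T ->
  all (fun e => G (env c l e.1) (env c l e.2)) E ->
  all (fun e => ~~ G (env c l e.1) (env c l e.2)) N ->
  all (fun v => far (env c l v)) U -> False.
Proof.
move=> C HT HE HN HU.
apply: (refute (cc := predT) noP9 _ cyc _ C) => //.
- by move=> a _; apply: no_walk5.
- by apply/allP.
- rewrite all_cat HE andbT; apply/allP => e /flatten_mapP[[k t] Tt].
  have /andP[/allP Ht _] := allP HT _ Tt.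
  by case/mapP=> j tj -> /=; rewrite env_cycle; apply: Ht.
rewrite all_cat HN andbT; apply/allP => e /flatten_mapP[[k t] Tt].
have /andP[_ Ht] := allP HT _ Tt; rewrite /type_nonedges /=.
case: (t.1) Ht => //= /andP[H1 H2].
by rewrite !inE => /orP[]/eqP-> /=; rewrite env_cycle.
Qed.

Lemma all_types (P : pred vtype) : all P types -> forall t, t \in types -> P t.
Proof. by move=> /allP. Qed.

Lemma all7 (P : pred nat) : all P (iota 0 7) -> forall i, i < 7 -> P i.
Proof. by move=> /allP H i lti; apply: H; rewrite mem_iota. Qed.

Lemma type_lt t : t \in types -> t.2 < 7.
Proof. by move: t; apply: all_types; vm_compute. Qed.

Lemma classify x : ~~ far x -> exists2 t, t \in types & typed x t.
Proof.
rewrite negb_forall => /existsP[[i lti] /negPn /= xi].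
have D j : j < 7 -> G x (c ((j + 6) %% 7)) -> G x (c ((j + 1) %% 7)) ->
    exists2 t, t \in types & typed x t.
  move=> ltj x1 x2; exists (false, j).
    by apply/allpairsP; exists (false, j); rewrite mem_iota.
  apply/andP; split=> //.
  by apply/allP => k; rewrite mem_filter => /andP[/orP[]/eqP->].
have [x2|nx2] := boolP (G x (c ((i + 2) %% 7))).
  apply: (D ((i + 1) %% 7)); first by rewrite ltn_pmod.
    by rewrite (_ : _ %% 7 = i) //; lia.
  by rewrite (_ : (_ + 1) %% 7 = (i + 2) %% 7) //; lia.
have [x5|nx5] := boolP (G x (c ((i + 5) %% 7))).
  apply: (D ((i + 6) %% 7)); first by rewrite ltn_pmod.
    by rewrite (_ : (_ + 6) %% 7 = (i + 5) %% 7) //; lia.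
  by rewrite (_ : _ %% 7 = i) //; lia.
exists (true, i); first by apply/allpairsP; exists (true, i); rewrite mem_iota.
apply/andP; split; last by rewrite /= nx2 nx5.
by apply/allP => k; rewrite mem_filter => /andP[/eqP->].
Qed.

(** [typed] fixes only part of the adjacency to the cycle. Any further edge makes the edge set
    contradictory, which the certificates with an empty path detect. *)
Lemma typed_adj x t i : t \in types -> i < 7 -> typed x t -> G x (c i) = touch t i.
Proof.
move=> Tt lti xt; case ti: (touch t i).
  by have /andP[/allP H _] := xt; apply: H; rewrite mem_filter ti mem_iota.
apply/negP => xi.
have H t' : t' \in types -> all (fun j => touch t' j ||
    cert 1 [:: (0, t')] [:: (0, 1 + j)] [::] [::] [::]) (iota 0 7).
  by move: t'; apply: all_types; vm_compute.
have := allP (H _ Tt) i; rewrite mem_iota ti => /(_ lti) /= C.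
by apply: (certP (l := [:: x]) C) => //=; rewrite ?xt ?xi.
Qed.

Lemma compatP y x1 x2 t1 t2 : far y -> G y x1 -> G y x2 ->
  typed x1 t1 -> typed x2 t2 -> compat t1 t2.
Proof.
move=> fy y1 y2 ty1 ty2; apply/negP => C.
by apply: (certP (l := [:: y; x1; x2]) C); rewrite /= ?fy ?y1 ?y2 ?ty1 ?ty2.
Qed.

Lemma compat_edgeP y y' x1 x2 t1 t2 : far y -> far y' -> G y y' ->
  G y x1 -> G y' x2 -> typed x1 t1 -> typed x2 t2 -> compat_edge t1 t2.
Proof.
move=> fy fy' yy y1 y2 ty1 ty2; apply/negP => C.
by apply: (certP (l := [:: y; y'; x1; x2]) C);
  rewrite /= ?fy ?fy' ?yy ?y1 ?y2 ?ty1 ?ty2.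
Qed.

(** The vertices z, y, x followed by c_i, ..., c_(i+5) would form an induced [P9]. *)
Lemma pendant_leaf x y z i : i < 7 -> typed x (true, i) ->
  far y -> far z -> G x y -> G y z -> False.
Proof.
move=> lti xt fy fz xy yz.
have : cert 3 [:: (0, (true, i))] [:: (0, 1); (1, 2)] [::] [:: 1; 2]
    ([:: 2; 1; 0] ++ arc 3 i 1 6).
  by move: i lti {xt}; apply: all7; vm_compute.
move=> C; apply: (certP (l := [:: x; y; z]) C);
  by rewrite /= ?fy ?fz ?xy ?yz ?xt.
Qed.

(* otherwise y3 y2 y1 x continues along the cycle to an induced P9 *)
Lemma far_step2 x y1 y2 y3 : ~~ far x -> far y1 -> far y2 -> far y3 ->
  G x y1 -> G y1 y2 -> G y2 y3 -> G x y3.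
Proof.
move=> /classify[[[] i] Tt xt] f1 f2 f3 x1 y12 y23.
  case: (pendant_leaf _ xt f1 f2 x1 y12).
  exact: type_lt Tt.
apply/negPn/negP => n3; move: Tt xt => /=.
have H t : t \in types -> t.1 || cert 4 [:: (0, t)]
    [:: (0, 1); (1, 2); (2, 3)] [:: (0, 3)] [:: 1; 2; 3]
    ([:: 3; 2; 1; 0] ++ arc 4 (t.2 + 1) 1 5).
  by move: t; apply: all_types; vm_compute.
move=> Tt xt; have := H _ Tt => /= C.
by apply: (certP (l := [:: x; y1; y2; y3]) C);
  rewrite /= ?f1 ?f2 ?f3 ?x1 ?y12 ?y23 ?xt ?n3.
Qed.

Definition nbr_type (t : vtype) (y : V) : {set V} := [set x | G y x & typed x t].

Definition kind_set (k : vtype * vtype) : {set V} :=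
  [set y | [&& far y, nbr_type k.1 y != set0 & nbr_type k.2 y != set0]].

Lemma kindsP (k : vtype * vtype) : k \in kinds ->
  [/\ k.1.1, k.1.2 < 7 &
      k.2 \in [:: (true, (k.1.2 + 2) %% 7); (true, (k.1.2 + 3) %% 7);
                  (false, (k.1.2 + 3) %% 7); (false, (k.1.2 + 4) %% 7)]].
Proof.
move=> kk; apply/and3P; apply: (allP (a := fun k => [&& k.1.1, k.1.2 < 7 &
   k.2 \in [:: (true, (k.1.2 + 2) %% 7); (true, (k.1.2 + 3) %% 7);
            (false, (k.1.2 + 3) %% 7); (false, (k.1.2 + 4) %% 7)]]) _ _ kk).
by vm_compute.
Qed.

(** The first type of a kind is that of a pendant, and [pendant_leaf] forbids an edge between far
    vertices next to a pendant. *)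
Lemma kind_indep i t y y' : i < 7 ->
  y \in kind_set ((true, i), t) -> y' \in kind_set ((true, i), t) -> G y y' = false.
Proof.
move=> lti; rewrite !inE => /and3P[fy /set0Pn[x]]; rewrite inE => /andP[yx xt] _.
case/and3P=> fy' _ _; apply/negP => yy'.
by apply: (pendant_leaf lti xt fy fy' _ yy'); rewrite symG.
Qed.

Lemma kind_both k : both (nbr_type k.1) (nbr_type k.2) (kind_set k).
Proof. by move=> y; rewrite inE => /and3P[]. Qed.

Lemma hitting_leq A B m m' (Y : {set V}) :
  m <= m' -> hitting A B m Y -> hitting A B m' Y.
Proof. by move=> le [s [sz H1 H2]]; exists s; split=> //; apply: leq_trans le. Qed.

Lemma kind_hit_clone k : k \in kinds -> ~~ k.2.1 ->
  hitting (nbr_type k.1) (nbr_type k.2) 6 (kind_set k).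
Proof.
move=> kk pend; apply: hit_chain; first exact: kind_both.
(* the induced path y1 x1 c_i x2 y2 z2 c_j z3 y3, where c_j is adjacent to z2, z3 *)
- move=> y1 y2 y3 Y1 Y2 Y3 /subsetPn[x1 A1 nA1] /subsetPn[x2 A2 nA2].
  move=> /subsetPn[z2 B2 nB2] /subsetPn[z3 B3 nB3].
  (* Of the two cycle neighbours of a vertex of type [k.2], c_j is the one at distance 3 from c_i on
     the cycle. *)
  have C : cert 7 [:: (1, k.1); (2, k.1); (4, k.2); (5, k.2)]
    [:: (0, 1); (2, 3); (3, 4); (5, 6)]
    [:: (1, 3); (1, 6); (2, 0); (2, 6); (4, 0); (4, 6); (5, 0); (5, 3);
        (0, 3); (0, 6); (3, 6)] [:: 0; 3; 6]
    [:: 0; 1; 7 + k.1.2; 2; 3; 4;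
        7 + (if k.2.2 == (k.1.2 + 3) %% 7 then k.1.2 + 4 else k.1.2 + 3) %% 7; 5; 6].
    move: pend; apply/implyP; move: k kk {Y1 Y2 Y3 A1 nA1 A2 nA2 B2 nB2 B3 nB3}.
    by apply/allP; vm_compute.
  have [p1 lt1 _] := kindsP kk.
  move: (k) kk pend Y1 Y2 Y3 A1 nA1 A2 nA2 B2 nB2 B3 nB3 C p1 lt1.
  case=> -[b1 i1] t2 /= kk pend Y1 Y2 Y3.
  rewrite !inE !negb_or => /andP[y1x1 T1] nA1 /andP[y2x2 T2] nA2.
  move=> /andP[y2z2 T2'] nB2 /andP[y3z3 T3] nB3 C p1 lt1.
  move: b1 p1 Y1 Y2 Y3 T1 T2 nA1 nA2 C {kk} => [] // _ Y1 Y2 Y3 T1 T2.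
  rewrite T1 T2 T2' T3 !andbT in nB2 nB3 * => /andP[x1y2 x1y3] /andP[x2y1 x2y3] C.
  have [z2y1 z2y3] := andP nB2; have [z3y1 z3y2] := andP nB3.
  apply: (certP (l := [:: y1; x1; x2; y2; z2; z3; y3]) C);
    rewrite /= ?T1 ?T2 ?T2' ?T3 ?y1x1 ?y2z2 ?y3z3 ?(symG x2) ?y2x2 //=.
  + by rewrite symG y3z3.
  + by rewrite !(symG x1) !(symG z2) !(symG z3) x1y2 x1y3 x2y1 x2y3 z2y1 z2y3 z3y1 z3y2
      ?(kind_indep lt1 Y1 Y2) ?(kind_indep lt1 Y1 Y3) ?(kind_indep lt1 Y2 Y3).
  + by move: Y1 Y2 Y3; rewrite !inE => /and3P[-> _ _] /and3P[-> _ _] /and3P[-> _ _].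
(* an induced path of three cycle vertices followed by z1 y1 x1 y2 x3 y3 *)
- move=> y1 y2 y3 Y1 Y2 Y3 /subsetPn[x1 A1 nA1] /subsetPn[x3 A3 nA3].
  move=> /subsetPn[z1 B1 nB1].
  have C : cert 6 [:: (0, k.2); (2, k.1); (4, k.1)]
    [:: (0, 1); (1, 2); (2, 3); (3, 4); (4, 5)]
    [:: (0, 3); (0, 5); (2, 5); (4, 1); (1, 3); (1, 5); (3, 5)] [:: 1; 3; 5]
    ((if k.2.2 == (k.1.2 + 3) %% 7 then arc 6 (k.1.2 + 6) 6 3
      else arc 6 (k.1.2 + 1) 1 3) ++ iota 0 6).
    move: pend; apply/implyP; move: k kk {Y1 Y2 Y3 A1 nA1 A3 nA3 B1 nB1}.
    by apply/allP; vm_compute.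
  have [p1 lt1 _] := kindsP kk.
  move: (k) kk pend Y1 Y2 Y3 A1 nA1 A3 nA3 B1 nB1 C p1 lt1.
  case=> -[b1 i1] t2 /= kk pend Y1 Y2 Y3.
  rewrite !inE !negb_or => /andP[/andP[y1x1 T1] /andP[y2x1 _]] nA1.
  move=> /andP[/andP[y2x3 T3] /andP[y3x3 _]] nA3 /andP[y1z1 T2] nB1 C p1 lt1.
  move: b1 p1 Y1 Y2 Y3 T1 T3 nA1 nA3 C {kk} => [] // _ Y1 Y2 Y3 T1 T3.
  rewrite T1 T2 T3 !andbT in nB1 * => x1y3 x3y1 C.
  have [z1y2 z1y3] := andP nB1.
  apply: (certP (l := [:: z1; y1; x1; y2; x3; y3]) C).
  + by rewrite /= T1 T2 T3.
  + by rewrite /= symG y1z1 y1x1 symG y2x1 y2x3 symG y3x3.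
  + by rewrite /= !(symG x1) !(symG x3) !(symG z1) x1y3 x3y1 z1y2 z1y3
      (kind_indep lt1 Y1 Y2) (kind_indep lt1 Y1 Y3) (kind_indep lt1 Y2 Y3).
  + by move: Y1 Y2 Y3; rewrite !inE => /and3P[f1 _ _] /and3P[f2 _ _] /and3P[f3 _ _];
      rewrite /= f1 f2 f3.
Qed.

(** If y1 and y2 cross, they have no common neighbour, and each vertex of A y1 is adjacent to each
    of B y2, and likewise A y2 to B y1. Three pairwise crossing elements would then yield the
    pentagon y1, x1, z2, x3, z1. *)
Lemma kind_hit_pendant k : k \in kinds -> k.2.1 ->
  hitting (nbr_type k.1) (nbr_type k.2) 6 (kind_set k).
Proof.
move=> kk pend; apply: (@hitting_leq _ _ 4) => //; apply: hit_cross.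
  exact: kind_both.
have [p1 lt1 _] := kindsP kk.
case: k kk pend p1 lt1 => -[b1 i] t2 /= kk pend p1; case: b1 p1 kk => // _ kk lti.
set A := nbr_type _; set B := nbr_type _; set Y := kind_set _.
have AP y x : x \in A y = G y x && typed x (true, i) by rewrite inE.
have BP y x : x \in B y = G y x && typed x t2 by rewrite inE.
(* x1 and z2 are adjacent, as otherwise y1 x1 continues to z2 y2 along the cycle *)
have adj y1 y2 x1 z2 : y1 \in Y -> y2 \in Y -> x1 \in A y1 -> x1 \notin A y2 ->
    z2 \in B y2 -> z2 \notin B y1 -> G x1 z2.
  move=> Y1 Y2; rewrite !AP !BP => /andP[y1x1 T1] nx1 /andP[y2z2 T2] nz2.
  rewrite T1 T2 !andbT in nx1 nz2; apply/negPn/negP => x1z2.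
  have C : cert 4 [:: (0, (true, i)); (2, t2)] [:: (0, 1); (2, 3)]
    [:: (0, 3); (1, 2); (1, 3); (0, 2)] [:: 1; 3]
    (if t2.2 == (i + 2) %% 7 then [:: 1; 0] ++ arc 4 i 6 6 ++ [:: 2]
     else [:: 1; 0] ++ arc 4 i 6 5 ++ [:: 2; 3]).
    clear -kk pend; pose P (k : vtype * vtype) := k.2.1 ==> cert 4 [:: (0, (true, k.1.2)); (2, k.2)]
      [:: (0, 1); (2, 3)] [:: (0, 3); (1, 2); (1, 3); (0, 2)] [:: 1; 3]
      (if k.2.2 == (k.1.2 + 2) %% 7 then [:: 1; 0] ++ arc 4 k.1.2 6 6 ++ [:: 2]
       else [:: 1; 0] ++ arc 4 k.1.2 6 5 ++ [:: 2; 3]).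
    have /allP/(_ _ kk) : all P kinds by vm_compute.
    by rewrite /P /= pend.
  apply: (certP (l := [:: x1; y1; z2; y2]) C).
  + by rewrite /= T1 T2.
  + by rewrite /= symG y1x1 symG y2z2.
  + by rewrite /= (symG x1 y2) nx1 nz2 (kind_indep lti Y1 Y2) x1z2.
  + by move: Y1 Y2; rewrite !inE => /and3P[f1 _ _] /and3P[f2 _ _]; rewrite /= f1 f2.
(* crossing neighbourhoods are disjoint, since a common neighbour closes a pentagon *)
have disj y1 y2 v : y1 \in Y -> y2 \in Y -> cross A B y1 y2 ->
    G y1 v -> G y2 v -> False.
  move=> Y1 Y2 /andP[/subsetPn[x1 A1 nA1] /subsetPn[z2 B2 nB2]] y1v y2v.
  have x1z2 := adj _ _ _ _ Y1 Y2 A1 nA1 B2 nB2.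
  move: A1 B2; rewrite AP BP => /andP[y1x1 _] /andP[y2z2 _].
  apply: (no_pentagon noC3 noC5 y1x1 x1z2 _ y2v); by rewrite symG.
have full y1 y2 : y1 \in Y -> y2 \in Y -> cross A B y1 y2 ->
    {in A y1 & B y2, forall x z, G x z} /\ {in A y2 & B y1, forall x z, G x z}.
  move=> Y1 Y2 cr; have D := disj _ _ _ Y1 Y2 cr.
  have A12 x : x \in A y1 -> x \notin A y2.
    by rewrite !AP => /andP[yx _]; apply/negP => /andP[/(D _ yx)].
  have A21 x : x \in A y2 -> x \notin A y1.
    by apply: contraL => /A12.
  have B12 x : x \in B y1 -> x \notin B y2.
    by rewrite !BP => /andP[yx _]; apply/negP => /andP[/(D _ yx)].
  have B21 x : x \in B y2 -> x \notin B y1.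
    by apply: contraL => /B12.
  split=> x z Ax Bz.
    by apply: (adj y1 y2); rewrite ?A12 ?B21.
  by apply: (adj y2 y1); rewrite ?A21 ?B12.
move=> y1 y2 y3 Y1 Y2 Y3 c12 c13 c23.
have [F12 _] := full _ _ Y1 Y2 c12; have [_ F13] := full _ _ Y1 Y3 c13.
have [_ F23] := full _ _ Y2 Y3 c23.
have [/set0Pn[x1 A1] /set0Pn[z1 B1]] := kind_both Y1.
have [_ /set0Pn[z2 B2]] := kind_both Y2; have [/set0Pn[x3 A3] _] := kind_both Y3.
have y1x1 : G y1 x1 by move: A1; rewrite inE => /andP[].
have z1y1 : G z1 y1 by move: B1; rewrite inE symG => /andP[].
apply: (no_pentagon noC3 noC5 y1x1 (F12 _ _ A1 B2) _ (F13 _ _ A3 B1) z1y1).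
by rewrite symG; apply: F23.
Qed.

Lemma kind_hit k : k \in kinds ->
  hitting (nbr_type k.1) (nbr_type k.2) 6 (kind_set k).
Proof.
move=> kk; case pend: k.2.1; first exact: kind_hit_pendant.
by apply: kind_hit_clone; rewrite ?pend.
Qed.

Definition in_kind (k : vtype * vtype) (y : V) : bool :=
  [exists x, G y x && typed x k.1] && [exists z, G y z && typed z k.2].

Lemma typed_near x t : t \in types -> typed x t -> ~~ far x.
Proof.
move=> Tt xt; apply/negP => fx.
have [i lti ti] : exists2 i, i < 7 & touch t i.
  have /hasP[i] : has (touch t) (iota 0 7) by move: t Tt {xt}; apply: all_types; vm_compute.
  by rewrite mem_iota; exists i.
by have := farP fx lti; rewrite (typed_adj Tt lti xt) ti.
Qed.

(** The bound is 28 kinds times 6 vertices. *)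
Lemma all_kinds_hit : exists s, [/\ size s <= 168, forall v, v \in s -> ~~ far v
  & forall k y, k \in kinds -> far y -> in_kind k y -> has (G y) s].
Proof.
suff H ks : {subset ks <= kinds} -> exists s,
    [/\ size s <= size ks * 6, forall v, v \in s -> ~~ far v
    & forall k y, k \in ks -> far y -> in_kind k y -> has (G y) s].
  by have [|s] := H kinds; [by []|exists s].
elim: ks => [|k ks IH] sub; first by exists [::].
have [|s [sz sN sH]] := IH; first by move=> k' k'ks; rewrite sub // inE k'ks orbT.
have kk : k \in kinds by rewrite sub ?inE ?eqxx.
have [s' [sz' sY' sH']] := kind_hit kk.
have [T1 T2] : k.1 \in types /\ k.2 \in types.
  by apply/andP; clear -kk; move: k kk; apply/allP; vm_compute.
exists (s' ++ s); split=> [|v|k' y].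
- by rewrite size_cat mulSn leq_add.
- rewrite mem_cat => /orP[/sY'[y _]|/sN //].
  rewrite !inE; case/orP=> /andP[_]; exact: typed_near.
rewrite inE has_cat => /orP[/eqP->|k'ks] fy yk; last by rewrite (sH _ _ k'ks) ?orbT.
apply/orP; left; case/andP: yk => /existsP[x yx] /existsP[z yz].
have /sH'/hasP[v vs' yv] : y \in kind_set k.
  rewrite inE fy /=; apply/andP; split; apply/set0Pn.
    by exists x; rewrite inE.
  by exists z; rewrite inE.
by apply/hasP; exists v => //; move: yv; rewrite !inE => /orP[]/andP[].
Qed.

Lemma clone_clone i j : i < 7 -> j < 7 -> compat (false, i) (false, j) ->
  j \in [:: i; (i + 2) %% 7; (i + 5) %% 7].
Proof.
move=> lti ltj; apply/implyP; move: j ltj; apply: all7; move: i lti; apply: all7.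
by vm_compute.
Qed.

(* If the neighbours of y have no common neighbour on the cycle, then two of them
   have disjoint sets of neighbours there, because sets {i - 1, i + 1} meeting
   pairwise have a common element. *)
Lemma unfoldable_kind y : far y ->
  (forall i, i < 7 -> exists x, [/\ G y x, ~~ far x & ~~ G x (c i)]) ->
  exists2 k, k \in kinds & in_kind k y.
Proof.
move=> fy unf.
have pend x i : (true, i) \in types -> G y x -> typed x (true, i) ->
    exists2 k, k \in kinds & in_kind k y.
  move=> Ti yx xt; have lti := type_lt Ti.
  have [x' [yx' /classify[t Tt xt'] nx']] := unf i lti.
  rewrite (typed_adj Tt lti xt') in nx'.
  have := compatP fy yx yx' xt xt'; have yk : in_kind ((true, i), t) y.
    by apply/andP; split; apply/existsP; [exists x|exists x']; rewrite ?yx ?yx'.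
  have yk' : in_kind (t, (true, i)) y by move: yk; rewrite /in_kind andbC.
  (* [kinds] contains each pair of types in one order only. *)
  have H i' t' : i' < 7 -> t' \in types -> compat (true, i') t' ==> ~~ touch t' i' ==>
      (((true, i'), t') \in kinds) || ((t', (true, i')) \in kinds).
    move=> lti'; move: t'; apply: all_types; move: i' lti'; apply: all7.
    by vm_compute.
  move=> cp; have := H _ _ lti Tt; rewrite cp nx' /= => /orP[kk|kk].
    by exists ((true, i), t).
  by exists (t, (true, i)).
have [x0 [yx0 /classify[[[] i] Tt xt] _]] := unf 0 isT; first exact: (pend x0 i).
(* From here on all relevant neighbours of y are clones. The two cycle neighbours of [x0] are
   c_(i+1) and c_(i-1); [x1] misses the former and [x2] the latter, although the three clones must
   be pairwise compatible. *)
have lt1 : (i + 1) %% 7 < 7 by rewrite ltn_pmod.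
have lt6 : (i + 6) %% 7 < 7 by rewrite ltn_pmod.
have [x1 [yx1 /classify[[[] i1] Tt1 xt1]]] := unf _ lt1; first by move=> _; apply: (pend x1 i1).
have [x2 [yx2 /classify[[[] i2] Tt2 xt2]]] := unf _ lt6; first by move=> _ _; apply: (pend x2 i2).
rewrite (typed_adj Tt2 lt6 xt2) (typed_adj Tt1 lt1 xt1) => n2 n1.
have c1 := compatP fy yx0 yx1 xt xt1; have c2 := compatP fy yx0 yx2 xt xt2.
have c12 := compatP fy yx1 yx2 xt1 xt2.
have H : forall j, j < 7 -> all (fun j1 => all (fun j2 => ~~
   [&& j1 \in [:: j; (j + 2) %% 7; (j + 5) %% 7],
       j2 \in [:: j; (j + 2) %% 7; (j + 5) %% 7],
       j2 \in [:: j1; (j1 + 2) %% 7; (j1 + 5) %% 7],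
       ~~ touch (false, j2) ((j + 6) %% 7) & ~~ touch (false, j1) ((j + 1) %% 7)])
   (iota 0 7)) (iota 0 7).
  by apply: all7; vm_compute.
have l1 := type_lt Tt1; have l2 := type_lt Tt2; have l0 := type_lt Tt.
have {H} := allP (H _ l0) i1; rewrite mem_iota => /(_ l1)/allP/(_ i2).
rewrite mem_iota => /(_ l2).
by rewrite (clone_clone l0 l1 c1) (clone_clone l0 l2 c2) (clone_clone l1 l2 c12) n1 n2.
Qed.

End SevenCycle.

(** * Shortest odd cycles *)

Section OddCycles.
Variables (V : finType) (G : sgraph V).
Notation symG := (adj_sym G).

Lemma connect_closed (P : V -> Prop) u v :
  (forall x y, P x -> G x y -> P y) -> connect G u v -> P u -> P v.
Proof.
move=> cl /connectP[p pth ->]; elim: p u pth => //= x p IH u /andP[ux px] Pu.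
by apply: IH px _; apply: cl ux.
Qed.

Lemma connectC u v : connect G u v = connect G v u.
Proof. by apply: sym_connect_sym; apply: adj_sym. Qed.

Lemma connect_trans1 r u v : connect G r u -> G u v -> connect G r v.
Proof. by move=> ru uv; apply: connect_trans ru (connect1 uv). Qed.

(** The bipartite double cover of [G]: the boolean flips along every edge and so records the parity
    of a walk. *)
Definition cover : rel (V * bool) := fun x y => G x.1 y.1 && (y.2 == ~~ x.2).

Lemma cover_odd x p : path cover x p -> (last x p).2 = x.2 (+) odd (size p).
Proof.
elim: p x => [|y p IH] x /=; first by rewrite addbF.
by case/andP=> /andP[_ /eqP Ey] /IH->; rewrite Ey addNb addbN.
Qed.

Lemma cover_path x p : path cover x p -> path G x.1 [seq y.1 | y <- p].
Proof. by elim: p x => //= y p IH x /andP[/andP[-> _] /IH]. Qed.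

Lemma coverN x y b b' :
  connect cover (x, b) (y, b') -> connect cover (x, ~~ b) (y, ~~ b').
Proof.
case/connectP=> p; elim: p x b => [|[z d] p IH] x b /=.
  by move=> _ [-> ->]; apply: connect0.
case/andP=> /andP[/= xz /eqP-> zp] /(IH _ _ zp).
by apply: connect_trans; apply: connect1; rewrite /cover /= xz eqxx.
Qed.

Lemma coverC : symmetric (connect cover).
Proof.
apply: sym_connect_sym => x y; rewrite /cover symG.
by case: (x.2) (y.2) => [] [].
Qed.

Lemma closed_path x p : x = last x p -> path G x p -> cycle G p.
Proof.
case/lastP: p => // p y; rewrite last_rcons => -> pth.
by rewrite -rot1_cons rot_cycle.
Qed.

(** If the two copies of [r] are connected in the double cover, the path between them projects to an
    odd closed walk; otherwise the copy reachable from [(r, false)] defines the side. Repeated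
    vertices are allowed in [p], and [short_odd_cycle] accepts them. *)
Lemma bipartite_or_odd r :
  (exists side : pred V, forall u v, connect G r u -> G u v -> side u != side v)
  \/ exists p, [/\ cycle G p, odd (size p) & forall x, x \in p -> connect G r x].
Proof.
have [/connectP[p pp lp]|nodd] := boolP (connect cover (r, false) (r, true)).
  right; have := cover_odd pp; rewrite -lp /= => oddp.
  have := cover_path pp; have := congr1 fst lp; rewrite -(last_map fst) /=.
  set q := map fst p => lq pq; exists q.
  have sq : size q = size p by rewrite size_map.
  have conn x : x \in q -> connect G r x.
    by move=> xq; apply: (path_connect pq); rewrite inE xq orbT.
  by rewrite sq -oddp; split=> //; apply: closed_path lq pq.
left; exists (fun v => connect cover (r, false) (v, false)).
have half u : connect G r u ->
    connect cover (r, false) (u, false) || connect cover (r, false) (u, true).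
  move=> ru; pose P v := connect cover (r, false) (v, false) ||
    connect cover (r, false) (v, true).
  rewrite -/(P u); apply: (connect_closed (P := fun w => P w) _ ru) => [x y|]; last by rewrite /P connect0.
  rewrite /P.
  move=> xb xy; have st b : connect cover (x, b) (y, ~~ b).
    by apply: connect1; rewrite /cover /= xy eqxx.
  by case/orP: xb => h; rewrite (connect_trans h (st _)) ?orbT.
have notboth u : connect cover (r, false) (u, false) ->
    connect cover (r, false) (u, true) -> False.
  move=> h0 h1; move: nodd; rewrite (connect_trans h0) //.
  by rewrite coverC; apply: (@coverN _ _ false true).
move=> u v ru uv; have st b : connect cover (u, b) (v, ~~ b).
  by apply: connect1; rewrite /cover /= uv eqxx.
have [u0|nu0] := boolP (connect cover (r, false) (u, false)).
  apply/negP => /eqP/esym v0; apply: (notboth v v0).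
  exact: connect_trans u0 (st false).
have := half u ru; rewrite (negbTE nu0) /= => u1.
by rewrite (connect_trans u1 (st true)).
Qed.

Lemma cycle_nth x0 p i : cycle G p -> i < size p ->
  G (nth x0 p i) (nth x0 p (i.+1 %% size p)).
Proof.
case: p => // x p /(pathP x0); rewrite size_rcons => H lti.
have := H i lti; rewrite nth_rcons.
have -> : nth x0 (x :: rcons p x) i = nth x0 (x :: p) i.
  by rewrite -rcons_cons nth_rcons lti.
case: ltnP => [lt|ge]; first by rewrite modn_small.
have -> : i = size p by move: lti ge => /=; lia.
by rewrite eqxx /= modnn.
Qed.

Hypothesis noP9 : ~ has_induced (path_graph 9) G.
Hypothesis noC3 : ~ has_induced (cycle_graph 3) G.
Hypothesis noC5 : ~ has_induced (cycle_graph 5) G.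

Lemma chord_shorten x q1 y q2 :
  cycle G (x :: q1 ++ y :: q2) -> G x y ->
  cycle G (x :: rcons q1 y) /\ cycle G (x :: y :: q2).
Proof.
rewrite /= rcons_cat cat_path rcons_cons /= => /and3P[p1 p2 p3] xy.
by rewrite p3 xy !rcons_path last_rcons p1 p2 symG xy.
Qed.

(** A closed walk of odd length at least 11 has a chord among its first nine vertices, as these
    would otherwise induce [P9]. The chord splits it into two shorter closed walks, one of which is
    odd. Lengths 1, 3 and 5 are impossible. *)
Lemma short_odd_cycle (D : pred V) p :
  cycle G p -> odd (size p) -> (forall x, x \in p -> D x) ->
  exists m (c : nat -> V), [/\ m \in [:: 7; 9],
    forall i, i < m -> G (c i) (c (i.+1 %% m)) & forall i, D (c i)].
Proof.
move: {2}(size p) (leqnn (size p)) => n; elim: n p => [|n IH] p.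
  by rewrite leqn0 => /eqP->.
move=> szp cycp oddp Dp.
have x0p : exists x0, x0 \in p by case: (p) oddp => // x *; exists x; rewrite inE eqxx.
have [x0 /Dp Dx0] := x0p.
have done m : size p = m -> m \in [:: 7; 9] ->
  exists m (c : nat -> V), [/\ m \in [:: 7; 9],
    forall i, i < m -> G (c i) (c (i.+1 %% m)) & forall i, D (c i)].
  move=> szm Hm; exists m, (nth x0 p); split=> // i.
    by rewrite -szm; apply: cycle_nth.
  by case: (ltnP i (size p)) => [/(mem_nth x0)/Dp //|/(nth_default x0)->].
have [sz10|sz10] := leqP (size p) 10.
  case: p szp cycp oddp Dp x0p done sz10 => // x1 [|x2 [|x3 [|x4 [|x5 [|x6 [|x7 p]]]]]] //=.
  - by rewrite adj_irr.
  - by move=> _ /and4P[a b d _] *; case: (no_triangle noC3 a b d).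
  - by move=> _ /and5P[a b d e /andP[f _]] *; case: (no_pentagon noC3 noC5 a b d e f).
  by case: p => [|x8 [|x9 [|x10 [|x11 p]]]] //= _ _ _ _ _ done _; apply: done erefl _.
have [ok|] := boolP (all (fun j => all (fun i =>
    G (nth x0 p i) (nth x0 p j) == (j == i.+1)) (iota 0 j)) (iota 0 9)).
  case: (no_P9 noP9 (f := nth x0 p)) => i j ltij ltj9.
  have := allP ok j; rewrite mem_iota ltj9 => /(_ isT)/allP/(_ i).
  by rewrite mem_iota ltij => /(_ isT)/eqP.
case/allPn=> j; rewrite mem_iota => /= ltj9 /allPn[i]; rewrite mem_iota => /= ltij.
have ltjp : j < size p by lia.
case: (j =P i.+1) => [Ej|nej].
  have := cycle_nth x0 cycp (i := i); rewrite modn_small -?Ej => [->|] //; lia.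
rewrite eqbF_neg negbK => chord.
pose q := rot i p; have cycq : cycle G q by rewrite rot_cycle.
have szq : size q = size p by rewrite size_rot.
have nthq m : i + m < size p -> nth x0 q m = nth x0 p (i + m).
  by move=> lt; rewrite /q /rot nth_cat size_drop ltn_subRL lt nth_drop.
have Dq x : x \in q -> D x by rewrite mem_rot; apply: Dp.
have ltk : j - i < size q by lia.
have := cat_take_drop (j - i) q; rewrite (drop_nth x0) // nthq ?subnKC ?(ltnW ltij) //.
move: (drop _ _ : seq V) => q2; case Eq1: (take (j - i) q) => [|x q1].
  by have := congr1 size Eq1; rewrite size_takel /=; lia.
have sz1 : (size q1).+1 = j - i by rewrite -[LHS]/(size (x :: q1)) -Eq1 size_takel //; lia.
move=> Eq; have Ex : x = nth x0 p i.
  by rewrite -[i]addn0 -nthq -?Eq //; lia.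
rewrite -Ex in chord; rewrite -Eq /= in cycq szq Dq.
have [c1 c2] := chord_shorten cycq chord.
have szE : size q1 + (size q2).+2 = size p by rewrite -szq size_cat /=; lia.
have gt0 : 0 < size q1 by move/eqP: nej; lia.
case odd1: (odd (size q1)).
  apply: (IH _ _ c1) => [||z]; first by rewrite /= size_rcons; lia.
    by rewrite /= size_rcons /= negbK.
  rewrite -cats1 -cat_cons mem_cat mem_seq1 => h; apply: Dq.
  by move: h; rewrite !inE mem_cat inE -!orbA => /or3P[]->; rewrite ?orbT.
apply: (IH _ _ c2) => [||z]; first by rewrite /=; lia.
  by move: oddp; rewrite -szE oddD odd1 /=.
rewrite !inE => h; apply: Dq.
by move: h; rewrite !inE mem_cat inE => /or3P[]->; rewrite ?orbT.
Qed.

End OddCycles.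

(** * Guesses that leave two colours everywhere *)

Section Guess.
Variables (V : finType) (G : sgraph V).

Definition near (t : seq V) (v : V) : bool := has (G v) (take 7 t).

Definition fold_ok (t : seq V) (v x : V) : bool :=
  [forall u, G v u && near t u ==> G u x].

Definition folds (t : seq V) (v : V) : seq V :=
  [seq x <- take 7 t | fold_ok t v x].

(* The colours the algorithm allows at v after guessing phi on t: vertices of t
   keep phi; a vertex at distance 2 from t_0, ..., t_6 that can be folded onto one
   of these may only take the colour of the first or the last candidate; any other
   vertex needs a neighbour in t, the colour of which it must avoid. *)
Definition admissible (t : seq V) (phi psi : V -> 'I_3) (v : V) : bool :=
  if v \in t then psi v == phi v
  else if ~~ near t v && (folds t v != [::]) then
    (psi v == phi (head v (folds t v))) || (psi v == phi (last v (folds t v)))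
  else has (G v) t && all (fun x => G v x ==> (psi v != phi x)) t.

Definition good_guess (t : seq V) (phi psi : V -> 'I_3) (D : pred V) : Prop :=
  (forall u v, D u -> G u v -> psi u != psi v) /\
  (forall v, D v -> admissible t phi psi v).

Hypothesis noP9 : ~ has_induced (path_graph 9) G.
Hypothesis noC3 : ~ has_induced (cycle_graph 3) G.
Hypothesis noC5 : ~ has_induced (cycle_graph 5) G.
Variable phi : V -> 'I_3.
Hypothesis phi_col : is_3colouring G phi.
Variable r : V.
Notation D := (connect G r).
Notation symG := (adj_sym G).

(** The guess is an edge r v. A vertex adjacent to neither end folds onto the end on its own side,
    because its neighbours lie on the other side and can be adjacent to that end only. *)
Lemma good_bipartite (side : pred V) :
  (forall u v, D u -> G u v -> side u != side v) ->
  exists t psi, size t = 175 /\ good_guess t phi psi D.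
Proof.
move=> sideP.
have [v [rv Dv]] : exists v, (G r v \/ v = r /\ forall w, ~~ G r w) /\ D v.
  have [/existsP[v rv]|] := boolP [exists v, G r v].
    by exists v; split; [left|apply: connect1].
  by rewrite negb_exists => /forallP H; exists r; split; [right|apply: connect0].
have [s [szs sr]] : exists s : seq V, size s = 168 /\ forall w, w \in s -> w = r.
  by exists (nseq 168 r); rewrite size_nseq; split=> // w /nseqP[].
(* Both ends are among the first seven entries, with [r] as the first possible fold target and [v]
   as the last. *)
pose t := r :: r :: r :: r :: r :: r :: v :: s.
have tE w : (w \in t) = (w == r) || (w == v).
  rewrite !inE; case: eqP => //= ne; case: (w == v) => //=.
  by apply/negP => /sr.
exists t, (fun w => if side w == side r then phi r else phi v); split; first by rewrite /= szs.
case: rv => [rv|[Ev iso]]; last first.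
  have Dr w : D w -> w = r.
    move=> rw; apply: (connect_closed (P := fun w => w = r) _ rw) => // x y ->.
    by rewrite (negbTE (iso y)).
  split=> [u w /Dr->|w /Dr->]; first by rewrite (negbTE (iso w)).
  by rewrite /admissible tE !eqxx.
have neq : phi r != phi v := phi_col rv.
have sv : side v = ~~ side r.
  by have := sideP r v (connect0 _ _) rv; case: (side r) (side v) => [] [].
split=> [u w Du uw|w Dw].
  have := sideP _ _ Du uw; case: (side u) (side w) (side r) => [] [] [] //= _;
  by rewrite // eq_sym.
have sideN u : G w u -> side u = ~~ side w.
  by move=> wu; have := sideP _ _ Dw wu; case: (side w) (side u) => [] [].
have nearE u : near t u = G u r || G u v.
  by rewrite /near /= take0 /= orbF; case: (G u r).
rewrite /admissible tE; case: eqP => [->|_]; first by rewrite !eqxx.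
case: eqP => [->|_] /=; first by rewrite sv; case: (side r).
have fr : side w = side r -> fold_ok t w r.
  move=> sw; apply/forallP => u; apply/implyP => /andP[wu].
  rewrite nearE => /orP[//|uv].
  have := sideP v u Dv; rewrite (symG v) => /(_ uv).
  by rewrite sv (sideN _ wu) sw eqxx.
have fv : side w != side r -> fold_ok t w v.
  move=> sw; apply/forallP => u; apply/implyP => /andP[wu].
  rewrite nearE => /orP[ur|//].
  have := sideP r u (connect0 _ _); rewrite (symG r) => /(_ ur).
  by rewrite (sideN _ wu); case: (side w) (side r) sw => [] [].
have hasT : G w r || G w v -> has (G w) t.
  by move=> h; apply/hasP; case/orP: h => h; [exists r|exists v];
    rewrite // tE eqxx ?orbT.
have allT : all (fun x => G w x ==>
    ((if side w == side r then phi r else phi v) != phi x)) t.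
  apply/allP => u; rewrite tE => /orP[]/eqP->; apply/implyP => /sideN.
    by move=> ->; case: (side w); rewrite /= eq_sym.
  by rewrite sv => /(congr1 negb); rewrite !negbK => ->; rewrite eqxx.
rewrite nearE /folds [take 7 t]/= take0 /=; case: ifP => [/andP[]|].
  rewrite negb_or => /andP[nr nv] _.
  case: (side w =P side r) => [sw|/eqP sw].
    by rewrite (fr sw) /= eqxx.
  rewrite (fv sw).
  by case: (fold_ok t w r); rewrite /= eqxx orbT.
case nw: (G w r || G w v) => /=; last first.
  move/negbT; rewrite negbK; case: (side w =P side r) => [/fr->//|/eqP/fv->].
  by case: (fold_ok t w r).
by move=> _; apply/andP; split; [apply: hasT|apply: allT].
Qed.

Lemma mem_pad (s : seq V) x m w : x \in s -> (w \in s ++ nseq m x) = (w \in s).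
Proof.
move=> sx; rewrite mem_cat; case: (boolP (w \in s)) => //= nw.
by apply/negP => /nseqP[Ew _]; rewrite Ew sx in nw.
Qed.

(** [p] and [q] will be the pairs of colours available on the two sides of a far component; distinct
    choices exist unless all four colours coincide. *)
Definition pick_distinct (T : eqType) (p q : T * T) : T * T :=
  if p.1 != q.1 then (p.1, q.1) else if p.1 != q.2 then (p.1, q.2)
  else if p.2 != q.1 then (p.2, q.1) else (p.2, q.2).

Lemma pick_distinctP (T : eqType) (p q : T * T) :
  ~~ [&& p.1 == q.1, p.1 == p.2 & q.1 == q.2] ->
  [/\ (pick_distinct p q).1 != (pick_distinct p q).2,
      (pick_distinct p q).1 \in [:: p.1; p.2] &
      (pick_distinct p q).2 \in [:: q.1; q.2]].
Proof.
case: p q => [a b] [d e]; rewrite /pick_distinct /= !inE.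
case: (a =P d) => [<-|/eqP ne] /=; last by rewrite ne !eqxx.
case: (a =P e) => [<-|/eqP ne] /=; last by rewrite ne !eqxx ?orbT.
by case: (b =P a) => [->|/eqP ne] /=; rewrite ?eqxx ?ne ?eqxx ?orbT.
Qed.

Lemma good_nine (c : nat -> V) :
  (forall i, i < 9 -> G (c i) (c (i.+1 %% 9))) -> (forall i, D (c i)) ->
  (forall x, D x -> ~~ walk G 7 x x) ->
  exists t psi, size t = 175 /\ good_guess t phi psi D.
Proof.
move=> cyc Dc odd_free.
(* Otherwise x, c_i, ..., c_(i+7) is an induced [P9]: the remaining adjacencies would close odd
   walks of length at most 7. *)
have pend x i : i < 9 -> D x -> G x (c i) ->
    G x (c ((i + 2) %% 9)) || G x (c ((i + 7) %% 9)).
  move=> lti Dx xi; apply/negPn/negP; rewrite negb_or => /andP[n2 n7].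
  have C : refuted (cyc_edges 9 1 ++ [:: (0, 1 + i)])
     ([:: (0, 1 + (i + 2) %% 9); (0, 1 + (i + 7) %% 9)] ++ flatten [seq far_pairs 9 1 v | v <- [::]])
     6 (0 :: [seq 1 + (i + k) %% 9 | k <- iota 0 8]).
    have : all (fun i => refuted (cyc_edges 9 1 ++ [:: (0, 1 + i)])
     ([:: (0, 1 + (i + 2) %% 9); (0, 1 + (i + 7) %% 9)] ++ [::])
     6 (0 :: [seq 1 + (i + k) %% 9 | k <- iota 0 8])) (iota 0 9) by vm_compute.
    by move/allP/(_ i); rewrite mem_iota; apply.
  apply: (refute noP9 odd_free cyc Dc (l := [:: x]) C).
  - by rewrite /= Dx.
  - by rewrite /= xi.
  - by rewrite /= n2 n7.
  - by [].
have near9 x : D x -> ~~ far G 9 c x.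
  suff H y : D y -> ~~ far G 9 c y -> forall z, G y z -> ~~ far G 9 c z.
    move=> Dx; have : D x /\ ~~ far G 9 c x; last by case.
    apply: (@connect_closed V G (fun w => D w /\ ~~ far G 9 c w) (c 0)).
    + move=> y z [Dy ny] yz; split; last exact: H ny _ yz.
      exact: connect_trans1 Dy yz.
    + by apply: (connect_trans (y := r)); [rewrite connectC; apply: (Dc 0)|].
    split=> //; apply/negP => /farP f0.
    by have := cyc 0 isT; rewrite f0.
  move=> Dy; rewrite negb_forall => /existsP[[i lti] /negPn /= yi] z yz.
  have Dz := connect_trans1 Dy yz.
  have [j [ltj yj yj2]] : exists j, [/\ j < 9, G y (c j) & G y (c ((j + 2) %% 9))].
    case/orP: (pend y i lti Dy yi) => h; first by exists i.
    exists ((i + 7) %% 9); split=> //; first by rewrite ltn_pmod.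
    by rewrite (_ : _ %% 9 = i) //; lia.
  (* A far z would start the induced path z, y, c_(j+2), ..., c_(j+8). *)
  apply/negP => fz.
  have C : refuted (cyc_edges 9 2 ++ [:: (0, 1); (1, 2 + j); (1, 2 + (j + 2) %% 9)])
     ([::] ++ flatten [seq far_pairs 9 2 v | v <- [:: 0]])
     6 [:: 0, 1 & [seq 2 + (j + 2 + k) %% 9 | k <- iota 0 7]].
    have : all (fun j => refuted
      (cyc_edges 9 2 ++ [:: (0, 1); (1, 2 + j); (1, 2 + (j + 2) %% 9)])
      ([::] ++ flatten [seq far_pairs 9 2 v | v <- [:: 0]])
      6 [:: 0, 1 & [seq 2 + (j + 2 + k) %% 9 | k <- iota 0 7]]) (iota 0 9) by vm_compute.
    by move/allP/(_ j); rewrite mem_iota; apply.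
  apply: (refute noP9 odd_free cyc Dc (l := [:: z; y]) C).
  - by rewrite /= Dz Dy.
  - by rewrite /= symG yz yj yj2.
  - by [].
  - by rewrite /= fz.
pose cs := [seq c i | i <- iota 0 9].
have c0 : c 0 \in cs by rewrite inE eqxx.
exists (cs ++ nseq 166 (c 0)), phi; split; first by rewrite size_cat size_nseq size_map size_iota.
split=> [u v _|v Dv]; first exact: phi_col.
rewrite /admissible mem_pad // eqxx; case: ifP => // nv.
(* [near] inspects c_0, ..., c_6 only. A neighbour c_7 or c_8 comes with another one two steps away,
   by [pend], and that one is among these seven. *)
have nearE : near (cs ++ nseq 166 (c 0)) v.
  have takeE : take 7 (cs ++ nseq 166 (c 0)) = [seq c i | i <- iota 0 7] by [].
  have H k : k < 7 -> G v (c k) -> near (cs ++ nseq 166 (c 0)) v.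
    move=> ltk vk; rewrite /near takeE; apply/hasP; exists (c k) => //.
    by apply: map_f; rewrite mem_iota.
  have := near9 _ Dv; rewrite negb_forall => /existsP[[i lti] /negPn /= vi].
  have [lt|ge] := ltnP i 7; first exact: H lt vi.
  case/orP: (pend v i lti Dv vi); apply: H; lia.
case: ifP => [|_]; first by rewrite nearE.
apply/andP; split.
  by have /hasP[x /mem_take tx vx] : has (G v) (take 7 _) := nearE;
    apply/hasP; exists x.
by apply/allP => x _; apply/implyP => /phi_col.
Qed.

(** * A good guess for a component with a 7-cycle *)

Section SevenCycle.
Variable c : nat -> V.
Hypothesis cyc : forall i, i < 7 -> G (c i) (c (i.+1 %% 7)).
Hypothesis Dc : forall i, D (c i).
Notation far := (far G 7 c).

Definition near_nbrs (v : V) : {set V} := [set u | G v u & ~~ far u].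

Definition targets (A : {set V}) : seq nat :=
  [seq i <- iota 0 7 | [forall u in A, G u (c i)]].

Definition ends (A : {set V}) : 'I_3 * 'I_3 :=
  (phi (c (head 0 (targets A))), phi (c (last 0 (targets A)))).

Lemma far_c i : i < 7 -> ~~ far (c i).
Proof.
move=> lti; apply/negP => f.
by have := farP f (ltn_pmod i.+1 (isT : 0 < 7)); rewrite cyc.
Qed.

Lemma near_nbrs_step2 v w x : far v -> far w -> far x -> G v w -> G w x ->
  near_nbrs v = near_nbrs x.
Proof.
move=> fv fw fx vw wx; apply/setP => u; rewrite !inE.
case nu: (~~ far u); rewrite ?andbF ?andbT //.
apply/idP/idP => h; rewrite symG.
  by apply: (far_step2 noP9 noC3 noC5 cyc nu fv fw fx); rewrite // symG.
by apply: (far_step2 noP9 noC3 noC5 cyc nu fx fw fv); rewrite // symG.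
Qed.

(* Otherwise the component of v would not meet the cycle. *)
Lemma near_nbrs_neq0 v w : D v -> far v -> far w -> G v w ->
  (near_nbrs v != set0) || (near_nbrs w != set0).
Proof.
move=> Dv fv fw vw; apply/negPn/negP; rewrite negb_or !negbK => /andP[v0 w0].
pose P u := far u /\ exists w, [/\ far w, G u w, near_nbrs u == set0 & near_nbrs w == set0].
have : P (c 0).
  apply: (@connect_closed V G P v) => [x y [fx [z [fz xz x0 z0]]] xy||].
  - have fy : far y.
      apply/negPn/negP => ny; have := in_set0 y.
      by rewrite -(eqP x0) inE xy ny.
    have yx : G y x by rewrite symG.
    by split=> //; exists x; split; rewrite // (near_nbrs_step2 fy fx fz yx xz).
  - by apply: (connect_trans (y := r)) (Dc 0); rewrite connectC; apply: Dv.
  by split=> //; exists w.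
by case=> f0 _; have := far_c (isT : 0 < 7); rewrite f0.
Qed.

(** A common near neighbour would form a triangle, and both sets cannot be empty. Together with
    [near_nbrs_step2] this makes each far component with an edge bipartite, the side being
    determined by the set of near neighbours. *)
Lemma near_nbrs_neq v w : D v -> far v -> far w -> G v w ->
  near_nbrs v != near_nbrs w.
Proof.
move=> Dv fv fw vw; apply/eqP => E.
have := near_nbrs_neq0 Dv fv fw vw; rewrite -E orbb => /set0Pn[u uv].
have := uv; rewrite {1}E; move: uv; rewrite !inE => /andP[vu _] /andP[wu _].
by apply: (no_triangle noC3 vw wu); rewrite symG.
Qed.

Fixpoint subseqs (s : seq nat) : seq (seq nat) :=
  if s is x :: s' then subseqs s' ++ map (cons x) (subseqs s') else [:: [::]].

Lemma filter_subseqs (P : pred nat) s : filter P s \in subseqs s.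
Proof.
elim: s => [|x s IH] /=; first by rewrite inE.
by rewrite mem_cat; case: (P x); rewrite ?IH // orbC map_f.
Qed.

Definition clone_targets (I : seq nat) : seq nat :=
  [seq i <- iota 0 7 | all (fun j => touch (false, j) i) I].

Definition adjacent7 (i j : nat) : bool := (j == i.+1 %% 7) || (i == j.+1 %% 7).

(** Some two of the four extreme targets are adjacent on the cycle and hence coloured differently.
    The last two disjuncts cover in particular an end without near neighbours: all seven positions
    are then targets, and c_0 is adjacent to c_6. *)
Definition separated (s t : seq nat) : bool :=
  [&& s != [::], t != [::] &
  [|| adjacent7 (head 0 s) (head 0 t), adjacent7 (head 0 s) (last 0 t),
      adjacent7 (last 0 s) (head 0 t), adjacent7 (last 0 s) (last 0 t),
      adjacent7 (head 0 s) (last 0 s) | adjacent7 (head 0 t) (last 0 t)]].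

Definition clones_ok (I : seq nat) : bool :=
  all (fun i => all (fun j => j \in [:: i; (i + 2) %% 7; (i + 5) %% 7]) I) I.

Definition clones_edge_ok (I J : seq nat) : bool :=
  all (fun i => all (fun j => j \in
    [:: (i + 1) %% 7; (i + 3) %% 7; (i + 4) %% 7; (i + 6) %% 7]) J) I.

Lemma clones_separated I J : I \in subseqs (iota 0 7) -> J \in subseqs (iota 0 7) ->
  clones_ok I -> clones_ok J -> clones_edge_ok I J ->
  separated (clone_targets I) (clone_targets J).
Proof.
have H : all (fun I => clones_ok I ==> all (fun J => clones_ok J ==>
   clones_edge_ok I J ==> separated (clone_targets I) (clone_targets J))
   (subseqs (iota 0 7))) (subseqs (iota 0 7)) by vm_compute.
move=> hI hJ okI okJ okIJ; have := allP H _ hI; rewrite okI => /allP/(_ _ hJ).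
by rewrite okJ okIJ.
Qed.

Lemma clone_edge i j : i < 7 -> j < 7 -> compat_edge (false, i) (false, j) ->
  j \in [:: (i + 1) %% 7; (i + 3) %% 7; (i + 4) %% 7; (i + 6) %% 7].
Proof.
move=> lti ltj; apply/implyP; move: j ltj; apply: all7; move: i lti; apply: all7.
by vm_compute.
Qed.

Definition positions (v : V) : seq nat :=
  [seq i <- iota 0 7 | [exists u, G v u && typed G c u (false, i)]].

Lemma near_clone v w u : far v -> far w -> G v w -> u \in near_nbrs v ->
  exists2 i, i < 7 & typed G c u (false, i).
Proof.
move=> fv fw vw; rewrite inE => /andP[vu /classify[[[] i] Tt ut]].
  by case: (pendant_leaf noP9 noC3 noC5 cyc (type_lt Tt) ut fv fw _ vw); rewrite symG.
by exists i => //; apply: (type_lt Tt).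
Qed.

Lemma clone_type i : i < 7 -> (false, i) \in types.
Proof. by move: i; apply: all7; vm_compute. Qed.

(** Near neighbours of an end of a far edge are clones, by [pendant_leaf]. So the targets depend
    only on a subset of the seven positions, and [clones_separated] can be checked exhaustively. *)
Lemma targets_positions v w : far v -> far w -> G v w ->
  targets (near_nbrs v) = clone_targets (positions v).
Proof.
move=> fv fw vw; apply: eq_in_filter => k; rewrite mem_iota => /= ltk.
apply/forallP/allP => [H j|H u].
  rewrite mem_filter mem_iota => /andP[/existsP[u /andP[vu ut]] /= ltj].
  rewrite -(typed_adj noP9 noC3 noC5 cyc (clone_type ltj) ltk ut).
  have /implyP := H u; rewrite inE vu /=; apply.
  exact: (typed_near noP9 noC3 noC5 cyc (clone_type ltj) ut).
apply/implyP => uv; have [j ltj ut] := near_clone fv fw vw uv.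
rewrite (typed_adj noP9 noC3 noC5 cyc (clone_type ltj) ltk ut); apply: H.
rewrite mem_filter mem_iota /= ltj andbT; apply/existsP; exists u.
by move: uv; rewrite inE ut => /andP[-> _].
Qed.

Lemma positionsP v i : i \in positions v ->
  i < 7 /\ exists2 u, G v u & typed G c u (false, i).
Proof.
rewrite mem_filter mem_iota => /andP[/existsP[u /andP[vu ut]] lti].
by split=> //; exists u.
Qed.

Lemma positions_ok v : far v -> clones_ok (positions v).
Proof.
move=> fv; apply/allP => i /positionsP[lti [x vx xi]].
apply/allP => j /positionsP[ltj [y vy yj]]; apply: clone_clone => //.
exact: (compatP noP9 noC3 noC5 cyc fv vx vy xi yj).
Qed.

Lemma positions_edge_ok v w : far v -> far w -> G v w ->
  clones_edge_ok (positions v) (positions w).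
Proof.
move=> fv fw vw; apply/allP => i /positionsP[lti [x vx xi]].
apply/allP => j /positionsP[ltj [y wy yj]]; apply: clone_edge => //.
exact: (compat_edgeP noP9 noC3 noC5 cyc fv fw vw vx wy xi yj).
Qed.

Lemma edge_separated v w : far v -> far w -> G v w ->
  separated (targets (near_nbrs v)) (targets (near_nbrs w)).
Proof.
move=> fv fw vw; have wv : G w v by rewrite symG.
rewrite (targets_positions fv fw vw) (targets_positions fw fv wv).
apply: clones_separated; try exact: filter_subseqs; try exact: positions_ok.
exact: positions_edge_ok.
Qed.

Lemma adjacent7_col i j : i < 7 -> j < 7 -> adjacent7 i j -> phi (c i) != phi (c j).
Proof.
move=> lti ltj /orP[]/eqP->; first exact: phi_col (cyc lti).
by rewrite eq_sym; apply: phi_col (cyc ltj).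
Qed.

Lemma targets_lt A : all (fun i => i < 7) (targets A).
Proof. by apply/allP => i; rewrite mem_filter mem_iota => /andP[]. Qed.

Lemma ends_distinct v w : far v -> far w -> G v w ->
  let p := ends (near_nbrs v) in let q := ends (near_nbrs w) in
  ~~ [&& p.1 == q.1, p.1 == p.2 & q.1 == q.2].
Proof.
move=> fv fw vw; have /and3P[_ _] := edge_separated fv fw vw.
rewrite /ends /=; set s := targets _; set t := targets _.
have lth A : head 0 (targets A) < 7.
  by have := targets_lt A; case: (targets A) => //= i l /andP[].
have ltl A : last 0 (targets A) < 7.
  have := targets_lt A; case: (lastP (targets A)) => // l i.
  by rewrite all_rcons last_rcons => /andP[].
have := (lth (near_nbrs v), lth (near_nbrs w), ltl (near_nbrs v), ltl (near_nbrs w)).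
rewrite -/s -/t => -[[[h1 h2] h3] h4] H; apply/negP => /and3P[/eqP e1 /eqP e2 /eqP e3].
move: H => /or4P[|||/or3P[]] /adjacent7_col; rewrite ?h1 ?h2 ?h3 ?h4 => /(_ isT isT).
all: by rewrite -?e3 -?e2 -?e1 ?eqxx.
Qed.

Definition far_mate (v : V) : option V := [pick w | G v w && far w].

(* A component with an edge at distance 2 from the cycle is bipartite, with all
   vertices of one side having the same set of near neighbours; the two sides are
   told apart by the rank of this set. *)
Definition recolour (v : V) : 'I_3 :=
  if ~~ far v then phi v else
  let A := near_nbrs v in
  if far_mate v is Some w then
    let B := near_nbrs w in
    if enum_rank A < enum_rank B then (pick_distinct (ends A) (ends B)).1
    else (pick_distinct (ends B) (ends A)).2
  else if targets A is i :: _ then phi (c i) else phi v.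

Lemma far_mateP v w : far v -> far w -> G v w ->
  exists2 w', far_mate v = Some w' & near_nbrs w' = near_nbrs w.
Proof.
move=> fv fw vw; rewrite /far_mate; case: pickP => [w' /andP[vw' fw']|/(_ w)].
  by exists w' => //; apply: (near_nbrs_step2 fw' fv fw); rewrite // symG.
by rewrite vw fw.
Qed.

Lemma recolour_edge v w : D v -> far v -> far w -> G v w ->
  [/\ recolour v != recolour w, targets (near_nbrs v) != [::] &
      recolour v \in [:: (ends (near_nbrs v)).1; (ends (near_nbrs v)).2]].
Proof.
move=> Dv fv fw vw; have wv : G w v by rewrite symG.
have [v' mv Ev] := far_mateP fv fw vw; have [w' mw Ew] := far_mateP fw fv wv.
have /and3P[nv _ _] := edge_separated fv fw vw.
have := near_nbrs_neq Dv fv fw vw.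
rewrite /recolour fv fw mv mw Ev Ew /= nv.
have [d1 i1 j1] := pick_distinctP (ends_distinct fv fw vw).
have [d2 i2 j2] := pick_distinctP (ends_distinct fw fv wv).
(* Comparing ranks makes both ends of the edge evaluate [pick_distinct] on the same ordered pair,
   one taking the first component and the other the second. *)
case: ltngtP => [_ _|_ _|/val_inj/enum_rank_inj ->]; last by rewrite eqxx.
  by rewrite d1 i1.
by rewrite eq_sym d2 j2.
Qed.

Lemma recolour_far v : D v -> far v ->
  if targets (near_nbrs v) is i :: s then
    recolour v \in [:: phi (c i); phi (c (last i s))] else recolour v = phi v.
Proof.
move=> Dv fv; case Em: (far_mate v) => [w|].
  have [vw fw] : G v w /\ far w.
    by move: Em; rewrite /far_mate; case: pickP => // w' /andP[h1 h2] [<-].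
  have [_ + +] := recolour_edge Dv fv fw vw.
  by rewrite /ends; case: (targets _).
rewrite /recolour fv /= Em; case: (targets _) => // i s.
by rewrite inE eqxx.
Qed.

(** Near vertices keep their colour. A near neighbour of a far vertex is adjacent to all targets of
    the latter, hence differs from the colour of any target that it may adopt. *)
Lemma recolour_col u v : D u -> G u v -> recolour u != recolour v.
Proof.
move=> Du uv; have Dv := connect_trans1 Du uv.
have nf x y : G x y -> D y -> ~~ far x -> far y -> recolour x != recolour y.
  move=> xy Dy nx fy; have := recolour_far Dy fy.
  have Ex : recolour x = phi x by rewrite /recolour nx.
  have xt i : i \in targets (near_nbrs y) -> phi x != phi (c i).
    rewrite mem_filter => /andP[/forallP/(_ x)]; rewrite inE symG xy nx /= => xi _.
    exact: phi_col.
  case: (targets _) xt => [|i s] xt; first by move=> ->; rewrite Ex phi_col.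
  rewrite !inE Ex => /orP[]/eqP->; apply: xt; first by rewrite inE eqxx.
  exact: mem_last.
case nu: (~~ far u); case nv: (~~ far v).
- by rewrite /recolour nu nv phi_col.
- by apply: nf => //; move/negbT: nv; rewrite negbK.
- by rewrite eq_sym; apply: nf => //; [rewrite symG|move/negbT: nu; rewrite negbK].
- by case: (recolour_edge Du _ _ uv); move/negbT: nu nv; rewrite !negbK // => ? /negbT; rewrite negbK.
Qed.

Lemma good_seven : exists t psi, size t = 175 /\ good_guess t phi psi D.
Proof.
have [s [sz sN sH]] := all_kinds_hit noP9 noC3 noC5 cyc.
pose cs := [seq c i | i <- iota 0 7].
have [t [szt tE takeE]] : exists t,
    [/\ size t = 175, t =i cs ++ s & take 7 t = cs].
  have c0 : c 0 \in cs ++ s by rewrite inE eqxx.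
  exists ((cs ++ s) ++ nseq (168 - size s) (c 0)); split=> [|w|].
  - by rewrite !size_cat size_nseq size_map size_iota -addnA subnKC.
  - exact: mem_pad.
  - by rewrite -catA take_size_cat // size_map size_iota.
have nearE v : near t v = ~~ far v.
  rewrite /near takeE has_map negb_forall; apply/hasP/existsP => [[i]|[i]].
    by rewrite mem_iota => lti vi; exists (Ordinal (lti : i < 7)); rewrite negbK.
  by rewrite negbK => vi; exists (val i); rewrite // mem_iota ltn_ord.
have foldsE v : folds t v = [seq c i | i <- targets (near_nbrs v)].
  rewrite /folds takeE filter_map; congr map; apply: eq_filter => i.
  by apply: eq_forallb => u; rewrite inE nearE.
exists t, recolour; split=> //.
split=> [|v Dv]; first exact: recolour_col.
rewrite /admissible nearE negbK foldsE; case: ifP => [|_].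
  rewrite tE mem_cat => tv; have nv : ~~ far v.
    case/orP: tv => [/mapP[i]|/sN //]; rewrite mem_iota => /= lti ->.
    exact: far_c.
  by rewrite /recolour nv eqxx.
case fv: (far v) => /=; last first.
  have nv : ~~ far v by rewrite fv.
  rewrite /recolour nv; apply/andP; split.
    have /hasP[x /mem_take tx vx] : has (G v) (take 7 t) by rewrite -/(near t v) nearE.
    by apply/hasP; exists x.
  by apply/allP => x _; apply/implyP => /phi_col.
have := recolour_far Dv fv; case Et: (targets _) => [|i l] /=; last first.
  by rewrite !inE last_map.
(* A far vertex without targets keeps its colour under [phi]; being of some kind, it has a neighbour
   in [s]. *)
move=> ->; apply/andP; split; last by apply/allP => x _; apply/implyP => /phi_col.
have [k|k kk kv] := unfoldable_kind noP9 noC3 noC5 cyc fv.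
  move=> ltk; have : k \notin targets (near_nbrs v) by rewrite Et.
  rewrite mem_filter mem_iota /= ltk andbT => /forallPn[x].
  by rewrite negb_imply inE => /andP[/andP[vx nx] nxk]; exists x.
have /hasP[x sx vx] := sH _ _ kk fv kv.
by apply/hasP; exists x => //; rewrite tE mem_cat sx orbT.
Qed.

End SevenCycle.

Lemma good_guess_exists : exists t psi, size t = 175 /\ good_guess t phi psi D.
Proof.
have [[side sideP]|[p [cp oddp Dp]]] := bipartite_or_odd G r.
  exact: good_bipartite sideP.
(* The cycle of length 9 obtained below need not be shortest. A closed walk of length 7 is as good
   as a 7-cycle, since only adjacency of consecutive vertices is required; thus [good_nine] may
   assume that there is none. *)
have seven x : D x -> walk G 7 x x ->
    exists t psi, size t = 175 /\ good_guess t phi psi D.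
  move=> Dx /existsP[x1 /andP[e1]] /existsP[x2 /andP[e2]] /existsP[x3 /andP[e3]].
  case/existsP=> [x4 /andP[e4]] /existsP[x5 /andP[e5]] /existsP[x6 /andP[e6]].
  case/existsP=> [x7 /andP[e7]] /eqP E7; subst x7.
  pose q := [:: x; x1; x2; x3; x4; x5; x6].
  have cq : cycle G q by rewrite /= e1 e2 e3 e4 e5 e6 e7.
  apply: (good_seven (c := nth x q)) => i; first exact: (cycle_nth x cq).
  have [lt|ge] := ltnP i 7; last by rewrite nth_default.
  have xi : nth x q i \in q by apply: mem_nth.
  apply: connect_trans Dx _; apply: (path_connect (p := rcons (behead q) x)) => //.
  by move: xi; rewrite !inE; case: (_ == x) => //=; rewrite orbF.
have [m [c [Hm cyc Dc]]] := short_odd_cycle noP9 noC3 noC5 cp oddp Dp.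
move: Hm; rewrite !inE => /orP[]/eqP Em; subst m; first exact: (good_seven cyc Dc).
have [/existsP[x /andP[Dx w7]]|] := boolP [exists x, D x && walk G 7 x x].
  exact: seven Dx w7.
rewrite negb_exists => /forallP H; apply: (good_nine cyc Dc) => x Dx.
by have := H x; rewrite Dx.
Qed.

End Guess.

(** * 2-list colouring by propagation *)

(* Partial colourings of the vertices 0, ..., n - 1 are functions to nat, with 0
   for an uncoloured vertex. *)
Section Propagation.
Variables (n : nat) (g : rel nat).
Hypothesis g_sym : symmetric g.

Lemma iotaS_rcons k : iota 0 k.+1 = rcons (iota 0 k) k.
Proof. by rewrite -addn1 iotaD cats1. Qed.

Definition pairs : seq (nat * nat) := [seq (u, w) | u <- iota 0 n, w <- iota 0 n].

Lemma mem_pairs u w : ((u, w) \in pairs) = (u < n) && (w < n).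
Proof.
apply/allpairsP/andP => [[[i j]] [/=]|[ltu ltw]].
  by rewrite !mem_iota => /= lti ltj [-> ->].
by exists (u, w); rewrite !mem_iota.
Qed.

Section Closure.
Variable nv : nat -> nat -> nat.

(* An uncoloured neighbour w of a vertex of colour x > 0 receives colour nv w x,
   unless nv w x = 0. *)
Definition push (s : nat -> nat) (p : nat * nat) : nat -> nat :=
  fun j => if [&& j == p.2, g p.1 p.2, 0 < s p.1 & s p.2 == 0]
           then nv p.2 (s p.1) else s j.

Definition round (s : nat -> nat) : nat -> nat := foldl push s pairs.

Definition closure (s : nat -> nat) : nat -> nat := iter n round s.

Definition stable (s : nat -> nat) : Prop :=
  forall u w, u < n -> w < n -> g u w -> 0 < s u -> s w = 0 -> nv w (s u) = 0.

Definition stableb (s : nat -> nat) : bool :=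
  all (fun p => [&& g p.1 p.2, 0 < s p.1 & s p.2 == 0] ==> (nv p.2 (s p.1) == 0))
      pairs.

Lemma stableP s : reflect (stable s) (stableb s).
Proof.
apply: (iffP allP) => [H u w ltu ltw uw su sw|H [u w]].
  by have := H (u, w); rewrite mem_pairs ltu ltw uw su sw => /(_ isT)/eqP.
rewrite mem_pairs => /andP[ltu ltw]; apply/implyP => /and3P[uw su /eqP sw].
by apply/eqP; apply: H.
Qed.

Lemma push_keep s p j : 0 < s j -> push s p j = s j.
Proof.
rewrite /push; case: ifP => // /and4P[/eqP-> _ _ /eqP->].
by [].
Qed.

Lemma pushes_keep L s j : 0 < s j -> foldl push s L j = s j.
Proof.
by elim: L s => //= p L IH s sj; rewrite IH push_keep.
Qed.

Lemma pushes_hit L s u w : (u, w) \in L -> g u w -> 0 < s u ->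
  0 < nv w (s u) -> 0 < foldl push s L w.
Proof.
elim: L s => //= p L IH s; rewrite inE => /predU1P[<-|uwL] uw su nvw; last first.
  by apply: IH; rewrite ?push_keep.
have pw : 0 < push s (u, w) w.
  by rewrite /push /= eqxx uw su /=; case: (posnP (s w)).
by rewrite pushes_keep.
Qed.

Definition size_of (s : nat -> nat) : nat := count (fun j => 0 < s j) (iota 0 n).

Lemma round_grows s : ~~ stableb s -> size_of s < size_of (round s).
Proof.
case/allPn=> -[u w] uwp; rewrite negb_imply /= -lt0n => /andP[/and3P[uw su /eqP sw] nvw].
have rw := pushes_hit uwp uw su nvw.
have := uwp; rewrite mem_pairs => /andP[_ ltw].
have sub : subpred (fun j => 0 < s j) (fun j => 0 < round s j).
  by move=> j /= sj; rewrite /round pushes_keep.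
rewrite /size_of -(cat_take_drop w (iota 0 n)) !count_cat.
have -> : drop w (iota 0 n) = w :: drop w.+1 (iota 0 n).
  by rewrite (drop_nth 0) ?size_iota // nth_iota.
rewrite /= sw /= rw.
have := sub_count sub (take w (iota 0 n)); have := sub_count sub (drop w.+1 (iota 0 n)).
by lia.
Qed.

Lemma round_stable s j : stable s -> round s j = s j.
Proof.
move=> st; rewrite /round; have : {subset pairs <= pairs} by [].
elim: {1 3}pairs s st => //= p L IH s st sub.
have E i : push s p i = s i.
  rewrite /push; case: ifP => // /and4P[/eqP-> uw su /eqP sw].
  have : p \in pairs by rewrite sub // inE eqxx.
  by rewrite [p]surjective_pairing mem_pairs => /andP[lt1 lt2]; rewrite st.
rewrite IH ?E //; last by move=> q qL; rewrite sub // inE qL orbT.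
by move=> u w lu lw uw; rewrite !E; apply: st.
Qed.

(** Every round that starts unstable colours at least one more vertex, so among the first n + 1
    iterates one is stable. *)
Lemma closure_stable s : stable (closure s).
Proof.
have grow k : (forall i, i < k -> ~~ stableb (iter i round s)) -> k <= size_of (iter k round s).
  elim: k => // k IH H; rewrite iterS; apply: leq_ltn_trans (round_grows (H k _)) => //.
  by apply: IH => i lti; apply: H; apply: ltnW.
have [i lei sti] : exists2 i, i <= n & stable (iter i round s).
  have [/hasP[i]|/hasPn H] := boolP (has (fun i => stableb (iter i round s)) (iota 0 n.+1)).
    by rewrite mem_iota => lti /stableP; exists i.
  have : n.+1 <= size_of (iter n.+1 round s).
    by apply: grow => i lti; apply: H; rewrite mem_iota.
  by have := count_size (fun j => 0 < iter n.+1 round s j) (iota 0 n);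
    rewrite size_iota /size_of; lia.
rewrite /closure -(subnK lei) iterD; elim: (n - i) => //= k IH.
by move=> u w lu lw uw; rewrite !round_stable //; apply: IH.
Qed.

Lemma closure_keep s j : 0 < s j -> closure s j = s j.
Proof.
rewrite /closure => sj; elim: n => //= k IH.
by rewrite {1}/round pushes_keep IH.
Qed.

(** The last premise is there because [push] agrees with the displayed update only pointwise. *)
Lemma closure_ind (P : (nat -> nat) -> Prop) s : P s ->
  (forall s u w, u < n -> w < n -> g u w -> 0 < s u -> s w = 0 -> P s ->
     P (fun j => if j == w then nv w (s u) else s j)) ->
  (forall s s', s =1 s' -> P s -> P s') ->
  P (closure s).
Proof.
move=> Ps IHP ext; rewrite /closure; elim: {1}n => //= k.
move: (iter k round s) => {}s {}Ps; rewrite /round.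
have : {subset pairs <= pairs} by [].
elim: {1 3}pairs s Ps => //= p L IH s Ps sub; apply: IH; last first.
  by move=> q qL; rewrite sub // inE qL orbT.
have : p \in pairs by rewrite sub // inE eqxx.
rewrite [p]surjective_pairing mem_pairs => /andP[lt1 lt2].
case E: [&& g p.1 p.2, 0 < s p.1 & s p.2 == 0].
  have /and3P[uw su /eqP sw] := E.
  apply: ext (IHP s p.1 p.2 lt1 lt2 uw su sw Ps) => j.
  by rewrite /push /= E andbT.
by apply: ext Ps => j; rewrite /push /= E andbF.
Qed.

End Closure.

Variables P Q : nat -> nat.
Hypothesis PQ_range : forall v, v < n -> (0 < P v <= 3) && (0 < Q v <= 3).

(** If both entries of the list of [w] equal [x], then [w] receives [x] itself and the clash is left
    to [conflict]. *)
Definition other (w x : nat) : nat :=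
  if P w == x then Q w else if Q w == x then P w else 0.

Definition conflict (s : nat -> nat) : bool :=
  has (fun u => has (fun w => [&& g u w, 0 < s u & s u == s w]) (iota 0 n)) (iota 0 n).

Lemma conflictP s : ~~ conflict s ->
  forall u w, u < n -> w < n -> g u w -> 0 < s u -> s u != s w.
Proof.
move=> nc u w lu lw uw su; apply: contra nc => E.
by apply/hasP; exists u; rewrite ?mem_iota //; apply/hasP; exists w; rewrite ?mem_iota // uw su.
Qed.

Definition assign (s : nat -> nat) (v col : nat) : nat -> nat :=
  fun j => if j == v then col else s j.

Definition try_colour (s : nat -> nat) (v col : nat) : nat -> nat :=
  let s' := closure other (assign s v col) in if conflict s' then s else s'.

Definition solve_vertex (s : nat -> nat) (v : nat) : nat -> nat :=
  if 0 < s v then s else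
  let s' := try_colour s v (P v) in
  if 0 < s' v then s' else try_colour s' v (Q v).

Definition solve : nat -> nat := foldl solve_vertex (fun=> 0) (iota 0 n).

(** As the list entries are positive, stability says that the colour of a coloured vertex is in the
    list of none of its uncoloured neighbours. What has been coloured therefore never restricts the
    rest and need not be revised. *)
Definition sound (s : nat -> nat) : Prop :=
  [/\ stable other s,
      forall u w, u < n -> w < n -> g u w -> 0 < s u -> s u != s w
    & forall u, u < n -> s u <= 3].

Lemma try_sound s v col : sound s -> v < n -> s v = 0 -> 0 < col <= 3 ->
  sound (try_colour s v col) /\
  forall u, 0 < s u -> try_colour s v col u = s u.
Proof.
move=> snd ltv sv /andP[col0 col3]; rewrite /try_colour.
case: ifP => [//|/negbT nc]; split; last first.
  move=> u su; rewrite closure_keep /assign; first by case: eqP su => // ->; rewrite sv.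
  by case: eqP su => // ->; rewrite sv.
split; [exact: closure_stable|exact: conflictP|].
case: snd => _ _ s3.
apply: (@closure_ind _ (fun s => forall u, u < n -> s u <= 3)).
- by move=> u ltu; rewrite /assign; case: eqP => // _; apply: s3.
- move=> s' u w _ ltw _ _ _ s3' j ltj; case: eqP => [Ej|_]; last exact: s3'.
  have /andP[/andP[_ P3] /andP[_ Q3]] := PQ_range ltw.
  by rewrite /other; do 2! case: ifP => //.
- by move=> s1 s2 E H u ltu; rewrite -E; apply: H.
Qed.

Section Solvable.
Variables (D : pred nat) (psi : nat -> nat).
Hypothesis D_closed : forall u w, u < n -> w < n -> g u w -> D u -> D w.
Hypothesis psi_col : forall u w, u < n -> w < n -> g u w -> D u -> psi u != psi w.
Hypothesis psi_PQ : forall u, u < n -> D u -> (psi u == P u) || (psi u == Q u).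

Lemma psi_gt0 u : u < n -> D u -> 0 < psi u.
Proof.
move=> ltu Du; have /andP[/andP[p0 _] /andP[q0 _]] := PQ_range ltu.
by case/orP: (psi_PQ ltu Du) => /eqP->.
Qed.

(* Forced colours agree with psi: a vertex coloured before never forces anything
   new, since s is stable. *)
Lemma try_succeeds s v : sound s -> v < n -> D v -> s v = 0 ->
  0 < try_colour s v (psi v) v.
Proof.
move=> [sst sprop s3] ltv Dv sv; have pv := psi_gt0 ltv Dv.
rewrite /try_colour; set s' := closure _ _.
have sv' : s' v = psi v by rewrite /s' closure_keep /assign eqxx.
suff nc : ~~ conflict s' by rewrite (negbTE nc) sv'.
have J : forall u, u < n -> (0 < s u -> s' u = s u) /\
    (s u = 0 -> 0 < s' u -> D u /\ s' u = psi u).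
  apply: (@closure_ind _ (fun s' => forall u, u < n -> (0 < s u -> s' u = s u) /\
    (s u = 0 -> 0 < s' u -> D u /\ s' u = psi u))).
  - move=> u ltu; rewrite /assign; case: eqP => [->|_].
      by split=> //; rewrite sv.
    by split=> // ->.
  - move=> t u w ltu ltw uw tu tw H j ltj; case: eqP => [->|_]; last exact: H.
    have sw : s w = 0.
      by apply/eqP; rewrite -leqn0 leqNgt; apply/negP => sw; have [/(_ sw)] := H w ltw; lia.
    split=> [|_ nz]; first by rewrite sw.
    have [Hu Hu'] := H u ltu; have [su|su] := posnP (s u); last first.
      move: nz; rewrite Hu //; have := sst u w ltu ltw uw su sw.
      by move=> ->.
    have [Du Eu] := Hu' su tu.
    have Dw := D_closed ltu ltw uw Du; split=> //.
    have nuw := psi_col ltu ltw uw Du; rewrite Eu in nz *.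
    move: nz nuw (psi_PQ ltw Dw); rewrite /other.
    case: eqP => [<-|_]; first by rewrite eq_sym => _ /negbTE-> /=  /eqP->.
    case: eqP => [<-|_ //]; rewrite eq_sym => _ /negbTE->; rewrite orbF.
    by move/eqP->.
  - by move=> s1 s2 E H u ltu; rewrite -E; apply: H.
(* By stability the old colour of [u] is not in the list of [w], whereas the new colour of [w]
   is. *)
have mixed u w : u < n -> w < n -> g u w -> 0 < s u -> s w = 0 -> 0 < s' w ->
    s' u != s' w.
  move=> ltu ltw uw su sw sw'; have [-> // _] := J u ltu.
  have [_ /(_ sw sw')[Dw ->]] := J w ltw.
  have := sst u w ltu ltw uw su sw; have := psi_PQ ltw Dw; rewrite /other.
  have /andP[/andP[p0 _] /andP[q0 _]] := PQ_range ltw.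
  case: (P w =P s u) => [Pw|/eqP nP]; first by move=> _ E; rewrite E in q0.
  case: (Q w =P s u) => [Qw|/eqP nQ]; first by move=> _ E; rewrite E in p0.
  by case/orP=> /eqP-> _; rewrite eq_sym.
apply/negP => /hasP[u]; rewrite mem_iota => /= ltu /hasP[w]; rewrite mem_iota => /= ltw.
case/and3P=> uw su' E; have sw' : 0 < s' w by rewrite -(eqP E).
have [su|su] := posnP (s u); have [sw|sw] := posnP (s w).
- have [_ /(_ su su')[Du Eu]] := J u ltu; have [_ /(_ sw sw')[Dw Ew]] := J w ltw.
  by have := psi_col ltu ltw uw Du; rewrite -Eu -Ew E.
- by have := mixed w u ltw ltu; rewrite g_sym eq_sym E => /(_ uw sw su su').
- by have := mixed u w ltu ltw uw su sw sw'; rewrite E.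
- have [/(_ su) Eu _] := J u ltu; have [/(_ sw) Ew _] := J w ltw.
  by have := sprop u w ltu ltw uw su; rewrite -Eu -Ew E.
Qed.

Lemma solve_vertex_succeeds s v : sound s -> v < n -> D v -> 0 < solve_vertex s v v.
Proof.
move=> snd ltv Dv; rewrite /solve_vertex; case: ifP => // /negbT.
rewrite -eqn0Ngt => /eqP sv; case: ifP => // /negbT nP.
have /andP[p q] := PQ_range ltv.
have [snd' _] := try_sound snd ltv sv p.
case/orP: (psi_PQ ltv Dv) => /eqP Epsi.
  by move: nP; rewrite -Epsi try_succeeds.
rewrite -Epsi; apply: try_succeeds => //.
by apply/eqP; rewrite eqn0Ngt.
Qed.

End Solvable.

Lemma solve_vertex_sound s v : sound s -> v < n -> sound (solve_vertex s v) /\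
  forall u, 0 < s u -> solve_vertex s v u = s u.
Proof.
move=> snd ltv; rewrite /solve_vertex; case: ifP => // /negbT.
rewrite -eqn0Ngt => /eqP sv; have /andP[p q] := PQ_range ltv.
have [snd' keep'] := try_sound snd ltv sv p.
case: ifP => // /negbT; rewrite -eqn0Ngt => /eqP sv'.
have [snd'' keep''] := try_sound snd' ltv sv' q.
by split=> // u su; rewrite keep'' keep'.
Qed.

(** [D] and [psi] are quantified after the run, as the solver does not know on which components the
    guess is good. *)
Lemma solve_prefix k : k <= n ->
  let s := foldl solve_vertex (fun=> 0) (iota 0 k) in
  sound s /\
  forall (D : pred nat) psi,
    (forall u w, u < n -> w < n -> g u w -> D u -> D w) ->
    (forall u w, u < n -> w < n -> g u w -> D u -> psi u != psi w) ->
    (forall u, u < n -> D u -> (psi u == P u) || (psi u == Q u)) ->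
    forall u, u < k -> D u -> 0 < s u.
Proof.
elim: k => [_|k IH ltk]; first by split=> //; split.
rewrite iotaS_rcons foldl_rcons /=.
have [snd succ] := IH (ltnW ltk); set s := foldl _ _ _ in snd succ *.
have [snd' keep] := solve_vertex_sound snd ltk; split=> //.
move=> D psi H1 H2 H3 u; rewrite ltnS leq_eqVlt => /orP[/eqP->|ltu] Du.
  exact: (solve_vertex_succeeds H1 H2 H3).
have su := succ _ _ H1 H2 H3 u ltu Du.
by rewrite keep.
Qed.

(** Propagating the constant 1 from the uncoloured vertices computes the union of the components on
    which the solver failed. *)
Definition tainted : nat -> nat := closure (fun _ _ => 1) (fun u => 1 - solve u).

Definition accept (fin : nat -> nat) : nat -> nat :=
  fun u => if 0 < tainted u then fin u else solve u.

(* fin is a proper colouring of a union of components *)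
Definition proper_part (fin : nat -> nat) : Prop :=
  (forall u, u < n -> fin u <= 3) /\
  forall u w, u < n -> w < n -> g u w -> 0 < fin u -> (0 < fin w) && (fin u != fin w).

Lemma solve_untainted u : tainted u = 0 -> 0 < solve u.
Proof.
move=> tu; rewrite lt0n; apply/eqP => su; move: tu.
by rewrite /tainted closure_keep su.
Qed.

(** No edge joins a tainted vertex to an untainted one, so the old and the new colouring never
    meet. *)
Lemma accept_proper fin : proper_part fin ->
  proper_part (accept fin) /\ forall u, 0 < fin u -> 0 < accept fin u.
Proof.
have [[_ prop s3] _] := solve_prefix (leqnn n); rewrite -/solve in prop s3.
have taintE u w : u < n -> w < n -> g u w -> 0 < tainted u -> 0 < tainted w.
  move=> ltu ltw uw tu; rewrite lt0n; apply/eqP => tw.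
  by have := closure_stable ltu ltw uw tu tw.
move=> [fin3 finp]; split; last first.
  move=> u fu; rewrite /accept; case: ifP => // /negbT.
  by rewrite -eqn0Ngt => /eqP/solve_untainted.
split=> [u ltu|u w ltu ltw uw]; rewrite /accept.
  by case: ifP => _; [apply: fin3|apply: s3].
have [tu|tu] := posnP (tainted u); have [tw|tw] := posnP (tainted w).
- by move=> su; rewrite solve_untainted // prop.
- by have := taintE w u ltw ltu; rewrite g_sym tu => /(_ uw tw).
- by have := taintE u w ltu ltw uw tu; rewrite tw.
- exact: finp.
Qed.

Lemma accept_succeeds fin (D : pred nat) psi :
  (forall u w, u < n -> w < n -> g u w -> D u -> D w) ->
  (forall u w, u < n -> w < n -> g u w -> D u -> psi u != psi w) ->
  (forall u, u < n -> D u -> (psi u == P u) || (psi u == Q u)) ->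
  forall u, u < n -> D u -> 0 < accept fin u.
Proof.
move=> H1 H2 H3 u ltu Du.
have [_ /(_ _ _ H1 H2 H3)] := solve_prefix (leqnn n); rewrite -/solve => succ.
have H : forall u, u < n -> D u -> tainted u = 0.
  apply: (@closure_ind _ (fun t => forall u, u < n -> D u -> t u = 0)).
  - move=> v ltv Dv; have := succ v ltv Dv; lia.
  - move=> t v w ltv ltw vw tv tw IH x ltx Dx; case: eqP => [Ex|_]; last exact: IH.
    subst x; have Dv : D v by apply: (H1 w v); rewrite // g_sym.
    by rewrite (IH v) in tv.
  - by move=> s1 s2 E IH v ltv Dv; rewrite -E IH.
by rewrite /accept H //; apply: succ.
Qed.

End Propagation.

(** * The program *)

Arguments mset : simpl never.

(** * Evaluation of commands without input and output *)

Section Pure.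
Variable n : nat.

Fixpoint ev (c : cmd) (m : mem) : mem :=
  match c with
  | Sto a e1 e2 => mset m a (value n e1 m) (value n e2 m)
  | Then c1 c2 => ev c2 (ev c1 m)
  | Ifp e c1 c2 => if 0 < value n e m then ev c1 m else ev c2 m
  | For a b c => foldl (fun m i => ev c (mset m a 0 i)) m (iota 0 (bound n b))
  | Skip | Rd _ _ | Wr _ => m
  end.

Fixpoint pure (c : cmd) : bool :=
  match c with
  | Skip | Sto _ _ _ => true
  | Then c1 c2 | Ifp _ c1 c2 => pure c1 && pure c2
  | For _ _ c => pure c
  | Rd _ _ | Wr _ => false
  end.

Lemma run_pure c m x y : pure c -> run n c (m, x, y) = (ev c m, x, y).
Proof.
elim: c m => //= [c1 IH1 c2 IH2 m /andP[p1 p2]|e c1 IH1 c2 IH2 m /andP[p1 p2]|a b c IH m p].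
- by rewrite IH1 // IH2.
- by case: ifP => _; [apply: IH1|apply: IH2].
elim: (iota _ _) m => //= i s IHs m.
by rewrite IH // IHs.
Qed.

Fixpoint mods (c : cmd) : seq nat :=
  match c with
  | Sto a _ _ => [:: a]
  | Then c1 c2 | Ifp _ c1 c2 => mods c1 ++ mods c2
  | For a _ c => a :: mods c
  | Skip | Rd _ _ | Wr _ => [::]
  end.

Lemma mset_other m a i v b : b != a -> mset m a i v b = m b.
Proof. by rewrite /mset => /negbTE->. Qed.

Lemma mset_same m a i v j : mset m a i v a j = if j == i then v else m a j.
Proof. by rewrite /mset eqxx. Qed.

Lemma ev_frame c m b : b \notin mods c -> ev c m b = m b.
Proof.
elim: c m => //= [a e1 e2 m|c1 IH1 c2 IH2 m|e c1 IH1 c2 IH2 m|a k c IH m].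
- by rewrite inE => ne; apply: mset_other.
- by rewrite mem_cat negb_or => /andP[h1 h2]; rewrite IH2 // IH1.
- by rewrite mem_cat negb_or => /andP[h1 h2]; case: ifP => _; rewrite ?IH1 ?IH2.
rewrite inE negb_or => /andP[ne h].
by elim: (iota _ _) m => //= i s IHs m; rewrite IHs IH // mset_other.
Qed.

(** Each round may also assume that the arrays not modified by the loop have their initial contents,
    which spares every invariant from saying so. *)
Lemma for_ind (I : nat -> mem -> Prop) a b c m :
  I 0 m ->
  (forall i m', i < bound n b -> (forall d, d \notin a :: mods c -> m' d = m d) ->
     I i m' -> I i.+1 (ev c (mset m' a 0 i))) ->
  I (bound n b) (ev (For a b c) m).
Proof.
move=> I0 H /=; set k := bound n b in H *.
suff [] : let m' := foldl (fun m i => ev c (mset m a 0 i)) m (iota 0 k) in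
  I k m' /\ forall d, d \notin a :: mods c -> m' d = m d by [].
elim: {-2}k (leqnn k) => [|i IH] lti; first by [].
rewrite iotaS_rcons !foldl_rcons /=; have [Ii fr] := IH (ltnW lti).
split=> [|d]; first exact: H.
by rewrite inE negb_or => /andP[ne nc]; rewrite ev_frame // mset_other // fr // inE negb_or ne.
Qed.

Lemma for_fold (T : Type) (R : mem -> T -> Prop) (f : T -> nat -> T) a b c m t :
  R m t ->
  (forall i m' t', i < bound n b -> (forall d, d \notin a :: mods c -> m' d = m d) ->
     R m' t' -> R (ev c (mset m' a 0 i)) (f t' i)) ->
  R (ev (For a b c) m) (foldl f t (iota 0 (bound n b))).
Proof.
move=> R0 H; pose I k m' := R m' (foldl f t (iota 0 k)).
apply: (for_ind (I := I)) => // i m' lti fr Ii.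
by rewrite /I iotaS_rcons foldl_rcons; apply: H.
Qed.

Lemma for_assign a b c s (p : pred nat) (f : nat -> nat) m : a != s ->
  (forall i m', i < bound n b -> (forall d, d \notin a :: mods c -> m' d = m d) ->
     ev c (mset m' a 0 i) s 0 = if p i then f i else m' s 0) ->
  ev (For a b c) m s 0 = last (m s 0) [seq f i | i <- iota 0 (bound n b) & p i].
Proof.
move=> ne H; pose R (m : mem) x := m s 0 = x.
have -> : last (m s 0) [seq f i | i <- iota 0 (bound n b) & p i] =
    foldl (fun x i => if p i then f i else x) (m s 0) (iota 0 (bound n b)).
  elim: (iota _ _) (m s 0) => //= i l IH x; rewrite -IH.
  by case: (p i).
apply: (for_fold (R := R)) => // i m' x lti fr <-; exact: H.
Qed.

Lemma for_fill a b c A (F : nat -> nat) m : a != A ->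
  (forall i m', i < bound n b -> (forall d, d \notin a :: A :: mods c -> m' d = m d) ->
     m' A i = m A i ->
     forall j, ev c (mset m' a 0 i) A j = if j == i then F i else m' A j) ->
  forall j, j < bound n b -> ev (For a b c) m A j = F j.
Proof.
move=> ne H j ltj; pose I k m' := forall j, m' A j = if j < k then F j else m A j.
suff : I (bound n b) (ev (For a b c) m) by move/(_ j); rewrite ltj.
apply: for_ind => // i m' lti fr Ii k.
rewrite H => [||d|] //; last by rewrite Ii ltnn.
  rewrite Ii ltnS; case: ltngtP => // [->]; exact: erefl.
by rewrite !inE !negb_or => /and3P[h1 h2 h3]; apply: fr; rewrite inE negb_or h1.
Qed.

Definition var (a : nat) : exp := Cell a (Cst 0).
Definition Not (e : exp) : exp := Minus (Cst 1) e.
Definition And (e1 e2 : exp) : exp := Not (Plus (Not e1) (Not e2)).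
Definition Eq (e1 e2 : exp) : exp := Not (Plus (Minus e1 e2) (Minus e2 e1)).

Lemma posNot e m : (0 < value n (Not e) m) = (value n e m == 0).
Proof. by rewrite /=; lia. Qed.

Lemma posAnd e1 e2 m :
  (0 < value n (And e1 e2) m) = (0 < value n e1 m) && (0 < value n e2 m).
Proof. by rewrite /=; lia. Qed.

Lemma posEq e1 e2 m : (0 < value n (Eq e1 e2) m) = (value n e1 m == value n e2 m).
Proof. by rewrite /=; lia. Qed.

End Pure.

Notation "c1 ;; c2" := (Then c1 c2) (at level 90, right associativity).

Notation aAdj := 0.
Notation aRow := 1.
Notation aT := 2.
Notation aC := 3.
Notation aNear := 4.
Notation aOk := 5.
Notation aP := 6.
Notation aQ := 7.
Notation aS := 8.
Notation aS2 := 9.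
Notation aBad := 10.
Notation aFin := 11.
Notation xU := 12.
Notation xW := 13.
Notation xR := 14.
Notation xI := 15.
Notation xV := 16.
Notation xP := 17.
Notation xB := 18.
Notation xCol := 19.
Notation xX := 20.
Notation xY := 21.
Notation xCnt := 22.

(** [aRow] holds the multiples of n, accumulated while reading the input, because the machine cannot
    multiply. *)
Definition edge (e1 e2 : exp) : exp := Cell aAdj (Plus (Cell aRow e1) e2).
Definition assign_var (x : nat) (e : exp) : cmd := Sto x (Cst 0) e.
Definition when (e : exp) (c : cmd) : cmd := Ifp e c Skip.
Definition unless (e : exp) (c : cmd) : cmd := Ifp e Skip c.

Definition near_cmd : cmd :=
  For xU None (assign_var xB (Cst 0) ;;
    For xI (Some 7) (when (edge (var xU) (Cell aT (var xI))) (assign_var xB (Cst 1))) ;;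
    Sto aNear (var xU) (var xB)).

Definition ok_cmd : cmd :=
  For xI (Some 7) (assign_var xB (Cst 1) ;;
    For xU None (when (And (edge (var xV) (var xU)) (And (Cell aNear (var xU))
                        (Not (edge (var xU) (Cell aT (var xI))))))
                   (assign_var xB (Cst 0))) ;;
    Sto aOk (var xI) (var xB)).

Definition guessed : exp := Cell aC (var xI).

(* first = true computes the smaller of the two colours other than C[I], and the
   first of the fold targets; first = false the larger one and the last target *)
Definition other_colour (first : bool) : exp :=
  if first then Plus (Cst 1) (Minus (Cst 1) (Minus guessed (Cst 1)))
  else Minus (Cst 3) (Minus guessed (Cst 2)).

(** A loop keeps its last assignment, so the first target is found by running through the positions
    downwards. *)
Definition target (first : bool) : exp :=
  if first then Minus (Cst 6) (var xI) else var xI.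

Definition hit_cmd (K : nat) (first : bool) : cmd :=
  For xI (Some K) (when (edge (var xV) (Cell aT (var xI)))
                     (assign_var xP (other_colour first))).

Definition fold_cmd (first : bool) : cmd :=
  For xI (Some 7) (when (Cell aOk (target first)) (assign_var xP (Cell aC (target first)))).

Definition own_cmd (K : nat) : cmd :=
  For xI (Some K) (when (Eq (Cell aT (var xI)) (var xV)) (assign_var xP guessed)).

(** Later assignments override earlier ones, which realises the order of the cases in [admissible].
    The defaults 1 and 2 keep the lists in range where nothing applies. *)
Definition cand_cmd (K : nat) (first : bool) (A : nat) : cmd :=
  For xV None (
    assign_var xP (Cst (if first then 1 else 2)) ;;
    hit_cmd K first ;;
    unless (Cell aNear (var xV)) (ok_cmd ;; fold_cmd first) ;;
    own_cmd K ;;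
    Sto A (var xV) (var xP)).

Definition closure_cmd (A : nat) (body : cmd) : cmd :=
  For xR None (For xU None (For xW None (
    when (And (edge (var xU) (var xW))
              (And (Cell A (var xU)) (Not (Cell A (var xW))))) body))).

Definition force_cmd : cmd :=
  Ifp (Eq (Cell aP (var xW)) (Cell aS2 (var xU))) (Sto aS2 (var xW) (Cell aQ (var xW)))
    (when (Eq (Cell aQ (var xW)) (Cell aS2 (var xU)))
       (Sto aS2 (var xW) (Cell aP (var xW)))).

Definition try_cmd (e : exp) : cmd :=
  assign_var xCol e ;;
  For xU None (Sto aS2 (var xU) (Cell aS (var xU))) ;;
  Sto aS2 (var xV) (var xCol) ;;
  closure_cmd aS2 force_cmd ;;
  assign_var xB (Cst 0) ;;
  For xU None (For xW None (
    when (And (edge (var xU) (var xW)) (And (Cell aS2 (var xU))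
            (Eq (Cell aS2 (var xU)) (Cell aS2 (var xW))))) (assign_var xB (Cst 1)))) ;;
  unless (var xB) (For xU None (Sto aS (var xU) (Cell aS2 (var xU)))).

Definition solve_cmd : cmd :=
  For xV None (Sto aS (var xV) (Cst 0)) ;;
  For xV None (unless (Cell aS (var xV)) (try_cmd (Cell aP (var xV)) ;;
    unless (Cell aS (var xV)) (try_cmd (Cell aQ (var xV))))).

Definition accept_cmd : cmd :=
  For xU None (Sto aBad (var xU) (Minus (Cst 1) (Cell aS (var xU)))) ;;
  closure_cmd aBad (Sto aBad (var xW) (Cst 1)) ;;
  For xU None (unless (Cell aBad (var xU)) (Sto aFin (var xU) (Cell aS (var xU)))).

Definition attempt_cmd (K : nat) : cmd :=
  near_cmd ;; cand_cmd K true aP ;; cand_cmd K false aQ ;; solve_cmd ;; accept_cmd.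

(** The nesting is unfolded in the program text: K loops over the vertices and K over the colours.
    Since K does not depend on the input, the cost is polynomial in n. *)
Fixpoint guess_cmd (K k : nat) : cmd :=
  if k is k'.+1 then
    For xX None (Sto aT (Cst k') (var xX) ;;
      For xY (Some 3) (Sto aC (Cst k') (Plus (var xY) (Cst 1)) ;; guess_cmd K k'))
  else attempt_cmd K.

(** * The commands compute the functions of the propagation *)

Section Refinement.
Variables (n : nat) (g : rel nat).

Notation ev := (ev n).

Definition graph_mem (m : mem) : Prop :=
  forall u v, u < n -> v < n -> m aAdj (m aRow u + v) = g u v.

Lemma graph_frame m m' : m' aAdj = m aAdj -> m' aRow = m aRow ->
  graph_mem m -> graph_mem m'.
Proof. by rewrite /graph_mem => -> ->. Qed.

Definition agrees (f s : nat -> nat) : Prop := forall j, j < n -> f j = s j.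

Lemma foldl_pairs (T : Type) (f : T -> nat * nat -> T) t :
  foldl f t (pairs n) =
  foldl (fun t u => foldl (fun t w => f t (u, w)) t (iota 0 n)) t (iota 0 n).
Proof.
suff H l l' : foldl f t [seq (u, w) | u <- l, w <- l'] =
    foldl (fun t u => foldl (fun t w => f t (u, w)) t l') t l by apply: H.
elim: l t => //= u l IH t; rewrite foldl_cat IH; congr (foldl _ _ _).
by elim: l' t {IH} => //= w l' IH t; rewrite IH.
Qed.

Lemma iter_foldl (T : Type) (f : T -> T) t i k :
  iter k f t = foldl (fun t _ => f t) t (iota i k).
Proof. by elim: k i t => // k IH i t; rewrite iterSr (IH i.+1). Qed.

(** The body is arbitrary because both the forcing of colours and the marking of tainted components
    are instances. *)
Lemma closure_cmdP A body nv m s :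
  A \notin [:: aAdj; aRow; xR; xU; xW] ->
  all (fun d => d \notin mods body) [:: aAdj; aRow; xU; xW] ->
  graph_mem m ->
  (forall m', (forall d, d \notin A :: mods (closure_cmd A body) -> m' d = m d) ->
     let u := m' xU 0 in let w := m' xW 0 in u < n -> w < n -> 0 < m' A u ->
     m' A w = 0 -> forall j, ev body m' A j = if j == w then nv w (m' A u) else m' A j) ->
  agrees (m A) s ->
  agrees (ev (closure_cmd A body) m A) (closure n g nv s).
Proof.
rewrite !inE !negb_or => /and5P[A0 A1 AR AU AW] /and5P[b0 b1 bU bW _] gm Hb eqs.
rewrite /closure.
have -> : iter n (round n g nv) s =
    foldl (fun s _ => round n g nv s) s (iota 0 (bound n None)).
  exact: iter_foldl.
apply: (for_fold (R := fun m s => agrees (m A) s)) => // r m1 s1 _ fr1 eq1.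
rewrite /round foldl_pairs.
apply: (for_fold (R := fun m s => agrees (m A) s)).
  by rewrite mset_other.
move=> u m2 s2 ltu fr2 eq2.
apply: (for_fold (R := fun m s => agrees (m A) s)).
  by rewrite mset_other.
move=> w m3 s3 ltw fr3 eq3; rewrite [bound _ _]/= in ltu ltw.
set m4 := mset m3 xW 0 w.
have fr d : d \notin A :: mods (closure_cmd A body) -> m4 d = m d.
  rewrite inE negb_or => /andP[dA]; rewrite /closure_cmd /= !inE cats0 !negb_or.
  case/and4P=> dR dU dW db.
  rewrite /m4 mset_other // fr3 /= ?inE ?negb_or ?cats0 ?dW ?db // mset_other //.
  rewrite fr2 /= ?inE ?negb_or ?cats0 ?dU ?dW ?db // mset_other //.
  by rewrite fr1 //= !inE !negb_or cats0 dR dU dW db.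
have b4U : m4 xU 0 = u.
  rewrite /m4 mset_other // fr3; first by rewrite mset_same.
  by rewrite /= !inE cats0 negb_or bU.
have b4W : m4 xW 0 = w by rewrite /m4 mset_same.
have gm4 : graph_mem m4.
  apply: graph_frame gm; rewrite fr // /= !inE !cats0 !negb_or.
    by rewrite eq_sym A0 b0.
  by rewrite eq_sym A1 b1.
have A4 : m4 A = m3 A by rewrite /m4 mset_other.
move=> j ltj; rewrite [ev _ _]/= -/m4 -[_ - _]/(value n (And (edge (var xU) (var xW))
              (And (Cell A (var xU)) (Not (Cell A (var xW))))) m4).
rewrite 2!posAnd posNot /push /=; rewrite b4U b4W gm4 // A4 !eq3 //.
case: (g u w) => /=; last by rewrite andbF A4 eq3.
case su: (0 < s3 u) => /=; last by rewrite andbF A4 eq3.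
case sw: (s3 w == 0); last by rewrite andbF A4 eq3.
by rewrite Hb ?b4U ?b4W ?A4 ?eq3 ?(eqP sw) // andbT.
Qed.

Lemma foldl_has (T : Type) (p : pred T) b l :
  foldl (fun b x => b || p x) b l = b || has p l.
Proof. by elim: l b => [|x l IH] b /=; rewrite ?orbF // IH orbA. Qed.

Lemma conflict_ext s s' : agrees s s' -> conflict n g s = conflict n g s'.
Proof.
move=> E; apply: eq_in_has => u; rewrite mem_iota => ltu.
by apply: eq_in_has => w; rewrite mem_iota => ltw; rewrite !E.
Qed.

Definition conflict_cmd : cmd :=
  For xU None (For xW None (
    when (And (edge (var xU) (var xW)) (And (Cell aS2 (var xU))
            (Eq (Cell aS2 (var xU)) (Cell aS2 (var xW))))) (assign_var xB (Cst 1)))).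

Lemma conflict_cmdP m : graph_mem m -> m xB 0 = 0 ->
  ev conflict_cmd m xB 0 = conflict n g (m aS2).
Proof.
move=> gm B0; rewrite -[RHS]/(false || conflict n g (m aS2) : nat) -foldl_has.
apply: (for_fold (R := fun m (b : bool) => m xB 0 = b)) => //.
move=> u m1 b1 ltu fr1 eq1; rewrite -foldl_has.
apply: (for_fold (R := fun m (b : bool) => m xB 0 = b)) => //.
move=> w m2 b2 ltw fr2 eq2; rewrite [bound _ _]/= in ltu ltw.
set m3 := mset m2 xW 0 w.
have U3 : m3 xU 0 = u by rewrite /m3 mset_other // fr2 // mset_same.
have W3 : m3 xW 0 = w by rewrite /m3 mset_same.
have fr d : d \notin [:: xU; xW; xB] -> m3 d = m d.
  rewrite !inE !negb_or => /and3P[dU dW dB].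
  rewrite /m3 mset_other // fr2 /= ?inE ?negb_or ?dW //.
  by rewrite mset_other // fr1 //= !inE !negb_or dU dW dB.
have gm3 : graph_mem m3 by apply: graph_frame gm; rewrite fr.
rewrite [ev _ _]/= -/m3 -[_ - _]/(value n (And (edge (var xU) (var xW)) (And (Cell aS2 (var xU))
            (Eq (Cell aS2 (var xU)) (Cell aS2 (var xW))))) m3).
rewrite 2!posAnd posEq /= U3 W3 gm3 // lt0b !fr //.
case: ifP => _; first by rewrite mset_same orbT.
by rewrite orbF /m3 mset_other.
Qed.

Lemma copy_cmdP a b (x : nat) m j : a != x -> b != x -> a != b -> j < n ->
  ev (For x None (Sto a (var x) (Cell b (var x)))) m a j = m b j.
Proof.
move=> ax bx ab ltj; apply: (for_fill (F := m b)) => //; first by rewrite eq_sym.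
move=> i m' _ fr _ k /=; rewrite mset_same (mset_other _ _ _ bx) (mset_other _ _ _ ax).
rewrite !mset_same /=; case: eqP => // _.
by rewrite fr // !inE !negb_or bx eq_sym ab.
Qed.

Lemma try_cmdP e m s v :
  graph_mem m -> agrees (m aS) s -> m xV 0 = v -> v < n ->
  agrees (ev (try_cmd e) m aS) (try_colour n g (m aP) (m aQ) s v (value n e m)).
Proof.
move=> gm eqs xv ltv; set col := value n e m.
pose m1 := mset m xCol 0 col.
pose m2 := ev (For xU None (Sto aS2 (var xU) (Cell aS (var xU)))) m1.
pose m3 := mset m2 aS2 (m2 xV 0) (m2 xCol 0).
pose m4 := ev (closure_cmd aS2 force_cmd) m3.
pose m5 := mset m4 xB 0 0.
pose m6 := ev conflict_cmd m5.
rewrite -[ev (try_cmd e) m]/(ev (unless (var xB)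
   (For xU None (Sto aS (var xU) (Cell aS2 (var xU))))) m6).
have fr2 d : d \notin [:: xCol; xU; aS2] -> m2 d = m d.
  rewrite !inE !negb_or => /and3P[dC dU dS]; rewrite /m2 ev_frame.
    by rewrite /m1 mset_other.
  by rewrite /= !inE negb_or dU.
have fr3 d : d \notin [:: xCol; xU; aS2] -> m3 d = m d.
  by move=> h; rewrite /m3 mset_other ?fr2 //; move: h; rewrite !inE !negb_or => /and3P[].
have fr4 d : d \notin [:: xCol; xR; xU; xW; aS2] -> m4 d = m d.
  rewrite !inE !negb_or => /and5P[dC dR dU dW dS]; rewrite /m4 ev_frame ?fr3 //.
    by rewrite !inE !negb_or dC dU.
  by rewrite /= !inE !negb_or dU dR dW dS.
have fr6 d : d \notin [:: xCol; xR; xU; xW; aS2; xB] -> m6 d = m d.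
  rewrite !inE !negb_or => /and5P[dC dR dU dW /andP[dS dB]]; rewrite /m6 ev_frame.
    by rewrite /m5 mset_other // fr4 // !inE !negb_or dC dR dU dW dS.
  by rewrite /= !inE !negb_or dU dW dB.
have eq3 : agrees (m3 aS2) (assign s v col).
  move=> j ltj; rewrite /m3 mset_same /assign fr2 // xv; case: eqP => _.
    by rewrite /m2 ev_frame // /m1 mset_same.
  by rewrite /m2 copy_cmdP // /m1 mset_other // eqs.
have eq4 : agrees (m4 aS2) (closure n g (other (m aP) (m aQ)) (assign s v col)).
  apply: closure_cmdP => //; first by apply: graph_frame gm; rewrite fr3.
  move=> m' fr' u w ltu ltw su sw j.
  rewrite -[ev force_cmd m']/(if 0 < value n (Eq (Cell aP (var xW)) (Cell aS2 (var xU))) m'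
    then _ else if 0 < value n (Eq (Cell aQ (var xW)) (Cell aS2 (var xU))) m' then _ else m').
  rewrite !posEq /= -/u -/w /other !(fr' aP) // !(fr' aQ) // !fr3 //.
  by do 2! [case: ifP => _; rewrite ?mset_same //]; case: eqP => // ->.
have eq6 : m6 aS2 = m4 aS2 by rewrite /m6 ev_frame // /m5 mset_other.
have B6 : m6 xB 0 = conflict n g (closure n g (other (m aP) (m aQ)) (assign s v col)).
  rewrite /m6 conflict_cmdP /m5 ?mset_same //; last first.
    by apply: graph_frame gm; rewrite mset_other // fr4.
  by congr (nat_of_bool _); apply: conflict_ext => j ltj; rewrite mset_other ?eq4.
rewrite /try_colour -/col.
rewrite [ev _ _]/= B6 lt0b; case: (conflict _ _ _) => /=.
  by rewrite fr6.
move=> j ltj; rewrite -[LHS]/(ev (For xU None (Sto aS (var xU) (Cell aS2 (var xU)))) m6 aS j).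
by rewrite copy_cmdP // eq6 eq4.
Qed.

Lemma ev_then c1 c2 m : ev (c1 ;; c2) m = ev c2 (ev c1 m).
Proof. by []. Qed.

Lemma ev_unless e c m : ev (unless e c) m = if 0 < value n e m then m else ev c m.
Proof. by []. Qed.

Lemma ev_when e c m : ev (when e c) m = if 0 < value n e m then ev c m else m.
Proof. by []. Qed.

Lemma solve_cmdP m : graph_mem m ->
  agrees (ev solve_cmd m aS) (solve n g (m aP) (m aQ)).
Proof.
move=> gm; rewrite /solve_cmd ev_then; set m1 := ev _ m.
apply: (for_fold (R := fun m s => agrees (m aS) s)).
  by move=> j ltj; rewrite /m1 (for_fill (F := fun=> 0)).
move=> v m2 s ltv fr2 eqs; rewrite [bound _ _]/= in ltv.
set m3 := mset m2 xV 0 v.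
have fr3 d : d \in [:: aAdj; aRow; aP; aQ] -> m3 d = m d.
  by rewrite !inE => /or4P[]/eqP->; rewrite /m3 mset_other // fr2 // /m1 ev_frame.
have gm3 : graph_mem m3 by apply: graph_frame gm; rewrite fr3.
have v3 : m3 xV 0 = v by rewrite /m3 mset_same.
have eq3 : agrees (m3 aS) s by rewrite /m3 mset_other.
rewrite ev_unless ev_then ev_unless /solve_vertex.
rewrite [value _ _ m3]/= v3 eq3 //; case: ifP => // _.
set m4 := ev (try_cmd _) m3.
have fr4 d : d \in [:: aAdj; aRow; aP; aQ; xV] -> m4 d = m3 d.
  by rewrite !inE => /or4P[|||/orP[]]/eqP->; rewrite /m4 ev_frame.
have eq4 : agrees (m4 aS) (try_colour n g (m aP) (m aQ) s v (m aP v)).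
  have := try_cmdP (Cell aP (var xV)) gm3 eq3 v3 ltv.
  by rewrite [value _ _ _]/= v3 !fr3.
rewrite [value _ _ m4]/= (fr4 xV) // v3 eq4 //; case: ifP => // _.
have := try_cmdP (Cell aQ (var xV)) (m := m4) _ eq4 _ ltv.
rewrite [value _ _ _]/= !fr4 // v3 !fr3 //; apply=> //.
by apply: graph_frame gm3; rewrite fr4.
Qed.

Lemma accept_cmdP m : graph_mem m ->
  agrees (m aS) (solve n g (m aP) (m aQ)) ->
  agrees (ev accept_cmd m aFin) (accept n g (m aP) (m aQ) (m aFin)).
Proof.
move=> gm eqs; rewrite /accept_cmd 2!ev_then; set m1 := ev _ m; set m2 := ev _ m1.
have eq1 : agrees (m1 aBad) (fun u => 1 - solve n g (m aP) (m aQ) u).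
  move=> j ltj; rewrite /m1 (for_fill (F := fun j => 1 - m aS j)) ?eqs //.
  move=> i m' _ fr _ k /=.
  by rewrite !mset_same /= mset_other // fr.
have eq2 : agrees (m2 aBad) (tainted n g (m aP) (m aQ)).
  apply: closure_cmdP eq1 => //.
  by apply: graph_frame gm; rewrite /m1 ev_frame.
have fr2 d : d \in [:: aS; aFin] -> m2 d = m d.
  by rewrite !inE => /orP[]/eqP->; rewrite /m2 ev_frame // /m1 ev_frame.
move=> j ltj; rewrite (for_fill (F := accept n g (m aP) (m aQ) (m aFin))) //.
move=> i m' lti fr Ei k; rewrite ev_unless [value _ _ _]/= mset_same /= mset_other //.
rewrite fr // eq2 // /accept; case: ifP => _.
  by rewrite mset_other //; case: eqP => // ->; rewrite Ei fr2.
by rewrite /= !mset_same /= !mset_other // fr // fr2 // eqs.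
Qed.

Definition nearb (t : nat -> nat) (v : nat) : bool :=
  has (fun i => g v (t i)) (iota 0 7).

Lemma near_cmdP m : graph_mem m -> (forall i, i < 7 -> m aT i < n) ->
  forall u, u < n -> ev near_cmd m aNear u = nearb (m aT) u.
Proof.
move=> gm ltT; apply: (for_fill (b := None) (F := fun u => nearb (m aT) u)) => //.
move=> u m1 ltu fr1 _ j; rewrite [bound _ _]/= in ltu.
rewrite 2!ev_then; set m2 := ev (assign_var _ _) _; set m3 := ev (For _ _ _) m2.
have E3 : m3 xB 0 = nearb (m aT) u.
  rewrite /m3 (for_assign (p := fun i => g u (m aT i)) (f := fun=> 1)) // => [|i m4 lti fr4].
    rewrite /nearb /m2 /= mset_same /=.
    by do 7! [case: (g u _); rewrite //=].
  rewrite ev_when; set m5 := mset m4 xI 0 i.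
  have I5 : m5 xI 0 = i by rewrite /m5 mset_same.
  have U5 : m5 xU 0 = u by rewrite /m5 mset_other // fr4 // /m2 /= mset_other // mset_same.
  have fr5 d : d \in [:: aAdj; aRow; aT] -> m5 d = m d.
    by rewrite !inE => /or3P[]/eqP->; rewrite /m5 mset_other // fr4 // /m2 /= !mset_other // fr1.
  have gm5 : graph_mem m5 by apply: graph_frame gm; rewrite fr5.
  rewrite [value _ _ _]/= I5 U5 gm5 ?fr5 ?ltT // lt0b.
  by case: ifP; rewrite /= ?mset_same // /m5 mset_other.
have U3 : m3 xU 0 = u by rewrite /m3 ev_frame // /m2 /= mset_other // mset_same.
by rewrite /= mset_same U3 E3 /m3 ev_frame // /m2 /= !mset_other.
Qed.

Definition okb (t : nat -> nat) (v i : nat) : bool :=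
  ~~ has (fun u => [&& g v u, nearb t u & ~~ g u (t i)]) (iota 0 n).

Definition other_col (first : bool) (x : nat) : nat :=
  if first then 1 + (1 - (x - 1)) else 3 - (x - 2).

Definition target_ix (first : bool) (i : nat) : nat := if first then 6 - i else i.

(** [last] describes a loop of conditional assignments, its default being the value held before the
    loop. *)
Definition hit_col (K : nat) (t a : nat -> nat) (first : bool) (v : nat) : nat :=
  last (if first then 1 else 2)
    [seq other_col first (a i) | i <- iota 0 K & g v (t i)].

Definition fold_col (K : nat) (t a : nat -> nat) (first : bool) (v : nat) : nat :=
  if nearb t v then hit_col K t a first v else
  last (hit_col K t a first v)
    [seq a (target_ix first i) | i <- iota 0 7 & okb t v (target_ix first i)].

Definition cand (K : nat) (t a : nat -> nat) (first : bool) (v : nat) : nat :=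
  last (fold_col K t a first v) [seq a i | i <- iota 0 K & t i == v].

Definition static (m : mem) (v : nat) (m' : mem) : Prop :=
  (forall d, d \in [:: aAdj; aRow; aT; aC; aNear] -> m' d = m d) /\ m' xV 0 = v.

Definition disjoint_static (l : seq nat) : bool :=
  all (fun d => d \notin l) [:: aAdj; aRow; aT; aC; aNear; xV].

Lemma static_frame m v m1 m2 l : disjoint_static l ->
  (forall d, d \notin l -> m2 d = m1 d) -> static m v m1 -> static m v m2.
Proof.
move=> /allP dl fr [H1 H2]; split=> [d dd|].
  by rewrite fr ?H1 // dl // -[_ :: _]/([:: aAdj; aRow; aT; aC; aNear] ++ [:: xV]) mem_cat dd.
by rewrite fr // dl.
Qed.

Lemma static_ev m v m1 c : disjoint_static (mods c) -> static m v m1 -> static m v (ev c m1).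
Proof. by move=> dl; apply: static_frame dl _ => d; apply: ev_frame. Qed.

Lemma static_mset m v m1 a i x : disjoint_static [:: a] -> static m v m1 ->
  static m v (mset m1 a i x).
Proof.
by move=> dl; apply: static_frame dl _ => d; rewrite inE => ne; apply: mset_other.
Qed.

Lemma last_const (x y : nat) (p : pred nat) l :
  last x [seq y | i <- l & p i] = if has p l then y else x.
Proof.
elim: l x => //= i l IH x; case: (p i) => //=.
by rewrite IH; case: (has p l).
Qed.

Section Candidates.
Variables (m : mem) (K v : nat).
Hypothesis gm : graph_mem m.
Hypothesis K7 : 7 <= K.
Hypothesis T_lt : forall i, i < K -> m aT i < n.
Hypothesis nearP : forall u, u < n -> m aNear u = nearb (m aT) u.
Hypothesis v_lt : v < n.

Lemma edge_value m1 e1 e2 : static m v m1 -> value n e1 m1 < n -> value n e2 m1 < n ->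
  value n (edge e1 e2) m1 = g (value n e1 m1) (value n e2 m1).
Proof. by move=> [st _] l1 l2; rewrite /= !st // gm. Qed.

Lemma ok_cmdP m1 i : static m v m1 -> i < 7 -> ev ok_cmd m1 aOk i = okb (m aT) v i.
Proof.
move=> st1; move: i; apply: (for_fill (b := Some 7) (F := fun i => okb (m aT) v i)) => //.
move=> i m2 lti fr2 _ j; rewrite [bound _ _]/= in lti.
rewrite 2!ev_then; set m3 := ev (assign_var _ _) _; set m4 := ev (For _ _ _) m3.
have st2 : static m v m2 by apply: static_frame fr2 st1.
have st3 : static m v m3 by apply: static_ev => //; apply: static_mset.
have I3 : m3 xI 0 = i by rewrite /m3 /= mset_other // mset_same.
have E4 : m4 xB 0 = okb (m aT) v i.
  rewrite /m4 (for_assign (f := fun=> 0)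
    (p := fun u => [&& g v u, nearb (m aT) u & ~~ g u (m aT i)])) //.
    by rewrite last_const /m3 /= mset_same /okb; case: (has _ _).
  move=> u m5 ltu fr5; rewrite [bound _ _]/= in ltu.
  rewrite ev_when; set m6 := mset m5 xU 0 u.
  have st6 : static m v m6.
    by apply: static_mset => //; apply: static_frame fr5 st3.
  have [e6 v6] := st6.
  have U6 : m6 xU 0 = u by rewrite /m6 mset_same.
  have I6 : m6 xI 0 = i by rewrite /m6 mset_other // fr5.
  have lti' : m aT i < n by apply: T_lt; apply: leq_trans lti K7.
  rewrite 2!posAnd posNot !edge_value //=; rewrite ?U6 ?I6 ?v6 ?e6 //.
  rewrite nearP // !lt0b eqb0.
  by case: ifP; rewrite /= ?mset_same // /m6 mset_other.
have I4 : m4 xI 0 = i by rewrite /m4 ev_frame.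
by rewrite /= mset_same I4 E4 /m4 ev_frame // /m3 /= !mset_other.
Qed.

Lemma cand_bodyP first A m1 j : A \in [:: aP; aQ] -> static m v m1 ->
  ev (assign_var xP (Cst (if first then 1 else 2)) ;;
    hit_cmd K first ;;
    unless (Cell aNear (var xV)) (ok_cmd ;; fold_cmd first) ;;
    own_cmd K ;;
    Sto A (var xV) (var xP)) m1 A j =
  if j == v then cand K (m aT) (m aC) first v else m1 A j.
Proof.
move=> AA st1; rewrite 4!ev_then.
set m2 := ev (assign_var _ _) _; set m3 := ev (hit_cmd _ _) m2.
set m4 := ev (unless _ _) m3; set m5 := ev (own_cmd _) m4.
have st2 : static m v m2 by apply: static_ev.
have st3 : static m v m3 by apply: static_ev => //; case: (first).
have st4 : static m v m4 by apply: static_ev => //; case: (first).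
have st5 : static m v m5 by apply: static_ev.
have E3 : m3 xP 0 = hit_col K (m aT) (m aC) first v.
  rewrite /m3 (for_assign (p := fun i => g v (m aT i))
     (f := fun i => other_col first (m aC i))) //.
  move=> i m' lti fr; rewrite [bound _ _]/= in lti.
  rewrite ev_when; set m6 := mset m' xI 0 i.
  have st6 : static m v m6.
    by apply: static_mset => //; apply: static_frame fr st2; case: (first).
  have [e6 v6] := st6; have I6 : m6 xI 0 = i by rewrite /m6 mset_same.
  rewrite edge_value //= ?I6 ?v6 ?e6 ?T_lt // lt0b.
  case: ifP => _; last by rewrite /m6 mset_other.
  by rewrite mset_same /=; case: (first); rewrite /= I6 e6.
have E4 : m4 xP 0 = fold_col K (m aT) (m aC) first v.
  rewrite /m4 ev_unless; have [e3 v3] := st3.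
  rewrite [value _ _ _]/= v3 e3 // nearP // lt0b /fold_col -E3.
  case: ifP => // _; rewrite ev_then; set m6 := ev ok_cmd m3.
  have st6 : static m v m6 by apply: static_ev.
  have P6 : m6 xP = m3 xP by rewrite /m6 ev_frame.
  rewrite (for_assign (p := fun i => okb (m aT) v (target_ix first i))
     (f := fun i => m aC (target_ix first i))) ?P6 //.
  move=> i m' lti fr; rewrite [bound _ _]/= in lti.
  rewrite ev_when; set m7 := mset m' xI 0 i.
  have st7 : static m v m7.
    by apply: static_mset => //; apply: static_frame fr st6; case: (first).
  have [e7 v7] := st7; have I7 : m7 xI 0 = i by rewrite /m7 mset_same.
  have tE : value n (target first) m7 = target_ix first i.
    by case: (first); rewrite /= I7.
  have t7 : target_ix first i < 7 by rewrite /target_ix; case: (first); lia.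
  have O7 : m7 aOk = m6 aOk.
    by rewrite /m7 mset_other // fr //; case: (first).
  rewrite [value _ _ _]/= tE O7 /m6 ok_cmdP // lt0b.
  case: ifP => _; last by rewrite /m7 mset_other.
  by rewrite /= mset_same /= tE e7.
have E5 : m5 xP 0 = cand K (m aT) (m aC) first v.
  rewrite /m5 (for_assign (p := fun i => m aT i == v) (f := fun i => m aC i)) ?E4 //.
  move=> i m' lti fr; rewrite [bound _ _]/= in lti.
  rewrite ev_when; set m6 := mset m' xI 0 i.
  have st6 : static m v m6.
    by apply: static_mset => //; apply: static_frame fr st4.
  have [e6 v6] := st6; have I6 : m6 xI 0 = i by rewrite /m6 mset_same.
  rewrite posEq /= v6 I6 e6 //.
  case: ifP => _; last by rewrite /m6 mset_other.
  by rewrite mset_same e6.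
have [_ v5] := st5; rewrite /= mset_same v5 E5.
suff -> : m5 A = m1 A by [].
by move: AA; rewrite !inE => /orP[]/eqP->; rewrite /m5 ev_frame // /m4 ev_frame;
  try (by case: (first)); rewrite /m3 ev_frame ?/m2 ?ev_frame //; case: (first).
Qed.

End Candidates.

Lemma cand_cmdP m K first A : A \in [:: aP; aQ] ->
  graph_mem m -> 7 <= K -> (forall i, i < K -> m aT i < n) ->
  (forall u, u < n -> m aNear u = nearb (m aT) u) ->
  forall v, v < n -> ev (cand_cmd K first A) m A v = cand K (m aT) (m aC) first v.
Proof.
move=> AA gm K7 T_lt nearP.
apply: (for_fill (b := None) (F := cand K (m aT) (m aC) first)).
  by move: AA; rewrite !inE => /orP[]/eqP->.
move=> v m1 ltv fr _ j; rewrite [bound _ _]/= in ltv.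
have st : static m v (mset m1 xV 0 v).
  split; last by rewrite mset_same.
  move=> d dd; rewrite mset_other; last by apply: contraTneq dd => ->.
  move: dd AA; rewrite !inE => /or4P[|||/orP[]]/eqP-> /orP[]/eqP EA;
    by rewrite fr // EA; case: (first).
rewrite (cand_bodyP gm K7 T_lt nearP ltv first j AA st) mset_other //.
by move: AA; rewrite !inE => /orP[]/eqP->.
Qed.

End Refinement.

(** * Correctness *)

Section Guessing.
Variables (n : nat) (g : rel nat) (K : nat).
Hypothesis g_sym : symmetric g.
Hypothesis K7 : 7 <= K.

Notation ev := (ev n).
Notation candK := (cand n g K).

Definition guess_ok (k : nat) (m : mem) : Prop :=
  forall i, k <= i < K -> m aT i < n /\ 0 < m aC i <= 3.

Lemma last_range x s : 0 < x <= 3 -> all (fun y => 0 < y <= 3) s -> 0 < last x s <= 3.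
Proof.
move=> hx /allP hs; have := mem_last x s; rewrite inE => /predU1P[->//|]; exact: hs.
Qed.

Lemma cand_range t a first v :
  (forall i, i < K -> 0 < a i <= 3) -> 0 < candK t a first v <= 3.
Proof.
move=> ha; have sub (p : pred nat) f k : (forall i, i < k -> f i < K) ->
    all (fun y => 0 < y <= 3) [seq a (f i) | i <- iota 0 k & p i].
  move=> hf; apply/allP => y /mapP[i]; rewrite mem_filter mem_iota => /andP[_ lti] ->.
  by apply: ha; apply: hf.
have hit : 0 < hit_col g K t a first v <= 3.
  apply: last_range; first by case: (first).
  apply/allP => y /mapP[i]; rewrite mem_filter mem_iota => /andP[_ /ha] r ->.
  by rewrite /other_col; case: (first); lia.
apply: last_range; last by apply: (sub _ id).
rewrite /fold_col; case: ifP => // _; apply: last_range => //; apply: sub => i lti.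
by rewrite /target_ix; case: (first); lia.
Qed.

Lemma attempt_cmdP m : graph_mem n g m -> guess_ok 0 m ->
  exists P Q, [/\ forall v, v < n -> P v = candK (m aT) (m aC) true v /\
                                     Q v = candK (m aT) (m aC) false v &
    agrees n (ev (attempt_cmd K) m aFin) (accept n g P Q (m aFin))].
Proof.
move=> gm ok; have T_lt i : i < K -> m aT i < n by move=> lti; case: (ok i lti).
rewrite /attempt_cmd 4!ev_then; set m1 := ev near_cmd m.
set m2 := ev _ m1; set m3 := ev _ m2; set m4 := ev solve_cmd m3.
have fr1 d : d \in [:: aAdj; aRow; aT; aC; aFin] -> m1 d = m d.
  by rewrite !inE => /or4P[|||/orP[]]/eqP->; rewrite /m1 ev_frame.
have fr2 d : d \in [:: aAdj; aRow; aT; aC; aFin] -> m2 d = m d.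
  move=> dd; transitivity (m1 d); last exact: fr1.
  by move: dd; rewrite !inE => /or4P[|||/orP[]]/eqP->; rewrite /m2 ev_frame.
have fr3 d : d \in [:: aAdj; aRow; aT; aC; aFin] -> m3 d = m d.
  move=> dd; transitivity (m2 d); last exact: fr2.
  by move: dd; rewrite !inE => /or4P[|||/orP[]]/eqP->; rewrite /m3 ev_frame.
have gm1 : graph_mem n g m1 by apply: graph_frame gm; rewrite fr1.
have gm2 : graph_mem n g m2 by apply: graph_frame gm; rewrite fr2.
have gm3 : graph_mem n g m3 by apply: graph_frame gm; rewrite fr3.
have near1 u : u < n -> m1 aNear u = nearb g (m aT) u.
  by apply: near_cmdP => // i lti; apply: T_lt; lia.
exists (m3 aP), (m3 aQ); split.
  move=> v ltv; split.
    by rewrite /m3 ev_frame // /m2 (cand_cmdP _ _ gm1) // ?(fr1 aT) ?(fr1 aC).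
  rewrite /m3 (cand_cmdP _ _ gm2) // ?(fr2 aT) ?(fr2 aC) // => u ltu.
  by rewrite /m2 ev_frame // near1.
have -> : m aFin = m4 aFin by rewrite /m4 ev_frame // fr3.
have <- : m4 aP = m3 aP by rewrite /m4 ev_frame.
have <- : m4 aQ = m3 aQ by rewrite /m4 ev_frame.
apply: accept_cmdP; first by apply: graph_frame gm3; rewrite /m4 ev_frame.
by rewrite {2 3}/m4 !ev_frame //; apply: solve_cmdP.
Qed.

Definition part_ok (m : mem) : Prop := graph_mem n g m /\ proper_part n g (m aFin).

Lemma proper_part_ext f f' : agrees n f f' -> proper_part n g f' -> proper_part n g f.
Proof.
move=> E [H1 H2]; split=> [u ltu|u w ltu ltw uw]; rewrite !E //; [exact: H1|exact: H2].
Qed.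

Variables (t a : nat -> nat) (U : pred nat).

(* U gets coloured by the attempt with guess (t, a) *)
Definition succeeds : Prop := forall P Q fin,
  (forall v, v < n -> P v = candK t a true v /\ Q v = candK t a false v) ->
  forall u, u < n -> U u -> 0 < accept n g P Q fin u.

Definition matches (k : nat) (m : mem) : Prop :=
  forall i, k <= i < K -> m aT i = t i /\ m aC i = a i.

Definition coloured (m : mem) : Prop := forall u, u < n -> U u -> 0 < m aFin u.

(** The flag [b] tells that the guess [(t, a)] has been passed. Coloured vertices stay coloured, so
    success on [U] survives all later guesses. *)
Definition post (k : nat) (b : bool) (m m' : mem) : Prop :=
  [/\ part_ok m', forall i, k <= i -> m' aT i = m aT i /\ m' aC i = m aC i,
      forall u, u < n -> 0 < m aFin u -> 0 < m' aFin u
    & matches k m -> b -> coloured m'].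

Hypothesis a_range : forall i, i < K -> t i < n /\ 0 < a i <= 3.
Hypothesis succ : succeeds.

Lemma cand_ext t1 a1 t2 a2 first v :
  (forall i, i < K -> t1 i = t2 i /\ a1 i = a2 i) ->
  candK t1 a1 first v = candK t2 a2 first v.
Proof.
move=> E; have E7 i : i < 7 -> t1 i = t2 i /\ a1 i = a2 i by move=> lti; apply: E; lia.
have near_eq u : nearb g t1 u = nearb g t2 u.
  by apply: eq_in_has => i; rewrite mem_iota => /E7[-> _].
have ok_eq i : i < 7 -> okb n g t1 v i = okb n g t2 v i.
  by move=> /E7[Ei _]; rewrite /okb Ei; congr (~~ _); apply: eq_has => u; rewrite near_eq.
rewrite /cand /fold_col /hit_col near_eq.
have seqE (p1 p2 : pred nat) (f1 f2 : nat -> nat) k :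
    (forall i, i < k -> p1 i = p2 i /\ f1 i = f2 i) ->
    [seq f1 i | i <- iota 0 k & p1 i] = [seq f2 i | i <- iota 0 k & p2 i].
  move=> H; rewrite (eq_in_filter (a2 := p2)); last first.
    by move=> i; rewrite mem_iota => /H[].
  by apply/eq_in_map => i; rewrite mem_filter mem_iota => /andP[_ /H[]].
rewrite (seqE (fun i => g v (t1 i)) (fun i => g v (t2 i)) _
  (fun i => other_col first (a2 i))); last by move=> i /E[-> ->].
rewrite (seqE (fun i => okb n g t1 v (target_ix first i))
  (fun i => okb n g t2 v (target_ix first i)) _ (fun i => a2 (target_ix first i))); last first.
  move=> i lti; have lt' : target_ix first i < 7 by rewrite /target_ix; case: (first); lia.
  by rewrite ok_eq //; have [_ ->] := E7 _ lt'.
by rewrite (seqE (fun i => t1 i == v) (fun i => t2 i == v) _ a2) // => i /E[-> ->].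
Qed.

Lemma guess_cmdP k m : k <= K -> part_ok m -> guess_ok k m ->
  post k true m (ev (guess_cmd K k) m).
Proof.
elim: k m => [|k IH] m lek [gm pp] ok.
  have [P [Q [PQ eqF]]] := attempt_cmdP gm ok.
  have PQr v : v < n -> (0 < P v <= 3) && (0 < Q v <= 3).
    move=> ltv; have [-> ->] := PQ v ltv; rewrite !cand_range // => i lti; by case: (ok i lti).
  have [pp' keep] := accept_proper g_sym PQr pp.
  split.
  - split; last exact: proper_part_ext eqF pp'.
    by apply: graph_frame gm; rewrite ev_frame.
  - by move=> i _; rewrite !ev_frame.
  - by move=> u ltu fu; rewrite eqF // keep.
  - move=> mt _ u ltu Uu; rewrite eqF //; apply: succ => // v ltv.
    by have [-> ->] := PQ v ltv; split; apply: cand_ext => i lti; apply: mt.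
pose R (b : bool) m' := [/\ part_ok m', forall i, k.+1 <= i -> m' aT i = m aT i /\ m' aC i = m aC i,
      forall u, u < n -> 0 < m aFin u -> 0 < m' aFin u
    & matches k.+1 m -> b -> coloured m'].
have RS (b : bool) m' x i v : x \notin [:: aAdj; aRow; aT; aC; aFin] -> R b m' -> R b (mset m' x i v).
  rewrite !inE !negb_or => /and5P[h0 h1 h2 h3 h4].
  have fr d : d \in [:: aAdj; aRow; aT; aC; aFin] -> mset m' x i v d = m' d.
    by move=> dd; apply: mset_other; apply: contraTneq dd => ->; rewrite !inE !negb_or h0 h1 h2 h3 h4.
  move=> [[r1 r1'] r2 r3 r4]; split; rewrite ?fr //.
    split; rewrite ?fr //; by apply: graph_frame r1; rewrite fr.
  by move=> h1' h2'; rewrite /coloured fr //; apply: r4.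
have R0 : R false m by split.
suff : R (t k < n) (ev (guess_cmd K k.+1) m).
  have [-> _] := a_range lek; exact.
rewrite [guess_cmd _ _]/=.
(* The flag becomes true once the loop has passed [i = t k]. *)
apply: (for_ind (I := fun i m' => R (t k < i) m')) => // i m1 lti _ R1.
rewrite [bound _ _]/= in lti.
rewrite ev_then; set m2 := ev (Sto _ _ _) _.
have [R2 T2] : R (t k < i) m2 /\ m2 aT k = i.
  have -> : m2 = mset (mset m1 xX 0 i) aT k i by rewrite /m2 /= mset_same.
  rewrite mset_same eqxx; split=> //.
  have := RS _ _ xX 0 i isT R1; set m1' := mset m1 xX 0 i => -[r1 r2 r3 r4].
  have fr d : d \in [:: aAdj; aRow; aC; aFin] -> mset m1' aT k i d = m1' d.
    by rewrite !inE => /or4P[]/eqP->; rewrite mset_other.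
  split.
  - by case: r1 => r1 r1'; split; rewrite ?fr //; apply: graph_frame r1; rewrite fr.
  - by move=> d ltd; rewrite mset_same fr // gtn_eqF //; apply: r2.
  - by rewrite fr.
  - by rewrite /coloured fr.
suff : R ((t k < i) || ((t k == i) && (a k <= 3))) (ev
     (For xY (Some 3) (Sto aC (Cst k) (Plus (var xY) (Cst 1)) ;; guess_cmd K k)) m2) /\
   (ev (For xY (Some 3) (Sto aC (Cst k) (Plus (var xY) (Cst 1)) ;; guess_cmd K k)) m2) aT k = i.
  have [_ /andP[_ ->]] := a_range lek.
  have -> : (t k < i.+1) = (t k < i) || (t k == i) by rewrite ltnS leq_eqVlt orbC.
  by rewrite andbT; case.
(* Round [j] writes colour j + 1, so in the round of vertex [t k] the right colour has been tried as
   soon as [a k <= j]. *)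
apply: (for_ind (I := fun j m' => R ((t k < i) || ((t k == i) && (a k <= j))) m' /\ m' aT k = i)).
  split=> //; have [_ /andP[]] := a_range lek; case: (a k) => // ? _ _.
  by rewrite andbF orbF.
move=> j m3 ltj _ [R3 T3]; rewrite [bound _ _]/= in ltj.
rewrite ev_then; set m4 := ev (Sto _ _ _) _.
have C4 : m4 aC k = j.+1 by rewrite /m4 /= !mset_same eqxx addn1.
have T4 : m4 aT = m3 aT by rewrite /m4 /= !mset_other.
have fr4 d : d \in [:: aAdj; aRow; aFin] -> m4 d = m3 d.
  by rewrite !inE => /or3P[]/eqP->; rewrite /m4 /= !mset_other.
have C4' i' : i' != k -> m4 aC i' = m3 aC i'.
  by move=> ne; rewrite /m4 /= mset_same (negbTE ne) mset_other.
have [[g3 p3] same3 keep3 done3] := R3.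
have ok4 : guess_ok k m4.
  move=> i' /andP[]; rewrite leq_eqVlt => /predU1P[<- _|lt ltK].
    by rewrite T4 T3 C4.
  have [e1 e2] := same3 i' lt.
  by rewrite T4 e1 C4' ?e2; [apply: ok; rewrite lt ltK|rewrite gtn_eqF].
have pp4 : part_ok m4.
  by split; rewrite ?fr4 //; apply: graph_frame g3; rewrite fr4.
have [p5 same5 keep5 done5] := IH m4 (ltnW lek) pp4 ok4.
split; last by have [-> _] := same5 k (leqnn k); rewrite T4.
split=> // [i' lt|u ltu fu|mt].
- have [-> ->] := same5 i' (ltnW lt); have [e1 e2] := same3 i' lt.
  by rewrite T4 e1 C4' ?e2 // gtn_eqF.
- by apply: keep5 => //; rewrite fr4 //; apply: keep3.
case/orP=> [lt u ltu Uu|/andP[/eqP Et]].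
  by apply: keep5 => //; rewrite fr4 //; apply: done3 => //; rewrite lt.
rewrite leq_eqVlt ltnS => /predU1P[Ea|le u ltu Uu]; last first.
  by apply: keep5 => //; rewrite fr4 //; apply: done3 => //; rewrite Et eqxx le orbT.
apply: done5 => // i' /andP[]; rewrite leq_eqVlt => /predU1P[<- _|lt ltK].
  by rewrite T4 T3 C4 Ea Et.
have [e1 e2] := same3 i' lt; rewrite T4 e1 C4' ?e2; last by rewrite gtn_eqF.
by apply: mt; rewrite lt ltK.
Qed.

End Guessing.

(** * From ordinals to natural numbers *)

Section Ordinals.
Variables (n : nat) (G : sgraph 'I_n).

Definition nat_adj (u v : nat) : bool :=
  if insub u is Some i then if insub v is Some j then G i j else false else false.

Lemma nat_adj_ord (i j : 'I_n) : nat_adj i j = G i j.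
Proof. by rewrite /nat_adj !valK. Qed.

Lemma nat_adj_sym : symmetric nat_adj.
Proof.
move=> u v; rewrite /nat_adj; case: (insub u) (insub v) => [i|] [j|] //.
exact: adj_sym.
Qed.

Notation g := nat_adj.

Lemma last_constant (T : eqType) (x y : T) s :
  s != [::] -> (forall z, z \in s -> z = y) -> last x s = y.
Proof.
case: s => // z s _ H; apply: H.
by rewrite /= mem_last.
Qed.

Lemma last_map_nil (T1 T2 : Type) (f : T1 -> T2) x y s :
  s <> [::] -> last y (map f s) = f (last x s).
Proof. by case: s => // z s _; rewrite /= last_map. Qed.

(** The downward scan reverses the list of targets, so its last element is the first target. *)
Lemma rev_targets (a : nat -> nat) (p : pred nat) :
  [seq a (6 - i) | i <- iota 0 7 & p (6 - i)] = rev [seq a i | i <- iota 0 7 & p i].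
Proof.
rewrite -map_rev -filter_rev; have -> : rev (iota 0 7) = [seq 6 - i | i <- iota 0 7] by [].
by rewrite filter_map -map_comp.
Qed.

Section Translate.
Variables (t : seq 'I_n) (x0 : 'I_n) (phi psi : 'I_n -> 'I_3).
Hypothesis t7 : 7 <= size t.

Let K := size t.
Let tn (i : nat) : nat := nth x0 t i.
Let an (i : nat) : nat := (phi (nth x0 t i)).+1.

Lemma nearb_near (u : 'I_n) : nearb g tn u = near G t u.
Proof.
rewrite /nearb /near -(map_nth_iota0 x0 t7) has_map.
by apply: eq_has => i; rewrite /tn /= nat_adj_ord.
Qed.

Lemma okb_fold_ok (v : 'I_n) i : okb n g tn v i = fold_ok G t v (nth x0 t i).
Proof.
rewrite /okb -all_predC; apply/allP/forallP => [H u|H u].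
  have := H (val u); rewrite mem_iota ltn_ord => /(_ isT) /=.
  by rewrite !nat_adj_ord nearb_near; case: (G v u) (near G t u) (G u _) => [] [] [].
rewrite mem_iota => /= ltu; pose w := Ordinal (ltu : u < n); have := H w.
rewrite -[u]/(val w) !nat_adj_ord nearb_near.
by case: (G v w) (near G t w) (G w (nth x0 t i)) => [] [] [].
Qed.

Lemma folds_targets (v : 'I_n) :
  [seq an i | i <- iota 0 7 & okb n g tn v i] = [seq (phi x).+1 : nat | x <- folds G t v].
Proof.
rewrite /folds -(map_nth_iota0 x0 t7) filter_map -map_comp.
by congr map; apply: eq_filter => i; apply: okb_fold_ok.
Qed.

Lemma cand_admissible (v : 'I_n) : admissible G t phi psi v ->
  ((psi v).+1 == cand n g K tn an true v) || ((psi v).+1 == cand n g K tn an false v).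
Proof.
have own : [seq an i | i <- iota 0 K & tn i == v] =
    [seq (phi x).+1 : nat | x <- t & x == v].
  have -> : [seq x <- t | x == v] = [seq x <- [seq nth x0 t i | i <- iota 0 K] | x == v].
    by rewrite map_nth_iota0 // take_size.
  by rewrite filter_map -map_comp.
rewrite /admissible /cand own; case: ifP => [tv|ntv].
  move/eqP->; rewrite (@last_constant _ _ (phi v).+1) ?eqxx //.
    have : v \in [seq x <- t | x == v] by rewrite mem_filter eqxx.
    by case: [seq _ <- _ | _].
  by move=> z /mapP[x]; rewrite mem_filter => /andP[/eqP-> _].
have -> : [seq x <- t | x == v] = [::].
  by apply/eqP; rewrite -(negbK (_ == _)) -has_filter; apply/negP => /hasP[x tx /eqP xv]; rewrite -xv tx in ntv.
(* The program looks only at the last guessed neighbour of [v]; avoiding its colour already leaves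
   no more than the two candidates. *)
have hit : has (G v) t && all (fun x => G v x ==> (psi v != phi x)) t ->
    ((psi v).+1 == hit_col g K tn an true v) || ((psi v).+1 == hit_col g K tn an false v).
  case/andP=> /hasP[x tx vx] /allP H; rewrite /hit_col.
  have : index x t \in [seq i <- iota 0 K | g v (tn i)].
    by rewrite mem_filter mem_iota /= index_mem tx /tn nth_index // nat_adj_ord vx.
  case El: [seq _ <- _ | _] => [//|i0 l] _; rewrite !(last_map_nil _ i0) //.
  have := mem_last i0 l; rewrite /= -El; set i := last i0 l.
  rewrite mem_filter mem_iota => /andP[vi /= lti].
  have := H (nth x0 t i) (mem_nth _ lti).
  rewrite -nat_adj_ord vi /= -val_eqE /other_col /an.
  case: (psi v) (phi (nth x0 t i)) => [[|[|[|//]]] ?] [[|[|[|//]]] ?] //=.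
rewrite /= /fold_col nearb_near; case nv: (near G t v) => /=; first exact: hit.
rewrite rev_targets folds_targets; case: (folds G t v) => [|y s] /=; first exact: hit.
rewrite rev_cons last_rcons last_map.
by case/orP=> /eqP->; rewrite eqxx ?orbT.
Qed.

End Translate.
End Ordinals.

(** * Input, output and the complete program *)

Definition read_cmd : cmd :=
  For xU None (Sto aRow (var xU) (var xCnt) ;;
    For xW None (Rd aAdj (var xCnt) ;; assign_var xCnt (Plus (var xCnt) (Cst 1)))).

Definition answer_cmd : cmd :=
  assign_var xB (Cst 1) ;;
  For xU None (unless (Cell aFin (var xU)) (assign_var xB (Cst 0))) ;;
  Wr (var xB) ;;
  when (var xB) (For xU None (Wr (Cell aFin (var xU)))).

Definition main_cmd (K : nat) : cmd := read_cmd ;; guess_cmd K K ;; answer_cmd.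

Lemma pure_guess K k : pure (guess_cmd K k).
Proof. by elim: k => //= k ->. Qed.

Lemma wf_guess K k : wf (guess_cmd K k).
Proof. by elim: k => //= k ->. Qed.

Lemma wf_main K : wf (main_cmd K).
Proof. by rewrite /= wf_guess. Qed.

Lemma foldl_iota_ind (T : Type) (I : nat -> T -> Prop) (f : T -> nat -> T) t k :
  I 0 t -> (forall i t, i < k -> I i t -> I i.+1 (f t i)) ->
  I k (foldl f t (iota 0 k)).
Proof.
move=> I0 H; suff : forall j, j <= k -> I j (foldl f t (iota 0 j)) by apply.
elim=> // j IH ltj; rewrite -addn1 iotaD cats1 foldl_rcons add0n addn1.
by apply: H => //; apply: IH; apply: ltnW.
Qed.

Section Main.
Variable n : nat.

Lemma run_then c1 c2 s : run n (c1 ;; c2) s = run n c2 (run n c1 s).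
Proof. by case: s => -[m x] y. Qed.

Lemma run_for a b c s : run n (For a b c) s =
  foldl (fun s i => run n c (mset s.1.1 a 0 i, s.1.2, s.2)) s (iota 0 (bound n b)).
Proof. by case: s => -[m x] y. Qed.

(* L is the adjacency matrix row by row, of which k entries have been read. *)
Definition reading (L : seq nat) (k r : nat) (s : state) : Prop :=
  [/\ s.1.2 = drop k L, s.2 = [::], s.1.1 xCnt 0 = k &
    [/\ forall i, i < k -> s.1.1 aAdj i = nth 0 L i,
        forall u, u < r -> s.1.1 aRow u = u * n & forall i, s.1.1 aFin i = 0]].

Lemma read_cmdP L : reading L (n * n) n (run n read_cmd (fun _ _ => 0, L, [::])).
Proof.
rewrite run_for; apply: (foldl_iota_ind (I := fun u s => reading L (u * n) u s)).
  by rewrite mul0n; split; rewrite ?drop0.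
move=> u [[m x] y] ltu [Ex Ey Ec [Ea Er Ef]]; rewrite run_then.
rewrite /= in Ex Ey Ec Ea Er Ef; set s1 := run n (Sto _ _ _) _.
pose m1 := mset (mset m xU 0 u) aRow u (u * n).
have -> : s1 = (m1, x, y) by rewrite /s1 /= mset_same /= mset_other // Ec.
rewrite run_for mulSn addnC.
apply: (foldl_iota_ind (I := fun w s => reading L (u * n + w) u.+1 s)).
  rewrite addn0; split=> //=; split=> [i lti|v|i].
  - by rewrite /m1 !mset_other // Ea.
  - by rewrite /m1 mset_same mset_other // ltnS leq_eqVlt; case: eqP => [->|_] //=; apply: Er.
  - by rewrite /m1 !mset_other.
move=> w [[m2 x2] y2] ltw [/= Ex2 Ey2 Ec2 [Ea2 Er2 Ef2]].
rewrite !mset_other // Ec2; split=> /=.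
- by rewrite Ex2 -drop1 drop_drop add1n addnS.
- by [].
- by rewrite mset_same /= !addnS addn0.
split=> [i|v ltv|i].
- rewrite mset_other // mset_same mset_other // Ex2 addnS ltnS leq_eqVlt.
  case: eqP => [->|_] /=; last exact: Ea2.
  by rewrite -nth0 nth_drop addn0.
- by rewrite !mset_other // Er2.
- by rewrite !mset_other.
Qed.

Lemma answer_cmdP m x :
  (run n answer_cmd (m, x, [::])).2 =
  if all (fun u => 0 < m aFin u) (iota 0 n) then 1 :: [seq m aFin u | u <- iota 0 n]
  else [:: 0].
Proof.
rewrite /answer_cmd run_then run_then run_then.
set m1 := mset m xB 0 1; rewrite -[run n (assign_var _ _) _]/(m1, x, [::]).
set c := For xU None (unless _ _); rewrite (run_pure n m1 x [::] (c := c)) //.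
set m2 := ev n c m1.
have F2 : m2 aFin = m aFin by rewrite /m2 ev_frame // /m1 mset_other.
have B2 : m2 xB 0 = all (fun u => 0 < m aFin u) (iota 0 n).
  rewrite /m2 (for_assign (p := fun u => ~~ (0 < m aFin u)) (f := fun=> 0)) //.
    rewrite last_const /m1 mset_same eqxx -[all _ _]negbK -has_predC.
    rewrite -[has (predC _) _]/(has (fun u => ~~ (0 < m aFin u)) (iota 0 n)).
    by case: (has _ _).
  move=> u m3 ltu fr; rewrite ev_unless [value _ _ _]/= mset_same /= mset_other // fr //.
  rewrite /m1 mset_other //; case: ifP => _ /=; last by rewrite mset_same.
  by rewrite mset_other.
rewrite -[run n (Wr (var xB)) _]/(m2, x, [:: m2 xB 0]) B2.
case: (all _ _) B2 => B2; rewrite [run _ _ _]/= B2 //=.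
rewrite -F2; pose I k (s : state) := s.1.1 aFin = m2 aFin /\ s.2 = 1 :: [seq m2 aFin u | u <- iota 0 k].
suff [] : I n (foldl (fun s i => let: (m0, x0, y) := (mset s.1.1 xU 0 i, s.1.2, s.2) in
     (m0, x0, rcons y (m0 aFin (m0 xU 0)))) (m2, x, [:: 1]) (iota 0 n)) by [].
apply: foldl_iota_ind; first by [].
move=> k [[m3 x3] y3] ltk [/= E3 ->]; split; first by rewrite /= mset_other.
by rewrite iotaS_rcons map_rcons /= mset_same /= mset_other // E3.
Qed.

End Main.

Lemma nth_allpairs (T1 T2 : Type) (x1 : T1) (x2 : T2) (f : T1 -> T2 -> nat) s1 s2 i j :
  i < size s1 -> j < size s2 ->
  nth 0 [seq f x y | x <- s1, y <- s2] (i * size s2 + j) = f (nth x1 s1 i) (nth x2 s2 j).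
Proof.
elim: s1 i => //= x s1 IH [|i] lti ltj.
  by rewrite mul0n add0n nth_cat size_map ltj (nth_map x2).
by rewrite nth_cat size_map mulSn -addnA ltnNge leq_addr /= addKn IH.
Qed.

Theorem theorem1p2 :
  exists (p : program) (a b : nat),
    forall (n : nat) (G : sgraph 'I_n),
      ~ has_induced (path_graph 9) G ->
      ~ has_induced (cycle_graph 3) G ->
      ~ has_induced (cycle_graph 5) G ->
      exists y : seq nat,
        outputs_within p (encode_graph G) y
          (a * size (encode_graph G) ^ b + a) /\
        correct_answer G y.
Proof.
(* 175 = 7 + 28 * 6: a 7-cycle, and at most 6 vertices for each of the 28 kinds. *)
have [K EK] : exists K, K = 175 by exists 175.
(* [K] stays abstract, since otherwise [guess_cmd K K] could unfold into 350 nested loops. *)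
have K7 : 7 <= K by rewrite EK.
have [a [b H]] := compileP (wf_main K).
exists (compile (main_cmd K)), a, b => n G noP9 noC3 noC5.
pose L := [seq nat_of_bool (G i j) | i <- enum 'I_n, j <- enum 'I_n].
exists (run n (main_cmd K) (fun _ _ => 0, L, [::])).2; split.
  apply: H; rewrite leq_add2r leq_mul2l; apply/orP; right.
  (* The encoding has n * n + 1 entries, at least n + 1. *)
  have le1 : n.+1 <= size (encode_graph G).
    by rewrite /= size_allpairs size_enum_ord ltnS; case: (n) => // k; rewrite leq_pmulr.
  by case: (b) => // b'; rewrite leq_exp2r.
have nG := nat_adj_ord G; have g_sym := nat_adj_sym G.
rewrite /main_cmd run_then run_then.
have := read_cmdP n L; case: (run n read_cmd _) => -[mR x] y [_ /= Ey _ [EA ER EF]]; subst y.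
rewrite (run_pure n _ _ _ (pure_guess _ _)) answer_cmdP.
set mF := ev n _ mR.
have gm : graph_mem n (nat_adj G) mR.
  move=> u v ltu ltv; rewrite ER // EA; last first.
    by rewrite -ltn_subRL -mulnBl; apply: leq_trans ltv _; rewrite leq_pmull // subn_gt0.
  have := nth_allpairs (Ordinal ltu) (Ordinal ltu) (fun i j => nat_of_bool (G i j))
     (s1 := enum 'I_n) (s2 := enum 'I_n) (i := u) (j := v).
  rewrite size_enum_ord => -> //; rewrite -nG.
  by rewrite !nth_enum_ord.
have pp : part_ok n (nat_adj G) mR.
  by split=> //; split=> [u ltu|u w ltu ltw uw]; rewrite !EF.
have okK : guess_ok n K K mR by move=> i /andP[h1 h2]; move: (leq_trans h2 h1); rewrite ltnn.
have mFP t a' U : (forall i, i < K -> t i < n /\ 0 < a' i <= 3) ->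
    succeeds n (nat_adj G) K t a' U -> post n (nat_adj G) K t a' U K true mR mF.
  by move=> h1 h2; apply: guess_cmdP.
have [mF3 mFp] : proper_part n (nat_adj G) (mF aFin).
  (* Soundness needs no good guess: an empty [U] suffices, with an arbitrary guess, which exists as
     soon as there is a vertex 0. *)
  have [n0|n0] := posnP n; last first.
    have [||[] //] := mFP (fun=> 0) (fun=> 1) pred0; first by move=> i _; rewrite n0.
    by move=> P Q fin PQ u.
  by split=> [u ltu|u w ltu]; have := ltu; rewrite [X in _ < X]n0.
(* Every vertex [u] owes its colour to a guess that is good for its own component; different
   components may rely on different guesses. *)
have complete : three_colourable G -> forall u, u < n -> 0 < mF aFin u.
  move=> [phi phi_col] u ltu; pose r := Ordinal ltu.
  have [t [psi [szt [psi_col adm]]]] := good_guess_exists noP9 noC3 noC5 phi_col r.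
  rewrite -EK in szt.
  pose U (v : nat) : bool := if insub v is Some i then connect G r i else false.
  have Uord (i : 'I_n) : U i = connect G r i by rewrite /U valK.
  pose tn i : nat := nth r t i; pose an i := (phi (nth r t i)).+1.
  have suc : succeeds n (nat_adj G) K tn an U.
    move=> P Q fin PQ v ltv Uv.
    pose ps (v : nat) : nat := if insub v is Some i then (psi i).+1 else 0.
    have psord (i : 'I_n) : ps i = (psi i).+1 by rewrite /ps valK.
    apply: (@accept_succeeds n (nat_adj G) g_sym P Q _ fin U ps) => //.
    - move=> w ltw; have [-> ->] := PQ w ltw.
      by rewrite !cand_range // => i _; rewrite /an; case: (phi _) => [[|[|[|]]]].
    - move=> w w' ltw ltw'; rewrite -[w]/(val (Ordinal ltw)) -[w']/(val (Ordinal ltw')).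
      rewrite nG !Uord => ww' rw; exact: connect_trans1 rw ww'.
    - move=> w w' ltw ltw'; rewrite -[w]/(val (Ordinal ltw)) -[w']/(val (Ordinal ltw')).
      by rewrite nG Uord !psord eqSS val_eqE => ww' rw; apply: psi_col ww'.
    - move=> w ltw Uw; have [-> ->] := PQ w ltw; move: Uw.
      rewrite -[w]/(val (Ordinal ltw)) Uord psord => rw.
      have t7 : 7 <= size t by rewrite szt.
      by have := cand_admissible r t7 (adm _ rw); rewrite szt.
  have [|_ _ _ done] := mFP tn an U _ suc.
    by move=> i _; rewrite /tn /an ltn_ord; case: (phi _) => [[|[|[|]]]].
  apply: done => //; last by rewrite -[u]/(val r) Uord connect0.
  by move=> i /andP[h1 h2]; move: (leq_trans h2 h1); rewrite ltnn.
case: ifP => [/allP fin|nfin].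
  have fin0 (i : 'I_n) : 0 < mF aFin i by apply: fin; rewrite mem_iota ltn_ord.
  have finlt (i : 'I_n) : (mF aFin i).-1 < 3.
    by have := mF3 i (ltn_ord i); have := fin0 i; case: (mF aFin i).
  left; exists (fun i => Ordinal (finlt i)).
    move=> i j ij; rewrite -val_eqE /=; have := mFp i j (ltn_ord i) (ltn_ord j).
    rewrite nG ij => /(_ isT (fin0 i)) /andP[fj].
    by move: (fin0 i) fj; case: (mF aFin i) (mF aFin j) => [|x'] [|y'].
  congr cons; rewrite /encode_colouring -val_enum_ord -map_comp.
  by apply: eq_map => i /=; rewrite prednK.
right; split=> // col; move/negbT/allPn: nfin => [u]; rewrite mem_iota => /= ltu.
by rewrite complete.
Qed.
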